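(* Let $X=(X_k)_{k\in\mathbb{Z}^d}$ be a stationary and ergodic process with values in $\{0,1\}$, let $\mu$ be its spectral measure, and let $\chi=\{k\in\mathbb{Z}^d: X_k=1\}$. (1) The process $\chi$ admits almost everywhere an autocorrelation $\gamma$, and $$\gamma=\sum_{k\in\mathbb{Z}^d}E(X_0X_k)\,\delta_k.$$ (2) The diffraction measure is $\widehat{\gamma}=\mu_p$, where $\mu_p$ is the $\mathbb{Z}^d$-periodic measure on $\mathbb{R}^d$ associated with $\mu$ by $$\mu_p(A)=\sum_{k\in\mathbb{Z}^d}\mu(A-k),\quad A\in\mathcal{B}(\mathbb{R}^d).$$
   Context: Stationary and ergodic mean with respect to the shift action of $\mathbb{Z}^d$ on $\{0,1\}^{\mathbb{Z}^d}$. The spectral measure $\mu$ of $X$ is the finite positive measure on the torus $\mathbb{R}^d/\mathbb{Z}^d$, identified with a measure on $[0,1[^d\subset\mathbb{R}^d$, such that $\widehat{\mu}(k)=\int e^{-2i\pi k\cdot t}\,d\mu(t)=E(X_0X_k)$ for all $k\in\mathbb{Z}^d$ (the process is not centered). Fourier transforms use the kernel $e^{-2i\pi x\cdot t}$, and are taken in the sense of tempered distributions for tempered measures. $\mathcal{B}(\mathbb{R}^d)$ is the Borel $\sigma$-algebra and $\delta_x$ is the Dirac measure at $x$. For a locally finite set $\chi\subset\mathbb{R}^d$, let $\gamma_R=\frac{1}{|B_R|}\sum_{x,y\in\chi\cap B_R}\delta_{y-x}$, where $B_R$ is the ball of radius $R$ centered at $0$ and $|\cdot|$ is Lebesgue measure.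 If $\gamma_R$ converges in the vague topology as $R\to\infty$, the limit $\gamma$ is called the autocorrelation of $\chi$; it is a tempered measure whose Fourier transform $\widehat{\gamma}$ is a positive measure, called the diffraction measure of $\chi$. *)

(* Defs.v *)
(* Built on MathComp and MathComp-Analysis; the real numbers are an arbitrary
   [R : realType] and R^d is ['rV[R]_d], with its product topology. *)
From HB Require Import structures.
From mathcomp Require Import all_boot all_order all_algebra.
From mathcomp Require Import all_classical all_reals all_analysis.
From mathcomp Require Import measurable_realfun.
From mathcomp Require Import complex.

Set Implicit Arguments.
Unset Strict Implicit.
Unset Printing Implicit Defensive.

Import Order.TTheory GRing.Theory Num.Theory.
Import numFieldNormedType.Exports.

Local Open Scope classical_set_scope.
Local Open Scope ring_scope.

(* R^d with its Borel sigma-algebra; the carrier is 'rV[R]_d. *)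
Notation borel_rV R d := (g_sigma_algebraType (@open 'rV[R]_d)).

Section borel_rV_theory.
Context {R : realType} {d : nat}.

Lemma measurable_borel_coord i :
  measurable_fun [set: borel_rV R d] (fun x : borel_rV R d => x ord0 i).
Proof.
apply: (measurability _ (RGenOInfty.measurableE R)).
move=> _ [_ [x ->] <-]; rewrite setTI; apply: sub_sigma_algebra.
have : open `]x, +oo[%classic by exact: interval_open.
by move/continuousP : (@coord_continuous R 1 d ord0 i); exact.
Qed.

Lemma open_rV_bigcup (U : set 'rV[R]_d) : open U ->
  U = \bigcup_(qe in [set qe : 'rV[rat]_d * rat |
         [set x : 'rV[R]_d | forall i, `|ratr (qe.1 ord0 i) - x ord0 i| < ratr qe.2]
           `<=` U])
      [set x : 'rV[R]_d | forall i, `|ratr (qe.1 ord0 i) - x ord0 i| < ratr qe.2].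
Proof.
move=> oU; apply/seteqP; split => [x Ux|x [qe]/= + xqe]; last exact.
have /nbhs_ballP[e /= e0 eU] : nbhs x U by exact: open_nbhs_nbhs.
have [r] := @rat_in_itvoo R 0 (e / 2) (divr_gt0 e0 (ltr0n _ 2)).
rewrite in_itv/= => /andP[r0 re].
have /choice[q qP] (i : 'I_d) : exists q : rat, `|ratr q - x ord0 i| < ratr r.
  have /rat_in_itvoo[q] : x ord0 i - ratr r < x ord0 i + ratr r.
    by rewrite ltrD2l gtrN.
  by rewrite in_itv/= -ltr_distl => ?; exists q.
exists (\row_i q i, r) => /=; last by move=> i; rewrite mxE.
move=> y /= yq; apply: eU; split => // j i; rewrite (ord1 j).
have {}yq := yq i; rewrite mxE in yq.
rewrite -ball_normE/=.
rewrite (_ : x ord0 i - y ord0 i =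
  (x ord0 i - ratr (q i)) + (ratr (q i) - y ord0 i)); last by rewrite addrA subrK.
rewrite (le_lt_trans (ler_normD _ _))// [e]splitr ltrD// (lt_trans _ re)//.
by rewrite distrC.
Qed.

Lemma measurable_fun_rV d' (T : measurableType d') (f : T -> 'rV[R]_d) :
  (forall i, measurable_fun [set: T] (fun t => f t ord0 i)) ->
  measurable_fun [set: T] (f : T -> borel_rV R d).
Proof.
move=> mf; apply: (@measurability _ _ T (borel_rV R d) setT f (@open 'rV[R]_d)) => //.
move=> _ [U oU <-]; rewrite setTI (open_rV_bigcup oU) bigcup_mkcond.
rewrite preimage_bigcup; apply: countable_bigcupT_measurable => // -[q e].
case: ifPn => _; last by rewrite preimage_set0.
rewrite (_ : _ @^-1` _ = \bigcap_(i in [set: 'I_d])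
    [set t | `|ratr (q ord0 i) - f t ord0 i| < ratr e]); last first.
  by apply/seteqP; split => t //= h i; [move=> _|]; apply: h.
apply: fin_bigcap_measurable => // i _.
rewrite (_ : mkset _ = (fun t => f t ord0 i) @^-1` ball (ratr (q ord0 i) : R) (ratr e)).
  rewrite -[X in measurable X]setTI; apply: mf => //.
  exact: measurable_ball.
by apply/seteqP; split=> t; rewrite /= -ball_normE.
Qed.

End borel_rV_theory.

Section esum_measure.
Local Open Scope ereal_scope.
Context d (T : measurableType d) (R : realType) (I : choiceType).
Variables (S : set I) (m : I -> {measure set T -> \bar R}).

Definition esum_measure (A : set T) : \bar R := \esum_(i in S) m i A.

Let esum_measure0 : esum_measure set0 = 0.
Proof. by rewrite /esum_measure esum1// => i _; rewrite measure0. Qed.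

Let esum_measure_ge0 A : 0 <= esum_measure A.
Proof. by apply: esum_ge0 => i _; exact: measure_ge0. Qed.

Let esum_measure_sigma_additive : semi_sigma_additive esum_measure.
Proof.
move=> F mF tF mUF.
rewrite [X in _ --> X](_ : _ = \sum_(n <oo) esum_measure (F n)).
  by apply: is_cvg_nneseries => n _ _; exact: esum_measure_ge0.
rewrite nneseries_esumT//= /esum_measure.
rewrite esum_esum; last by move=> *; exact: measure_ge0.
rewrite (_ : setT `*`` _ = [set: nat] `*` S); last by apply/seteqP; split.
transitivity (\esum_(i in S) \esum_(n in [set: nat]) m i (F n)).
  apply: eq_esum => i _; rewrite -nneseries_esumT; last first.
    by move=> n; exact: measure_ge0.
  by apply/esym/cvg_lim => //; exact: measure_semi_sigma_additive.
rewrite esum_esum; last by move=> *; exact: measure_ge0.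
rewrite (reindex_esum (S `*`` (fun=> [set: nat])) _ (fun k => (k.2, k.1)))//.
split => [[i n] []//|[i n] [j k] _ _ []-> ->//|[n i] [_ Si]].
by exists (i, n).
Qed.

HB.instance Definition _ := isMeasure.Build _ _ _ esum_measure
  esum_measure0 esum_measure_ge0 esum_measure_sigma_additive.

End esum_measure.

(* Lebesgue measure on R^d, as the d-fold product of Lebesgue measure on R. *)
Section lebesgue_rV.
Local Open Scope ereal_scope.
Context {R : realType}.

Definition cons_rV n (p : R * 'rV[R]_n) : 'rV[R]_n.+1 := row_mx p.1%:M p.2.

Definition uncons_rV n (x : 'rV[R]_n.+1) : R * 'rV[R]_n :=
  (x ord0 ord0, \row_j x ord0 (lift ord0 j)).

Lemma cons_rV0 n (p : R * 'rV[R]_n) : cons_rV p ord0 ord0 = p.1.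
Proof.
rewrite /cons_rV (_ : ord0 = @lshift 1 n ord0); last exact: val_inj.
by rewrite (row_mxEl p.1%:M p.2) mxE eqxx.
Qed.

Lemma cons_rVS n (p : R * 'rV[R]_n) j : cons_rV p ord0 (lift ord0 j) = p.2 ord0 j.
Proof.
rewrite /cons_rV (_ : lift ord0 j = @rshift 1 n j); last exact: val_inj.
by rewrite (row_mxEr p.1%:M p.2).
Qed.

Lemma cons_rVK n : cancel (@cons_rV n) (@uncons_rV n).
Proof.
move=> p; rewrite /uncons_rV cons_rV0 [RHS]surjective_pairing; congr (_, _).
by apply/rowP => j; rewrite mxE cons_rVS.
Qed.

Lemma uncons_rVK n : cancel (@uncons_rV n) (@cons_rV n).
Proof.
move=> x; apply/rowP => i; case: (unliftP ord0 i) => [j ->|->].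
  by rewrite cons_rVS mxE.
by rewrite cons_rV0.
Qed.

Lemma measurable_cons_rV n :
  measurable_fun [set: measurableTypeR R * borel_rV R n]
    (@cons_rV n : _ -> borel_rV R n.+1).
Proof.
apply: measurable_fun_rV => i; case: (unliftP ord0 i) => [j ->|->].
  under eq_fun do rewrite cons_rVS.
  exact: (measurableT_comp (measurable_borel_coord j) measurable_snd).
under eq_fun do rewrite cons_rV0.
exact: measurable_fst.
Qed.

Lemma measurable_uncons_rV n :
  measurable_fun [set: borel_rV R n.+1]
    (@uncons_rV n : _ -> measurableTypeR R * borel_rV R n).
Proof.
apply: measurable_fun_pair; first exact: measurable_borel_coord.
apply: measurable_fun_rV => i; under eq_fun do rewrite mxE.
exact: measurable_borel_coord.
Qed.

Section lebesgue_cons.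
Context n (m : {sigma_finite_measure set (borel_rV R n) -> \bar R}).

Definition lebesgue_cons : set (borel_rV R n.+1) -> \bar R :=
  pushforward (lebesgue_measure \x m) (@cons_rV n : _ -> borel_rV R n.+1).

Let mcons := @measurable_cons_rV n.

Let lebesgue_cons0 : lebesgue_cons set0 = 0.
Proof. exact: measure0. Qed.

Let lebesgue_cons_ge0 A : 0 <= lebesgue_cons A.
Proof. exact: measure_ge0. Qed.

Let lebesgue_cons_sigma_additive : semi_sigma_additive lebesgue_cons.
Proof. exact: measure_semi_sigma_additive. Qed.

HB.instance Definition _ := isMeasure.Build _ _ _ lebesgue_cons
  lebesgue_cons0 lebesgue_cons_ge0 lebesgue_cons_sigma_additive.

Let lebesgue_cons_sigma_finite : sigma_finite setT lebesgue_cons.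
Proof.
have /sigma_finiteP[F [FT ndF Foo]] := sigma_finiteT (@lebesgue_measure R).
have /sigma_finiteP[G [GT ndG Goo]] := sigma_finiteT m.
have mFG i : measurable (F i `*` G i).
  by apply: measurableX; [exact: (Foo i).1|exact: (Goo i).1].
exists (fun i => @uncons_rV n @^-1` (F i `*` G i)).
  rewrite -preimage_bigcup (_ : \bigcup_i _ = setT) ?preimage_setT//.
  apply/seteqP; split => // -[x y] _.
  have [i _ Fx] : (\bigcup_i F i) x by rewrite -FT.
  have [j _ Gy] : (\bigcup_i G i) y by rewrite -GT.
  exists (maxn i j) => //; split => /=.
    by move: Fx; exact/subsetPset/ndF/leq_maxl.
  by move: Gy; exact/subsetPset/ndG/leq_maxr.
move=> i; split.
  by rewrite -[X in measurable X]setTI; exact: measurable_uncons_rV.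
rewrite /lebesgue_cons /pushforward (_ : _ @^-1` _ = F i `*` G i); last first.
  by apply/funext => p; exact: (congr1 (F i `*` G i) (cons_rVK p)).
have [[mF Fi] [mG Gi]] := (Foo i, Goo i).
by rewrite product_measure1E// lte_mul_pinfty// ge0_fin_numE.
Qed.

HB.instance Definition _ := Measure_isSigmaFinite.Build _ _ _ lebesgue_cons
  lebesgue_cons_sigma_finite.

End lebesgue_cons.

Fixpoint lebesgue_rV n : {sigma_finite_measure set (borel_rV R n) -> \bar R} :=
  match n return {sigma_finite_measure set (borel_rV R n) -> \bar R} with
  | 0%N => @dirac _ (borel_rV R 0) 0%R R
  | n'.+1 => lebesgue_cons (lebesgue_rV n')
  end.

End lebesgue_rV.

Section euclidean.
Context {R : realType} {d : nat}.
Implicit Types x y : 'rV[R]_d.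

Definition dotp x y : R := \sum_i x ord0 i * y ord0 i.

(* The norm [`|x|] of 'rV[R]_d is the sup norm. *)
Definition enorm x : R := Num.sqrt (dotp x x).

Definition eball (r : R) : set (borel_rV R d) := [set x : 'rV[R]_d | enorm x < r].

Definition lattice_pt (k : 'rV[int]_d) : 'rV[R]_d := map_mx intr k.

End euclidean.

Section complex_integral.
Context d (T : measurableType d) (R : realType).
Variable mu : {measure set T -> \bar R}.
Implicit Type f : T -> R[i].

Definition cintegrable f :=
  mu.-integrable [set: T] (fun x => (complex.Re (f x))%:E) /\
  mu.-integrable [set: T] (fun x => (complex.Im (f x))%:E).

Definition cintegral f : R[i] :=
  ((\int[mu]_x complex.Re (f x)) +i* (\int[mu]_x complex.Im (f x)))%C.

End complex_integral.

Section schwartz.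
Context {R : realType} {d : nat}.
Implicit Types (g : 'rV[R]_d -> R) (f : 'rV[R]_d -> R[i]).

(* Iterated partial derivative along the list of coordinates s. *)
Fixpoint pderive (s : seq 'I_d) g : 'rV[R]_d -> R :=
  if s is i :: s' then fun x => 'D_(delta_mx ord0 i) (pderive s' g) x else g.

Definition smooth g := forall s : seq 'I_d,
  continuous (pderive s g) /\
  forall i x, derivable (pderive s g) x (delta_mx ord0 i).

Definition cpderive s f (x : 'rV[R]_d) : R[i] :=
  (pderive s (fun y => complex.Re (f y)) x +i*
   pderive s (fun y => complex.Im (f y)) x)%C.

Definition csmooth f :=
  smooth (fun y => complex.Re (f y)) /\ smooth (fun y => complex.Im (f y)).

Definition monomial (a : 'I_d -> nat) (x : 'rV[R]_d) : R :=
  \prod_i x ord0 i ^+ a i.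

(* sup_x |x^a (d^s f)(x)| <= M *)
Definition seminorm_le (a : 'I_d -> nat) (s : seq 'I_d) f (M : R) :=
  forall x, `|(monomial a x)%:C%C * cpderive s f x| <= M%:C%C.

Definition schwartz f :=
  csmooth f /\ forall a s, exists M, seminorm_le a s f M.

(* mu is tempered if f |-> \int f dmu is a tempered distribution, that is, a
   well-defined continuous linear form on the Schwartz space. *)
Definition tempered (mu : {measure set (borel_rV R d) -> \bar R}) :=
  (forall f, schwartz f -> cintegrable mu f) /\
  exists (N : nat) (C : R), forall f M, schwartz f ->
    (forall a s, (\sum_i a i <= N)%N -> (size s <= N)%N -> seminorm_le a s f M) ->
    `|cintegral mu f| <= (C * M)%:C%C.

End schwartz.

Section fourier.
Context {R : realType} {d : nat}.

(* exp(- 2 i pi x.t) *)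
Definition fourier_kernel (x t : 'rV[R]_d) : R[i] :=
  (cos (2 * pi * dotp x t) -i* sin (2 * pi * dotp x t))%C.

Definition fourier (f : 'rV[R]_d -> R[i]) (x : 'rV[R]_d) : R[i] :=
  cintegral (lebesgue_rV d) (fun t : borel_rV R d => f t * fourier_kernel x t).

(* The Fourier transform of the tempered distribution gamma is defined by
   duality, f |-> <gamma, fourier f>. *)
Definition is_fourier_transform
    (gamma nu : {measure set (borel_rV R d) -> \bar R}) :=
  [/\ tempered gamma, tempered nu &
    forall f, schwartz f -> cintegral gamma (fourier f) = cintegral nu f].

End fourier.

Section diffraction.
Context {R : realType} {d : nat}.
Implicit Types (chi : set 'rV[R]_d) (r : R).
Implicit Types (m gamma nu : {measure set (borel_rV R d) -> \bar R}).

Definition locally_finite chi := forall r, finite_set (chi `&` eball r).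

Definition locally_finite_measure m := forall K : set 'rV[R]_d, compact K ->
  (m K < +oo)%E.

Definition vague_cvg (m_ : R -> {measure set (borel_rV R d) -> \bar R}) m :=
  forall f : 'rV[R]_d -> R, continuous f ->
    compact (closure [set x | f x != 0]) ->
    (\int[m_ r]_x f x) @[r --> +oo] --> \int[m]_x f x.

Lemma inv_vol_ge0 r :
  0 <= (fine (lebesgue_rV d (@eball R d r)))^-1.
Proof. by rewrite invr_ge0 fine_ge0. Qed.

(* gamma_r = |B_r|^-1 sum_(x, y in chi cap B_r) delta_(y - x) *)
Definition averaged_differences chi r : {measure set (borel_rV R d) -> \bar R} :=
  mscale (NngNum (inv_vol_ge0 r))
    (esum_measure ((chi `&` eball r) `*` (chi `&` eball r))
      (fun xy => @dirac _ (borel_rV R d) (xy.2 - xy.1) R)).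

Definition is_autocorrelation chi gamma :=
  [/\ locally_finite chi, locally_finite_measure gamma &
    vague_cvg (averaged_differences chi) gamma].

Definition is_diffraction chi nu := exists gamma,
  is_autocorrelation chi gamma /\ is_fourier_transform gamma nu.

End diffraction.

Section periodization.
Local Open Scope ereal_scope.
Context {R : realType} {d : nat}.
Variable mu : {measure set (borel_rV R d) -> \bar R}.

(* The image set is A - k. *)
Definition periodization (A : set (borel_rV R d)) : \bar R :=
  \esum_(k in [set: 'rV[int]_d])
    mu [set (x - lattice_pt k)%R | x in (A : set 'rV[R]_d)].

Definition translation (k : 'rV[int]_d) : borel_rV R d -> borel_rV R d :=
  fun x : 'rV[R]_d => (x + lattice_pt k)%R.

Lemma measurable_translation k : measurable_fun setT (translation k).
Proof.
apply: measurable_fun_rV => i; under eq_fun do rewrite mxE.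
by apply: measurable_funD => //; exact: measurable_borel_coord.
Qed.

Definition translate k : set (borel_rV R d) -> \bar R :=
  pushforward mu (translation k).

Let translate0 k : translate k set0 = 0.
Proof. by have := measurable_translation k => ?; exact: measure0. Qed.

Let translate_ge0 k A : 0 <= translate k A.
Proof. by have := measurable_translation k => ?; exact: measure_ge0. Qed.

Let translate_sigma_additive k : semi_sigma_additive (translate k).
Proof.
by have := measurable_translation k => ?; exact: measure_semi_sigma_additive.
Qed.

HB.instance Definition _ k := isMeasure.Build _ _ _ (translate k)
  (translate0 k) (@translate_ge0 k) (@translate_sigma_additive k).

Lemma periodizationE : periodization = esum_measure [set: 'rV[int]_d] translate.
Proof.
apply/funext => A; apply: eq_esum => k _; congr (mu _).
apply/seteqP; split=> [_ /= [x Ax <-]|x /= Ax].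
  by rewrite /translation /= subrK.
by exists (translation k x) => //; rewrite /translation addrK.
Qed.

Let periodization0 : periodization set0 = 0.
Proof. by rewrite periodizationE measure0. Qed.

Let periodization_ge0 A : 0 <= periodization A.
Proof. by rewrite periodizationE measure_ge0. Qed.

Let periodization_sigma_additive : semi_sigma_additive periodization.
Proof. by rewrite periodizationE; exact: measure_semi_sigma_additive. Qed.

HB.instance Definition _ := isMeasure.Build _ _ _ periodization
  periodization0 periodization_ge0 periodization_sigma_additive.

End periodization.

(* A {0,1}-valued process indexed by Z^d is a family of bool-valued random
   variables; {0,1}^(Z^d) is ['rV[int]_d -> bool]. *)
Section process.
Context {d : nat} {dT : measure_display} {T : measurableType dT} {R : realType}.
Variables (P : probability T R) (X : 'rV[int]_d -> {mfun T >-> bool}).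

Definition shift_conf (k : 'rV[int]_d) (x : 'rV[int]_d -> bool) :
  'rV[int]_d -> bool := fun j => x (j + k).

(* The product sigma-algebra of {0,1}^(Z^d), generated by the coordinates. *)
Definition measurable_conf : set (set ('rV[int]_d -> bool)) :=
  <<s [set A | exists k, A = [set x | x k = true]] >>.

Definition process_law (A : set ('rV[int]_d -> bool)) : \bar R :=
  P [set w | A (fun k => X k w)].

Definition stationary := forall k A, measurable_conf A ->
  process_law (shift_conf k @^-1` A) = process_law A.

Definition ergodic := forall A, measurable_conf A ->
  (forall k, shift_conf k @^-1` A = A) ->
  process_law A = 0%E \/ process_law A = 1%E.

Definition correlation (k : 'rV[int]_d) : R :=
  fine 'E_P[fun w => (X 0 w)%:R * (X k w)%:R].

Lemma correlation_ge0 k : 0 <= correlation k.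
Proof.
rewrite fine_ge0// unlock; apply: integral_ge0 => w _.
by rewrite lee_fin mulr_ge0.
Qed.

(* A measure on the torus is a measure on R^d carried by [0,1[^d. *)
Definition is_spectral_measure
    (mu : {finite_measure set (borel_rV R d) -> \bar R}) :=
  mu (~` [set x : 'rV[R]_d | forall i, 0 <= x ord0 i < 1]) = 0%E /\
  forall k, cintegral mu (fourier_kernel (lattice_pt k)) = (correlation k)%:C%C.

(* sum_(k in Z^d) E(X_0 X_k) delta_k *)
Definition correlation_comb : {measure set (borel_rV R d) -> \bar R} :=
  esum_measure [set: 'rV[int]_d]
    (fun k => mscale (NngNum (correlation_ge0 k))
      (@dirac _ (borel_rV R d) (lattice_pt k) R)).

Definition point_set (w : T) : set 'rV[R]_d :=
  [set lattice_pt k | k in [set k | X k w = true]].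

End process.

(* Main.v *)
(* (1) A stopping-time argument bounds the integral of the limsup of the ergodic
   averages of a [0,1]-valued function along one direction by its mean. Applied
   one coordinate at a time, to the function and to its complement, and combined
   with ergodicity, it yields the almost sure convergence of the averages of
   X_0 X_k over long boxes in each orthant. A ball of large radius is
   approximated by a bounded number of cubes whose side is proportional to the
   radius, so the averages over balls converge too; these are the masses at the
   points k of the measures gamma_R, which are carried by Z^d.

   (2) This is Poisson summation integrated against mu. Averaging a Fourier
   integral over half-period translations replaces the function by its second
   differences in the coordinates i where k_i != 0, hence decay like
   prod_i (1 + k_i^2)^-1 at the lattice points k. The sums sum_k ghat(k) exp(2 i pi k.u)
   and sum_m g(u + m) then define continuous functions of u with the same Fourier
   coefficients on the unit cell; testing their difference against the powers of
   prod_i (1 + cos (2 pi u_i)) / 2, which concentrate at 0, shows that they agree at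
   u = 0, and at every u after a translation of g. Integrating in u against mu
   turns exp(2 i pi k.u) into E(X_0 X_k), which is real, so only cosines
   survive. *)
From HB Require Import structures.
Require Import Defs.
From mathcomp Require Import all_boot all_order all_algebra.
From mathcomp Require Import all_classical all_reals all_analysis.
From mathcomp Require Import measurable_realfun.
From mathcomp Require Import complex zify ring lra.
Import Order.TTheory GRing.Theory Num.Theory.
Import numFieldNormedType.Exports.
Local Open Scope classical_set_scope.
Local Open Scope ring_scope.
Set Implicit Arguments.
Unset Strict Implicit.
Unset Printing Implicit Defensive.

(** * A maximal bound for ergodic averages *)

(** The coordinates are combined through a majorant rather than a limit. Past a threshold [N], the
    averages of [g] along one direction are dominated at every point by a function [V] with values
    in [0,1], whose integral exceeds that of [g] by at most [e]; such a [V] can be fed to the next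
    direction, whatever the relative sizes of the sides. The bound on its integral shows only that
    the set where box averages stay asymptotically below some [q] above the mean is not null. That
    set is invariant because a shift alters a box sum by a face, and ergodicity then gives it full
    measure. On the Fourier side, sums over Z^d are integrals for [dirac_comb], so that exchanging
    them with other integrals is Fubini, and passing to the limit is dominated convergence. Lebesgue
    measure is itself the periodization of its restriction to a unit cell, so a single formula
    unfolds integrals over R^d and integrals against the diffraction measure. A single weight
    dominates everything. All these integrals are real: the family [wave], with its phase, stands
    for complex exponentials. *)

Lemma ler_norm_sum_ord (R : realType) n (f : 'I_n -> R) (M : R) :
  (forall i, `|f i| <= M) -> `|\sum_i f i| <= n%:R * M.
Proof.
move=> fM; rewrite (le_trans (ler_norm_sum _ _ _))//.
by rewrite mulr_natl -[X in _ *+ X]card_ord -sumr_const ler_sum.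
Qed.

Section bounded_Rintegral.
Context d (T : measurableType d) (R : realType).
Variable mu : {finite_measure set T -> \bar R}.

Lemma bounded_integrable (f : T -> R) (M : R) : measurable_fun setT f ->
  (forall x, `|f x| <= M) -> mu.-integrable setT (EFin \o f).
Proof.
move=> mf fM; apply: measurable_bounded_integrable => //.
  exact: fin_num_fun_lty.
by exists M; split; [exact: num_real|move=> r /ltW Mr x _; exact: le_trans Mr].
Qed.

Lemma cvg_bounded_Rintegral (f_ : nat -> T -> R) (f : T -> R) (M : R) :
  (forall n, measurable_fun setT (f_ n)) -> measurable_fun setT f ->
  (forall n x, `|f_ n x| <= M) -> (forall x, f_ ^~ x @ \oo --> f x) ->
  \int[mu]_x f_ n x @[n --> \oo] --> \int[mu]_x f x.
Proof.
move=> mf_ mf fM cf.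
have [//||||||intf _] := @dominated_convergence _ T R mu setT _
  (fun n x => (f_ n x)%:E) (fun x => (f x)%:E) (cst M%:E).
- by move=> n; exact/measurable_EFinP.
- exact/measurable_EFinP.
- by apply: aeW => x _; apply: cvg_EFin; [exact: nearW|exact: cf].
- exact: finite_measure_integrable_cst.
- by apply: aeW => x n _; rewrite lee_fin; exact: fM.
move=> cvf; apply: fine_cvg; rewrite fineK//.
exact: integrable_fin_num intf.
Qed.

End bounded_Rintegral.

Section birkhoff.
Context d (Omega : measurableType d) (R : realType) (P : probability Omega R).
Variable T : Omega -> Omega.
Hypothesis mT : measurable_fun setT T.
Hypothesis PT : forall A, measurable A -> P (T @^-1` A) = P A.

Lemma measurable_iter n : measurable_fun setT (iter n T).
Proof.
elim: n => [|n ih] /=; first exact: measurable_id.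
exact: measurableT_comp.
Qed.

Lemma Rintegral_probability_cst (r : R) : \int[P]_w r = r.
Proof.
rewrite Rintegral_cst// (_ : fine _ = 1) ?mulr1//.
by rewrite -[RHS]/(fine (1%:E)); congr fine; exact: probability_setT.
Qed.

Lemma Rintegral_invariant (g : Omega -> R) (M : R) : measurable_fun setT g ->
  (forall w, `|g w| <= M) -> \int[P]_w g (T w) = \int[P]_w g w.
Proof.
move=> mg gM; rewrite /Rintegral; congr fine.
have igT : P.-integrable (T @^-1` setT) ((EFin \o g) \o T).
  rewrite preimage_setT; apply: (@bounded_integrable _ _ _ _ (g \o T) M).
    exact: measurableT_comp.
  by move=> w; exact: gM.
have mg' : measurable_fun setT (EFin \o g) by exact/measurable_EFinP.
have := @integral_pushforward _ _ _ _ R T mT P setT (EFin \o g) mg' igT measurableT.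
rewrite preimage_setT => <-.
by apply: eq_measure_integral => A mA _; exact: PT.
Qed.

Lemma Rintegral_iter_invariant (g : Omega -> R) (M : R) n :
  measurable_fun setT g ->
  (forall w, `|g w| <= M) -> \int[P]_w g (iter n T w) = \int[P]_w g w.
Proof.
move=> mg gM; elim: n => // n ih.
rewrite -[RHS]ih -(@Rintegral_invariant (fun w => g (iter n T w)) M)//.
- by apply: eq_Rintegral => w _; rewrite -iterSr.
- by apply: measurableT_comp => //; exact: measurable_iter.
Qed.

Lemma Rintegral_sum_iter (g : Omega -> R) (M : R) n :
  measurable_fun setT g -> (forall w, `|g w| <= M) ->
  \int[P]_w (\sum_(j < n) g (iter j T w)) = n%:R * \int[P]_w g w.
Proof.
move=> mg gM.
have mgj j : measurable_fun setT (fun w => g (iter j T w)).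
  by apply: measurableT_comp => //; exact: measurable_iter.
elim: n => [|n ih].
  by under eq_Rintegral do rewrite big_ord0; rewrite Rintegral_cst// !mul0r.
under eq_Rintegral do rewrite big_ord_recr.
rewrite RintegralD//= ?ih ?(@Rintegral_iter_invariant _ M)//.
- by rewrite -addn1 natrD mulrDl mul1r.
- apply: (@bounded_integrable _ _ _ _ _ (n%:R * M)).
    by apply: measurable_sum => j; exact: mgj.
  by move=> w; exact: ler_norm_sum_ord.
- by apply: (@bounded_integrable _ _ _ _ _ M) => //; exact: mgj.
Qed.

Section limsup.
Variable g : Omega -> R.
Hypothesis mg : measurable_fun setT g.
Hypothesis g01 : forall w, 0 <= g w <= 1.

Let S n w : R := \sum_(j < n) g (iter j T w).
(* Shifted by one so that no average is empty. *)
Let A n w : R := S n.+1 w / n.+1%:R.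
(** [sups] is the supremum over indices at least [n], so [G] below is the limsup of the averages. *)
Let U n w : R := sups (A ^~ w) n.
Let G w : R := inf (range (U ^~ w)).

Let S01 n w : 0 <= S n w <= n%:R.
Proof.
rewrite sumr_ge0 => [|j _]; last by case/andP: (g01 (iter j T w)).
rewrite /S -[X in _ <= X%:R]card_ord -sumr_const ler_sum// => j _.
by case/andP: (g01 (iter j T w)).
Qed.

Let mS n : measurable_fun setT (S n).
Proof.
apply: measurable_sum => j; apply: measurableT_comp => //.
exact: measurable_iter.
Qed.

Let A01 n w : 0 <= A n w <= 1.
Proof.
have /andP[S0 S1] := S01 n.+1 w.
by rewrite /A divr_ge0//= ler_pdivrMr// mul1r.
Qed.

Let ubA w : has_ubound (range (A ^~ w)).
Proof. by exists 1 => _ [n _ <-]; case/andP: (A01 n w). Qed.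

Let lbA w : has_lbound (range (A ^~ w)).
Proof. by exists 0 => _ [n _ <-]; case/andP: (A01 n w). Qed.

Let mA n : measurable_fun setT (A n).
Proof. by apply: measurable_funM => //; exact: mS. Qed.

Let mU n : measurable_fun setT (U n).
Proof. by apply: measurable_fun_sups => // w _; exact: ubA. Qed.

Let A_le_U N n w : (N <= n)%N -> A n w <= U N w.
Proof.
move=> Nn; apply: ub_le_sup; last by exists n.
exact: (has_ubound_sdrop (ubA w)).
Qed.

Let U_le N w x : (forall n, (N <= n)%N -> A n w <= x) -> U N w <= x.
Proof.
move=> h; apply: ge_sup; first by exists (A N w), N => /=.
by move=> _ [n /= Nn <-]; exact: h.
Qed.

Let U01 n w : 0 <= U n w <= 1.
Proof.
rewrite (le_trans _ (A_le_U w (leqnn n))) ?(andP (A01 _ _)).1//=.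
by apply: U_le => m _; case/andP: (A01 m w).
Qed.

Let cvgU w : U ^~ w @ \oo --> G w.
Proof. exact: (@cvg_sups_inf _ (A ^~ w)). Qed.

Let lbU w : has_lbound (range (U ^~ w)).
Proof. by exists 0 => _ [n _ <-]; case/andP: (U01 n w). Qed.

Let G_le_U n w : G w <= U n w.
Proof. by apply: ge_inf; [exact: lbU|exists n]. Qed.

Let G01 w : 0 <= G w <= 1.
Proof.
rewrite (le_trans (G_le_U 0 w)) ?(andP (U01 _ _)).2// andbT.
apply: lb_le_inf; first by exists (U 0 w), 0%N.
by move=> _ [n _ <-]; case/andP: (U01 n w).
Qed.

Let mG : measurable_fun setT G.
Proof.
by apply: (measurable_fun_cvg mU) => w _; exact: cvgU.
Qed.

(** Dropping the first point of an orbit lowers a long average by at most the reciprocal of its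
    length, since [g] is at most 1. The inequality has the direction that [greedy] uses: later
    points of the orbit have targets at least as high. *)
Let GT w : G w <= G (T w).
Proof.
apply: lb_le_inf; first by exists (U 0 (T w)), 0%N.
move=> _ [N _ <-]; apply/ler_addgt0Pr => e e0.
(* [N.+1] leaves an index at least [N] after one term is dropped; the second bound makes the lost
   reciprocal at most [e]. *)
pose N' := maxn N.+1 (Num.truncn e^-1).+1.
rewrite (le_trans (G_le_U N' w))//; apply: U_le => -[|n] N'n.
  by move: N'n; rewrite /N' leqn0 => /eqP; lia.
have /andP[g0 g1] := g01 w.
have Nn : (N <= n)%N by move: N'n; rewrite /N'; lia.
have /andP[S0 S1] := S01 n.+1 (T w).
apply: (@le_trans _ _ (A n (T w) + n.+2%:R^-1)).
  rewrite /A {1}/S big_ord_recl/=.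
  rewrite (eq_bigr (fun j : 'I_n.+1 => g (iter j T (T w)))); last first.
    by move=> j _; rewrite /= -iterSr.
  rewrite -/(S _ _) mulrDl addrC lerD//; last by rewrite ler_piMl.
  by rewrite ler_wpM2l// lef_pV2 ?posrE// ler_nat.
rewrite lerD ?A_le_U//.
rewrite invf_ple ?posrE// (le_trans (ltW (truncnS_gt _)))//.
by rewrite ler_nat (leq_trans (leq_maxr N.+1 _))// -/N' (leq_trans N'n).
Qed.

Let GTn n w : G w <= G (iter n T w).
Proof. by elim: n => //= n ih; rewrite (le_trans ih)// GT. Qed.

Section stopping.
Variable e : R.
Hypothesis e0 : 0 < e.

(* No average of length at most m comes within e of the limsup: a stopping time
   bounded by m fails exactly here. *)
Let B m : set Omega := \bigcap_(n in [set n | (n < m)%N]) [set w | A n w < G w - e].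

Let mB m : measurable (B m).
Proof.
apply: bigcap_measurableType => n _.
rewrite (_ : mkset _ = (fun w => A n w < G w - e) @^-1` [set true]).
  rewrite -[X in measurable X]setTI.
  by apply: measurable_fun_ltr => //; exact: measurable_funB.
by apply/seteqP; split.
Qed.

(** The supremum of all averages is at least their limsup, so some average exceeds [G w - e] at
    every point; the sets [B m] therefore decrease to the empty set. *)
Let PB_small : exists m, fine (P (B m)) <= e.
Proof.
have B0 : \bigcap_m B m = set0.
  apply/seteqP; split => // w Bw.
  have hs : has_sup (sdrop (A ^~ w) 0).
    by split; [exists (A 0 w), 0%N|exact: (has_ubound_sdrop (ubA w))].
  have [_ [n _ <-] An] := sup_adherent e0 hs.
  have := Bw n.+1 I n (ltnSn n); rewrite /= => AG.
  have := lt_trans An AG; rewrite ltrD2r => /lt_le_trans/(_ (G_le_U 0 w)).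
  by rewrite ltxx.
have : P \o B @ \oo --> 0%E.
  rewrite -(measure0 P) -B0; apply: nonincreasing_cvg_mu => //.
  - by rewrite (le_lt_trans (probability_le1 _ _))// ltry.
  - by rewrite B0.
  - by move=> i j ij; apply/subsetPset => w Bw n ni; apply: Bw; exact: leq_trans ij.
move/fine_cvgP => [_] /cvgrPdist_le/(_ _ e0)[m _ /(_ m (leqnn m))].
by rewrite /= sub0r normrN => /(le_trans (ler_norm _)); exists m.
Qed.

(** The orbit segment is cut from the left. At a point of [B m] a single step is taken, paid for by
    the indicator; elsewhere, a block of length at most [m] whose average reaches the target
    [G w - e]. A final piece of length at most [m] is paid for by the term [m%:R]. By [GTn], the
    target at the start of each block is at least the one at [w]. *)
Let greedy m (g' := fun w => g w + \1_(B m) w) L w :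
  L%:R * (G w - e) <= \sum_(j < L) g' (iter j T w) + m%:R.
Proof.
have g'0 v : 0 <= g' v by rewrite addr_ge0//; case/andP: (g01 v).
elim/ltn_ind: L w => L ih w; have [Lm|mL] := leqP L m.
  rewrite (@le_trans _ _ m%:R)//; last by rewrite lerDr sumr_ge0.
  have /andP[_ G1] := G01 w.
  rewrite (@le_trans _ _ L%:R) ?ler_nat// -[leRHS]mulr1 ler_wpM2l//.
  by rewrite lerBlDr (le_trans G1)// lerDl ltW.
have [Bw|] := pselect (B m w).
  case: L ih mL => // L ih _.
  rewrite big_ord_recl/= (eq_bigr (fun j : 'I_L => g' (iter j T (T w)))); last first.
    by move=> j _; rewrite /= -iterSr.
  have := ih L (ltnSn L) (T w).
  have : L%:R * (G w - e) <= L%:R * (G (T w) - e).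
    by rewrite ler_wpM2l// lerD2r GT.
  have : 1 <= g' w by rewrite /g' indicE mem_set// lerDr; case/andP: (g01 w).
  rewrite -addn1 natrD; have /andP[_ G1] := G01 w. 
  move: G1 e0; move: (g' w) (G w) (G (T w)) (\sum_(_ < L) _) => x y z t.
  by move=> *; lra.
rewrite /B /bigcap /= => /existsNP[n /not_implyP[nm /negP]].
rewrite -leNgt /A ler_pdivlMr// => Sn.
have nL : (n.+1 < L)%N by exact: leq_ltn_trans mL.
have := ih (L - n.+1)%N _ (iter n.+1 T w).
rewrite ltn_subrL/= (leq_ltn_trans (leq0n _) nL) => /(_ isT) ih1.
rewrite -(subnKC (ltnW nL)) big_split_ord/= natrD.
rewrite [X in _ + X + _](eq_bigr
  (fun j : 'I__ => g' (iter j T (iter n.+1 T w)))); last first.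
  by move=> j _; rewrite -[in RHS]iterD addnS addnC.
have : S n.+1 w <= \sum_(j < n.+1) g' (iter j T w).
  by apply: ler_sum => j _; rewrite /g' lerDl.
have : (L - n.+1)%:R * (G w - e) <= (L - n.+1)%:R * (G (iter n.+1 T w) - e).
  by rewrite ler_wpM2l// lerD2r GTn.
move: Sn ih1; move: (S _ _) (G _) (G _) (\sum_(_ < n.+1) _) (\sum_(_ < _) _).
by move=> x y z t u *; lra.
Qed.

(** Integrating [greedy] and dividing by [L] makes the term [m] negligible. One [e] comes from the
    target [G w - e], the other from the probability of [B m]. *)
Lemma Rintegral_limsup_le : \int[P]_w G w <= \int[P]_w g w + 2 * e.
Proof.
have [m Bm] := PB_small.
have abs1 (h : Omega -> R) : (forall w, 0 <= h w <= 1) -> forall w, `|h w| <= 1.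
  by move=> h01 w; have /andP[h0 h1] := h01 w; rewrite ger0_norm.
have iG := bounded_integrable P mG (abs1 _ G01).
have ig := bounded_integrable P mg (abs1 _ g01).
have m1 : measurable_fun setT (\1_(B m) : Omega -> R) by exact: measurable_indic.
have i1 : P.-integrable setT (EFin \o (\1_(B m) : Omega -> R)).
  by apply: integrable_indic.
pose g' w := g w + \1_(B m) w.
have mg' : measurable_fun setT g' by exact: measurable_funD.
have g'2 w : `|g' w| <= 2.
  rewrite (le_trans (ler_normD _ _))// (_ : 2 = 1 + 1)// lerD ?abs1//.
  by move=> v; rewrite indicE ler0n lern1; case: (_ \in _).
have Ig' : \int[P]_w g' w <= \int[P]_w g w + e.
  rewrite RintegralD// lerD2l (_ : \int[P]_w _ = fine (P (B m)))//.
  by rewrite /Rintegral integral_indic// setIT.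
have key L : L%:R * (\int[P]_w G w - e) <= L%:R * \int[P]_w g' w + m%:R.
  rewrite -(Rintegral_sum_iter _ mg' g'2).
  have -> : \int[P]_w G w - e = \int[P]_w (G w - e).
    rewrite RintegralB//; last exact: finite_measure_integrable_cst.
    by rewrite Rintegral_probability_cst.
  have iGe : P.-integrable setT (EFin \o (fun w => G w - e)).
    apply: (@bounded_integrable _ _ _ _ _ (1 + e)); first exact: measurable_funB.
    move=> w; have /andP[G0 G1] := G01 w.
    by rewrite (le_trans (ler_normB _ _))// lerD ?ger0_norm// ltW.
  have mSg' : measurable_fun setT (fun w => \sum_(j < L) g' (iter j T w)).
    apply: measurable_sum => j; apply: measurableT_comp => //.
    exact: measurable_iter.
  have Sg'M w : `|\sum_(j < L) g' (iter j T w)| <= L%:R * 2.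
    exact: ler_norm_sum_ord.
  have iS := bounded_integrable P mSg' Sg'M.
  have -> : m%:R = \int[P]_w (m%:R : R).
    by rewrite Rintegral_probability_cst.
  rewrite -RintegralD//; last exact: finite_measure_integrable_cst.
  rewrite -RintegralZl//; apply: le_Rintegral => //.
  - rewrite (_ : EFin \o _ = fun w => L%:R%:E * (EFin \o (fun w => G w - e)%R) w)%E.
      exact: integrableZl.
    by apply/funext => w /=; rewrite EFinM.
  - rewrite (_ : EFin \o _ = (EFin \o (fun w => \sum_(j < L) g' (iter j T w))%R)
        \+ cst m%:R%:E)%E.
      by apply: integrableD => //; exact: finite_measure_integrable_cst.
    by apply/funext => w /=; rewrite EFinD.
  - by move=> w _; exact: greedy.
apply/ler_addgt0Pr => r r0.
have := key (Num.truncn (m%:R / r)).+1; set L := _.+1 => kL.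
have mL : m%:R <= L%:R * r by rewrite -ler_pdivrMr// ltW// truncnS_gt.
have L0 : 0 < L%:R :> R by rewrite ltr0n.
rewrite -(ler_pM2l L0); move: kL (ler_wpM2l (ltW L0) Ig'); lra.
Qed.

End stopping.

(** The majorant is [U N], whose integral tends to that of the limsup by dominated convergence; this
    costs [e / 2], and [Rintegral_limsup_le] at [e / 4] costs the rest. The threshold is [N.+1]
    because [A n] averages [n.+1] terms. *)
Lemma Rintegral_sup_averages_le (e : R) : 0 < e ->
  exists N (V : Omega -> R), [/\ measurable_fun setT V,
    (forall w, 0 <= V w <= 1),
    \int[P]_w V w <= \int[P]_w g w + e &
    forall n w, (N <= n)%N -> \sum_(j < n) g (iter j T w) <= n%:R * V w].
Proof.
move=> e0.
have : \int[P]_w U n w @[n --> \oo] --> \int[P]_w G w.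
  apply: (@cvg_bounded_Rintegral _ _ _ _ _ _ 1) => // n w.
  by have /andP[h0 h1] := U01 n w; rewrite ger0_norm.
move=> /cvgrPdist_le/(_ (e / 2)) [|N _ /(_ N (leqnn N)) UG]; first by lra.
exists N.+1, (U N); split => //.
  have e4 : 0 < e / 4 by lra.
  move: UG (Rintegral_limsup_le e4); rewrite /= distrC => /(le_trans (ler_norm _)).
  lra.
move=> [//|n] w Nn.
by have := @A_le_U N n w Nn; rewrite /A ler_pdivrMr// mulrC.
Qed.

End limsup.
End birkhoff.

(** * Ergodic averages over boxes of Z^d *)

Section boxes.
Variable d : nat.

(* Z as bool x nat: [false] encodes -1, -2, ... so the two half-lines are disjoint. *)
Definition signed_int (s : bool) (u : nat) : int := if s then Posz u else Negz u.

Definition signed_vec K (s : {ffun 'I_d -> bool}) (u : {ffun 'I_d -> 'I_K}) :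
  'rV[int]_d := \row_i signed_int (s i) (u i).

Definition unit_step (s : {ffun 'I_d -> bool}) (i : 'I_d) : 'rV[int]_d :=
  if s i then delta_mx ord0 i else - delta_mx ord0 i.

Variable K : nat.
Implicit Types (u : {ffun 'I_d -> 'I_K.+1}) (n : 'I_d -> nat) (l : seq 'I_d).

(** Coordinates outside [l] are pinned at 0, so a box grows one direction at a time as [l] gets
    longer. [K] is only room for the indices. *)
Definition in_box l n u := [forall i, if i \in l then (u i < n i)%N else u i == ord0].

Definition set_coord u (i : 'I_d) (j : 'I_K.+1) : {ffun 'I_d -> 'I_K.+1} :=
  [ffun x => if x == i then j else u x].

Lemma in_box_nil n u : in_box [::] n u = (u == [ffun=> ord0]).
Proof.
apply/forallP/eqP => [h|-> i]; last by rewrite ffunE.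
by apply/ffunP => i; rewrite ffunE; apply/eqP; have := h i.
Qed.

Lemma eq_in_box l l' n u : l =i l' -> in_box l n u = in_box l' n u.
Proof. by move=> ll'; apply: eq_forallb => i; rewrite ll'. Qed.

Lemma in_box_set_coord i l n u j : i \notin l -> in_box l n u ->
  in_box (i :: l) n (set_coord u i j) = (j < n i)%N.
Proof.
move=> il /forallP h; apply/forallP/idP => [/(_ i)|jn x].
  by rewrite mem_head ffunE eqxx.
rewrite inE ffunE; by have [->|xi]//= := eqVneq x i.
Qed.

Lemma big_box_cons (R : nmodType) i l n (phi : {ffun 'I_d -> 'I_K.+1} -> R) :
  i \notin l -> (n i <= K.+1)%N ->
  \sum_(u | in_box (i :: l) n u) phi u =
  \sum_(j < n i) \sum_(u | in_box l n u) phi (set_coord u i (inord j)).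
Proof.
move=> il nK.
rewrite (big_ord_widen _ (fun j => \sum_(u | in_box l n u)
  phi (set_coord u i (inord j))) nK).
rewrite (partition_big (fun u => u i) (fun j : 'I_K.+1 => (j < n i)%N)); last first.
  by move=> u /forallP/(_ i); rewrite mem_head.
apply: eq_bigr => j jn; rewrite inord_val.
(* Setting the [i]-th coordinate to [j], undone by resetting it to [ord0], identifies the box for
   [l] with the fibre over [j]. *)
rewrite (reindex_onto (fun u => set_coord u i j) (fun u => set_coord u i ord0)).
  apply: eq_bigl => u; rewrite ffunE eqxx eqxx andbT.
  apply/andP/idP => [[/forallP h /eqP e]|h].
    apply/forallP => x; have [xl|xl] := ifPn.
      have := h x; rewrite inE xl orbT ffunE.
      by case: ifPn => // /eqP xi; move: il; rewrite -xi xl.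
    have := h x; rewrite inE (negbTE xl) orbF ffunE.
    have [->|xi//] := eqVneq x i.
    by move/ffunP/(_ i): e; rewrite !ffunE eqxx => <- _.
  split; first by rewrite in_box_set_coord.
  apply/eqP/ffunP => x; rewrite !ffunE; have [->|//] := eqVneq x i.
  by have /forallP/(_ i) := h; rewrite (negbTE il) => /eqP.
move=> u /andP[_ /eqP ui]; apply/ffunP => x; rewrite !ffunE.
by have [->|//] := eqVneq x i.
Qed.

Lemma signed_vec_set_coord s u i (j : 'I_K.+1) : u i = ord0 ->
  signed_vec s (set_coord u i j) = signed_vec s u + unit_step s i *+ j.
Proof.
move=> ui; apply/rowP => x; rewrite [RHS]mxE mulmxnE /unit_step.
rewrite !mxE ffunE (fun_if (fun M : 'rV[int]_d => M ord0 x)) !mxE eqxx/=.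
have [->|xi] := eqVneq x i; last by case: (s i); rewrite ?oppr0 mul0rn addr0.
by rewrite ui; case: (s i) => /=; lia.
Qed.

End boxes.

Section box_sums.
Context (d : nat) (dO : measure_display) (Omega : measurableType dO) (R : realType).
Variable th : 'rV[int]_d -> Omega -> Omega.
Hypothesis th0 : forall w, th 0 w = w.
Hypothesis thD : forall a b w, th (a + b) w = th a (th b w).
Variable s : {ffun 'I_d -> bool}.

Definition box_sum (g : Omega -> R) K l (n : 'I_d -> nat) w : R :=
  \sum_(u : {ffun 'I_d -> 'I_K.+1} | in_box l n u) g (th (signed_vec s u) w).

Lemma thMn a n w : th (a *+ n) w = iter n (th a) w.
Proof.
elim: n => [|n ih]; first by rewrite mulr0n th0.
by rewrite mulrS thD ih.
Qed.

(** The corner of the orthant [s] need not be the origin: its [i]-th coordinate is [Negz 0], that is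
    -1, where [s i] is false. *)
Lemma box_sum_nil g K n w :
  box_sum g K [::] n w = g (th (\row_i signed_int (s i) 0) w).
Proof.
rewrite /box_sum (eq_bigl (pred1 [ffun=> ord0])); last first.
  by move=> u; rewrite in_box_nil.
rewrite big_pred1_eq; congr (g (th _ w)).
by apply/rowP => i; rewrite !mxE ffunE.
Qed.

Lemma box_sum_cons g K i l (n : 'I_d -> nat) w :
  i \notin l -> (n i <= K.+1)%N ->
  box_sum g K (i :: l) n w =
  \sum_(j < n i) box_sum g K l n (iter j (th (unit_step s i)) w).
Proof.
move=> il nK; rewrite /box_sum big_box_cons//; apply: eq_bigr => j _.
apply: eq_bigr => u /forallP/(_ i); rewrite (negbTE il) => /eqP ui.
rewrite signed_vec_set_coord// thD thMn inordK//.
exact: leq_trans nK.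
Qed.

Lemma box_sum_cst1 K l (n : 'I_d -> nat) w :
  uniq l -> (forall i, n i <= K.+1)%N ->
  box_sum (fun=> 1) K l n w = \prod_(i <- l) (n i)%:R.
Proof.
move=> + nK; elim: l w => [|i l ih] w /=; first by rewrite box_sum_nil big_nil.
case/andP => il ul; rewrite box_sum_cons// big_cons.
rewrite (eq_bigr (fun=> \prod_(i <- l) (n i)%:R)); last by move=> j _; exact: ih.
by rewrite sumr_const card_ord mulr_natl.
Qed.

Lemma box_sum_bounds g K l (n : 'I_d -> nat) w :
  (forall w, 0 <= g w <= 1) -> uniq l -> (forall i, n i <= K.+1)%N ->
  0 <= box_sum g K l n w <= \prod_(i <- l) (n i)%:R.
Proof.
move=> g01 ul nK; rewrite -(box_sum_cst1 w ul nK).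
apply/andP; split; first by apply: sumr_ge0 => u _; case/andP: (g01 (th (signed_vec s u) w)).
by apply: ler_sum => u _; case/andP: (g01 (th (signed_vec s u) w)).
Qed.

Lemma measurable_box_sum g K l n : (forall a, measurable_fun setT (th a)) ->
  measurable_fun setT g -> measurable_fun setT (box_sum g K l n).
Proof.
move=> mth mg; rewrite /box_sum.
under eq_fun do rewrite big_mkcond.
apply: measurable_sum => u; case: (in_box l n u) => //.
exact: measurableT_comp.
Qed.

End box_sums.

Section ergodic_theorem.
Context (d : nat) (dO : measure_display) (Omega : measurableType dO) (R : realType).
Variable P : probability Omega R.
Variable th : 'rV[int]_d -> Omega -> Omega.
Hypothesis th0 : forall w, th 0 w = w.
Hypothesis thD : forall a b w, th (a + b) w = th a (th b w).
Hypothesis mth : forall a, measurable_fun setT (th a).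
Hypothesis Pth : forall a A, measurable A -> P (th a @^-1` A) = P A.
Hypothesis erg : forall A, measurable A -> (forall a, th a @^-1` A = A) ->
  P A = 0%E \/ P A = 1%E.

Section one_sided.
Variable s : {ffun 'I_d -> bool}.
Variable g : Omega -> R.
Hypothesis mg : measurable_fun setT g.
Hypothesis g01 : forall w, 0 <= g w <= 1.

Let abs1 (h : Omega -> R) : (forall w, 0 <= h w <= 1) -> forall w, `|h w| <= 1.
Proof. by move=> h01 w; have /andP[h0 h1] := h01 w; rewrite ger0_norm. Qed.

(* The one-parameter maximal bound, applied one coordinate at a time. *)
Lemma box_sum_majorant (l : seq 'I_d) (e : R) : uniq l -> 0 < e ->
  exists N (V : Omega -> R), [/\ measurable_fun setT V,
    (forall w, 0 <= V w <= 1),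
    \int[P]_w V w <= \int[P]_w g w + e &
    forall K (n : 'I_d -> nat) w, (forall i, (N <= n i <= K.+1)%N) ->
      box_sum th s g K l n w <= (\prod_(i <- l) (n i)%:R) * V w].
Proof.
elim: l e => [|i l ih] e /=.
  move=> _ e0; pose a : 'rV[int]_d := \row_i signed_int (s i) 0.
  exists 0%N, (g \o th a); split.
  - exact: measurableT_comp.
  - by move=> w; exact: g01.
  - rewrite (Rintegral_invariant (mth a) (Pth a) mg (abs1 g01)).
    by rewrite lerDl ltW.
  - by move=> K n w _; rewrite box_sum_nil big_nil mul1r.
move=> /andP[il ul] e0; have e20 : 0 < e / 2 by rewrite divr_gt0.
have [N1 [V1 [mV1 V101 iV1 hV1]]] := ih _ ul e20.
have [N2 [V [mV V01 iV hV]]] := Rintegral_sup_averages_le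
  (mth (unit_step s i)) (Pth (unit_step s i)) mV1 V101 e20.
exists (maxn N1 N2), V; split => //; first by lra.
move=> K n w nNK.
have nK j : (n j <= K.+1)%N by case/andP: (nNK j).
have Nn j : (N1 <= n j <= K.+1)%N.
  by rewrite nK andbT; have /andP[] := nNK j; rewrite geq_max => /andP[].
rewrite box_sum_cons// big_cons.
(* Each slice is bounded by [V1] at a shifted point, so what remains is an orbit sum of [V1] in
   direction [i], to which [hV] applies. *)
rewrite (le_trans (ler_sum _ (fun j _ => hV1 K n _ Nn)))//.
rewrite -mulr_sumr -mulrA [leRHS]mulrCA ler_wpM2l//.
  by apply: prodr_ge0 => j _; exact: ler0n.
by apply: hV; have /andP[] := nNK i; rewrite geq_max => /andP[].
Qed.

(** The sides lie in ['I_K.+2] because they may equal [K.+1], the number of available indices.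
    Letting them range over a finite type for each [K] makes the intersections in [mE] at most
    countable. *)
Let S K (n : {ffun 'I_d -> 'I_K.+2}) w := box_sum th s g K (enum 'I_d) (fun i => n i) w.

Let E (p : R) : set Omega := [set w | exists N, forall K (n : {ffun 'I_d -> 'I_K.+2}),
  (forall i, N <= n i)%N -> S n w <= p * \prod_i (n i)%:R].

Let mE p : measurable (E p).
Proof.
rewrite (_ : E p = \bigcup_N \bigcap_K \bigcap_(n in [set n : {ffun 'I_d -> 'I_K.+2} |
    forall i, (N <= n i)%N]) [set w | S n w <= p * \prod_i (n i)%:R]).
  apply: bigcup_measurable => N _; apply: bigcap_measurableType => K _.
  apply: fin_bigcap_measurable => [|n _]; first exact: finite_finset.
  rewrite -[X in measurable X]setTI.
  rewrite (_ : mkset _ = S n @^-1` `]-oo, p * \prod_i (n i)%:R]).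
    have mS : measurable_fun setT (S n).
      exact: (@measurable_box_sum _ _ _ _ th s g K (enum 'I_d) (fun i => n i) mth mg).
    by apply: mS => //; exact: measurable_itv.
  by apply/seteqP; split => w /=; rewrite in_itv.
apply/seteqP; split => w.
  by move=> [N h]; exists N => // K _ n /= Nn; exact: h.
by move=> [N _ h]; exists N => K n Nn; exact: h.
Qed.

(** The set where the limsup of box averages, as all sides grow, is at most [q]. The slack
    [k.+1%:R^-1] absorbs boundary terms, which is what makes the set invariant. *)
Let F (q : R) : set Omega := \bigcap_k E (q + k.+1%:R^-1).

(** A unit shift of the box trades one face for the opposite one, and as [g] lies between 0 and 1 a
    face contributes at most the product of the other sides. *)
Let S_step K (n : {ffun 'I_d -> 'I_K.+2}) i w :
  S n (th (unit_step s i) w) <= S n w + \prod_(j | j != i) (n j)%:R /\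
  S n (th (- unit_step s i) w) <= S n w + \prod_(j | j != i) (n j)%:R.
Proof.
pose l := rem i (enum 'I_d).
have ul : uniq l by rewrite rem_uniq// enum_uniq.
have il : i \notin l by rewrite mem_rem_uniq ?enum_uniq// inE eqxx.
have nK j : (n j <= K.+1)%N by rewrite -ltnS.
pose W v := box_sum th s g K l (fun j => n j) v.
have SE v : S n v = \sum_(j < n i) W (iter j (th (unit_step s i)) v).
  rewrite -(box_sum_cons th0 thD s g (n := fun j => n j))//; apply: eq_bigl => u; apply: eq_in_box => x.
  by rewrite inE mem_rem_uniq ?enum_uniq// inE mem_enum; case: eqVneq.
have W01 v : 0 <= W v <= \prod_(j | j != i) (n j)%:R.
  rewrite (_ : \prod_(_ | _) _ = \prod_(j <- l) (n j)%:R).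
    by apply: box_sum_bounds.
  by rewrite /l rem_filter ?enum_uniq// big_filter big_enum_cond.
pose D := th (unit_step s i).
have DK v : D (th (- unit_step s i) v) = v by rewrite /D -thD subrr th0.
have tele v m : \sum_(j < m) W (iter j D (D v)) + W v =
    \sum_(j < m) W (iter j D v) + W (iter m D v).
  transitivity (\sum_(j < m.+1) W (iter j D v)); last by rewrite big_ord_recr.
  rewrite big_ord_recl/= addrC; congr (_ + _).
  by apply: eq_bigr => j _; rewrite -iterSr.
rewrite !SE -/D; split.
  have := tele w (n i); have := W01 w; have := W01 (iter (n i) D w); lra.
have := tele (th (- unit_step s i) w) (n i); rewrite DK.
have := W01 (th (- unit_step s i) w); have := W01 (iter (n i) D (th (- unit_step s i) w)).
lra.
Qed.

Let F_unit q i w : F q w ->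
  F q (th (unit_step s i) w) /\ F q (th (- unit_step s i) w).
Proof.
move=> Fw.
have key w' : (forall K (n : {ffun 'I_d -> 'I_K.+2}), 
    S n w' <= S n w + \prod_(j | j != i) (n j)%:R) -> F q w'.
  (* With [b = (2 * k.+1).+1%:R^-1], the bound at [w] is taken with slack [b], and a face is at most
     the fraction [b] of the volume once the [i]-th side is at least [b^-1]. Together they cost
     [2 * b <= a]. *)
  move=> h k _; have [N EN] := Fw (2 * k.+1)%N I.
  exists (maxn N (2 * k.+1).+1)%N => K n Nn.
  have Nn' j : (N <= n j)%N by rewrite (leq_trans _ (Nn j))// leq_maxl.
  rewrite (le_trans (h K n))//.
  have := EN K n Nn'; rewrite (bigD1 i)//=.
  set p := \prod_(_ | _) _.
  have p0 : 0 <= p by apply: prodr_ge0 => j _; exact: ler0n.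
  have ni : (2 * k.+1).+1%:R <= (n i)%:R :> R.
    by rewrite ler_nat (leq_trans _ (Nn i))// leq_maxr.
  set a := k.+1%:R^-1; set b := (2 * k.+1).+1%:R^-1.
  have b1 : 1 <= b * (n i)%:R by rewrite mulrC ler_pdivlMr// mul1r.
  have ba : 2 * b <= a.
    rewrite /a /b -ler_pdivlMl// -invfM lef_pV2 ?posrE//.
    by rewrite -natrM ler_nat.
  have ab : 1 <= (a - b) * (n i)%:R.
    have := ler_wpM2r (ler0n R (n i)) ba; lra.
  have := ler_wpM2r p0 ab; lra.
by split; apply: key => K n; case: (S_step n i w).
Qed.

Let F_shift q a w : F q w -> F q (th a w).
Proof.
pose H a := forall w, F q w -> F q (th a w).
have H0 : H 0 by move=> v; rewrite th0.
have HD b c : H b -> H c -> H (b + c) by move=> Hb Hc v Fv; rewrite thD; apply/Hb/Hc.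
have HMn b n : H b -> H (b *+ n).
  by move=> Hb; elim: n => [|n ih]; rewrite ?mulr0n// mulrS; exact: HD.
have Hd i : H (delta_mx ord0 i) /\ H (- delta_mx ord0 i).
  rewrite /H; split => v Fv; have := F_unit i Fv; rewrite /unit_step;
    by case: (s i) => -[]; rewrite ?opprK.
suff : H a by apply.
rewrite [a]row_sum_delta; apply: (big_ind H) => // i _.
case: (a _ i) => n.
  by rewrite -natz scaler_nat; apply: HMn; case: (Hd i).
by rewrite NegzE -natz scaleNr scaler_nat -mulNrn; apply: HMn; case: (Hd i).
Qed.

(** Ergodicity leaves only probability 0 to exclude. Off [F q] there are boxes with arbitrarily long
    sides and average above [q], which forces [V] to be at least [q] there; if [F q] were null the
    integral of [V] would reach [q], although it exceeds the mean by at most half the gap. *)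
Let PF q : \int[P]_w g w < q -> P (F q) = 1%E.
Proof.
move=> gq.
have mF : measurable (F q) by apply: bigcap_measurableType => k _; exact: mE.
have [|P0|//] := @erg (F q) mF.
  move=> a; apply/seteqP; split => w /=; last exact: F_shift.
  by move/(@F_shift q (- a)); rewrite -thD addNr th0.
have g0 : 0 <= \int[P]_w g w.
  by apply: Rintegral_ge0 => w _; case/andP: (g01 w).
have e0 : 0 < (q - \int[P]_w g w) / 2 by lra.
have [N [V [mV V01 iV hV]]] := box_sum_majorant (enum_uniq 'I_d) e0.
have qV w : q * \1_(~` F q) w <= V w.
  clear P0;   rewrite indicE; have [|_] := boolP (w \in _); last first.
    by rewrite mulr0; case/andP: (V01 w).
  (* A threshold of at least 1 keeps every side positive, so that the volume can be cancelled. *)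
  rewrite inE mulr1 => /existsNP[k /not_implyP[_ /forallNP/(_ (maxn N 1))]].
  move=> /existsNP[K /existsNP[n /not_implyP[Nn /negP]]]; rewrite -ltNge.
  have nNK i : (N <= n i <= K.+1)%N.
    by rewrite -[X in _ && X]ltnS ltn_ord andbT (leq_trans _ (Nn i))// leq_maxl.
  move=> /lt_le_trans/(_ (hV _ _ _ nNK)); rewrite big_enum/= mulrC.
  have p0 : 0 < \prod_i (n i)%:R :> R.
    apply: prodr_gt0 => i _; rewrite ltr0n (leq_trans _ (Nn i))//.
    by rewrite leq_max orbT.
  rewrite ltr_pM2l// => /ltW; apply: le_trans.
  by rewrite lerDl invr_ge0.
exfalso.
have : \int[P]_w (q * \1_(~` F q) w) <= \int[P]_w V w.
  apply: le_Rintegral => //.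
  - apply: (@bounded_integrable _ _ _ _ _ q).
      by apply: measurable_funM => //; apply: measurable_indic; exact: measurableC.
    move=> w; rewrite indicE normrM ger0_norm; last by clear P0; lra.
    rewrite ler_piMr//; first by clear P0; lra.
    by rewrite ger0_norm// lern1; case: (_ \in _).
  - exact: bounded_integrable mV (abs1 V01).
rewrite RintegralZl//; last by apply: integrable_indic => //; exact: measurableC.
rewrite (_ : (\int[P]_w \1_(~` F q) w)%R = 1) ?mulr1; first by clear P0; lra.
rewrite /Rintegral integral_indic//; last exact: measurableC.
rewrite setIT (_ : fine _ = fine (P (~` F q)))//.
by rewrite probability_setC// P0 sube0.
Qed.

Lemma box_averages_limsup : {ae P, forall w, forall e : R, 0 < e ->
  exists N, forall K (n : {ffun 'I_d -> 'I_K.+2}), (forall i, N <= n i)%N ->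
    box_sum th s g K (enum 'I_d) (fun i => n i) w <=
      (\int[P]_w g w + e) * \prod_i (n i)%:R}.
Proof.
pose c := \int[P]_w g w.
have : {ae P, forall w, forall k, F (c + k.+1%:R^-1) w}.
  apply/ae_foralln => k.
  have mF : measurable (F (c + k.+1%:R^-1)).
    by apply: bigcap_measurableType => j _; exact: mE.
  have P0 : P (~` F (c + k.+1%:R^-1)) = 0%E.
    by rewrite probability_setC// PF ?subee// ltrDl invr_gt0.
  by exists (~` F (c + k.+1%:R^-1)); split => //; exact: measurableC.
apply: filterS => w Fw e e0.
(* The same [k] is used for the level [c + k.+1%:R^-1] and for the slack inside [F]; each costs at
   most [e / 2]. *)
pose k := Num.truncn (2 / e).
have ke : k.+1%:R^-1 <= e / 2.
  by rewrite invf_ple ?posrE ?divr_gt0// invfM invrK mulrC ltW// truncnS_gt.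
have [N hN] := Fw k k I; exists N => K n Nn.
rewrite (le_trans (hN K n Nn))// ler_wpM2r//.
  by apply: prodr_ge0 => i _; exact: ler0n.
by rewrite -/c -addrA lerD2l [leRHS]splitr lerD.
Qed.

End one_sided.

Lemma box_averages_cvg (s : {ffun 'I_d -> bool}) (g : Omega -> R) :
  measurable_fun setT g -> (forall w, 0 <= g w <= 1) ->
  {ae P, forall w, forall e : R, 0 < e ->
  exists N, forall K (n : {ffun 'I_d -> 'I_K.+2}), (forall i, N <= n i)%N ->
    `|box_sum th s g K (enum 'I_d) (fun i => n i) w -
      (\int[P]_w g w) * \prod_i (n i)%:R| <= e * \prod_i (n i)%:R}.
Proof.
move=> mg g01.
have mg' : measurable_fun setT (fun w => 1 - g w) by exact: measurable_funB.
have g'01 w : 0 <= 1 - g w <= 1 by have := g01 w; lra.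
have := box_averages_limsup s mg' g'01.
have := box_averages_limsup s mg g01.
apply: filterS2 => w h1 h2 e e0.
have [N1 hN1] := h1 e e0; have [N2 hN2] := h2 e e0.
exists (maxn N1 N2) => K n Nn.
have nK i : (n i <= K.+1)%N by rewrite -ltnS.
have := hN1 K n (fun i => leq_trans (leq_maxl N1 N2) (Nn i)).
have := hN2 K n (fun i => leq_trans (leq_maxr N1 N2) (Nn i)).
have ig : P.-integrable setT (EFin \o g).
  apply: (@bounded_integrable _ _ _ _ _ 1) => // v.
  by have /andP[h3 h4] := g01 v; rewrite ger0_norm.
rewrite RintegralB//; last exact: finite_measure_integrable_cst.
rewrite Rintegral_probability_cst.
have -> : box_sum th s (fun w => 1 - g w) K (enum 'I_d) (fun i => n i) w =
    \prod_i (n i)%:R - box_sum th s g K (enum 'I_d) (fun i => n i) w.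
  rewrite -big_enum -(box_sum_cst1 _ th0 thD s w (enum_uniq 'I_d) nK) /box_sum.
  by rewrite -sumrB.
set p := \prod_i _; set b := box_sum _ _ _ _ _ _ _.
by rewrite ler_norml => h3 h4; apply/andP; split; lra.
Qed.

End ergodic_theorem.

(** * Transfer of the ergodic theorem to the process *)

Section configurations.
Variable d : nat.

Definition conf_gen : set (set ('rV[int]_d -> bool)) :=
  [set A | exists k, A = [set x | x k = true]].

Notation conf := (g_sigma_algebraType conf_gen).

Lemma measurable_conf_coord k : measurable_fun setT (fun x : conf => x k).
Proof.
apply: (measurable_fun_bool true) => //; rewrite setTI.
by apply: sub_sigma_algebra; exists k.
Qed.

Lemma measurable_fun_conf dT (T : measurableType dT) (f : T -> conf) :
  (forall k, measurable_fun setT (fun t => f t k)) -> measurable_fun setT f.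
Proof.
move=> mf; apply: (@measurability _ _ T conf setT f conf_gen) => //.
move=> _ [_ [k ->] <-].
have := mf k measurableT [set true].
by rewrite !setTI; apply.
Qed.

Lemma measurable_shift_conf k : measurable_fun setT (shift_conf k : conf -> conf).
Proof. by apply: measurable_fun_conf => j; exact: measurable_conf_coord. Qed.

End configurations.
Arguments conf_gen : clear implicits.
Notation conf d := (g_sigma_algebraType (conf_gen d)).

Section process_ergodic.
Context (d : nat) (dT : measure_display) (T : measurableType dT) (R : realType).
Variables (P : probability T R) (X : 'rV[int]_d -> {mfun T >-> bool}).

Let conf_map (w : T) : conf d := fun k => X k w.

Let measurable_conf_map : measurable_fun setT conf_map.
Proof. by apply: measurable_fun_conf => k; exact: measurable_funPT. Qed.

HB.instance Definition _ :=
  @isMeasurableFun.Build _ _ _ _ conf_map measurable_conf_map.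

(** Stationarity and ergodicity are properties of the law, so the ergodic theorem is applied to the
    shift on configurations under the distribution [Q], and the exceptional null set is pulled back
    by [conf_map]. *)
Lemma process_box_averages (k : 'rV[int]_d) : stationary P X -> ergodic P X ->
  {ae P, forall w, forall s (e : R), 0 < e ->
  exists N, forall K (n : {ffun 'I_d -> 'I_K.+2}), (forall i, N <= n i)%N ->
    `|\sum_(u : {ffun 'I_d -> 'I_K.+1} | in_box (enum 'I_d) (fun i => n i) u)
        (X (signed_vec s u) w)%:R * (X (signed_vec s u + k) w)%:R
      - correlation P X k * \prod_i (n i)%:R| <= e * \prod_i (n i)%:R}.
Proof.
move=> stat erg; apply: filter_forall => s.
pose Q : probability (conf d) R := distribution P conf_map.
pose g (x : conf d) : R := (x 0)%:R * (x k)%:R.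
have mnat (b : conf d -> bool) : measurable_fun setT b ->
    measurable_fun setT (fun x => (b x)%:R : R).
  move=> mb; rewrite (_ : (fun x => _) = \1_(b @^-1` [set true])).
    by apply: measurable_indic; rewrite -[X in measurable X]setTI; exact: mb.
  apply/funext => x; rewrite indicE; case bx: (b x); first by rewrite mem_set.
  by rewrite memNset//= bx.
have mg : measurable_fun setT g.
  by apply: measurable_funM; apply: mnat; exact: measurable_conf_coord.
have g01 x : 0 <= g x <= 1 by rewrite /g; case: (x 0); case: (x k) => /=; lra.
have th0 (w : conf d) : shift_conf 0 w = w.
  by apply/funext => j; rewrite /shift_conf addr0.
have thD a b (w : conf d) : shift_conf (a + b) w = shift_conf a (shift_conf b w).
  by apply/funext => j; rewrite /shift_conf addrA.
have Pth a (A : set (conf d)) : measurable A -> Q (shift_conf a @^-1` A) = Q A.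
  by move=> mA; exact: stat.
have ergQ (A : set (conf d)) : measurable A -> (forall a, shift_conf a @^-1` A = A) ->
    Q A = 0%E \/ Q A = 1%E.
  by move=> mA invA; exact: erg.
have [N [mN QN sub]] := box_averages_cvg th0 thD (@measurable_shift_conf d)
  Pth ergQ s mg g01.
have Ec : \int[Q]_x g x = correlation P X k.
  rewrite /correlation unlock /Rintegral; congr fine.
  rewrite ge0_integral_distribution//; first exact/measurable_EFinP.
  by move=> x; rewrite lee_fin; case/andP: (g01 x).
exists (conf_map @^-1` N); split => //.
  by rewrite -[X in measurable X]setTI; exact: measurable_conf_map.
apply: subset_trans (preimage_subset sub) => w /= Nw h; apply: Nw => e e0.
have [N' hN'] := h e e0; exists N' => K n Nn.
have := hN' K n Nn; rewrite Ec /box_sum /g /shift_conf /= /conf_map.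
set lhs := (X in `|X - _|) => hN; set rhs := (X in `|X - _|).
rewrite (_ : rhs = lhs)//; apply: eq_bigr => u _.
by rewrite add0r [k + _]addrC.
Qed.

End process_ergodic.

(** * Cubes, balls, and averages over balls *)

Section lebesgue_box.
Context (R : realType).

Definition rbox d (a : 'I_d -> R) (t : R) : set 'rV[R]_d :=
  [set x | forall i, a i <= x ord0 i < a i + t].

Lemma measurable_rbox d (a : 'I_d -> R) t :
  measurable (rbox a t : set (borel_rV R d)).
Proof.
rewrite (_ : rbox a t = \bigcap_(i in [set: 'I_d])
    ((fun x : borel_rV R d => x ord0 i) @^-1` `[a i, a i + t[)).
  apply: fin_bigcap_measurable => // i _.
  rewrite -[X in measurable X]setTI; 
  exact: (measurable_borel_coord i measurableT (measurable_itv _)).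
apply/seteqP; split => x /= h i; first by move=> _; rewrite /preimage/= in_itv/=; exact: h.
by have := h i I; rewrite /preimage/= in_itv.
Qed.

Lemma lebesgue_rbox d (a : 'I_d -> R) t : 0 <= t ->
  lebesgue_rV d (rbox a t : set (borel_rV R d)) = (t ^+ d)%:E.
Proof.
move=> t0; elim: d a => [|d ih] a.
  by rewrite /= diracE mem_set// => -[].
transitivity (((@lebesgue_measure R) \x (lebesgue_rV d))%E
   (`[a ord0, a ord0 + t[%classic `*` (rbox (fun i => a (lift ord0 i)) t))).
  rewrite /= /lebesgue_cons /pushforward; congr (_ _).
  apply/seteqP; split => -[x y] /=.
    move=> h; split.
      by have := h ord0; rewrite cons_rV0 in_itv.
    by move=> i /=; have := h (lift ord0 i); rewrite cons_rVS.
  move=> [h1 h2] i; case: (unliftP ord0 i) => [j ->|->].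
    by rewrite cons_rVS; exact: h2.
  by rewrite cons_rV0; move: h1; rewrite in_itv.
rewrite product_measure1E//; last exact: measurable_rbox.
rewrite ih exprS EFinM; congr (_ * _)%E.
transitivity (lebesgue_measure (`[a ord0, a ord0 + t[%classic : set R)) => //.
rewrite lebesgue_measure_itv/= lte_fin; case: ifPn.
  by rewrite -EFinB [(a ord0 + t)%R]addrC addrK.
by rewrite -leNgt gerDl => h; congr EFin; apply/eqP; rewrite eq_le t0 h.
Qed.

End lebesgue_box.

Section cube_counting.
Variable d : nat.

(** [p] indexes a unit cube of one orthant by its corner nearest to 0. In the ball of radius [M.+1],
    [outer] places the nearest corner and [inner] the farthest one: the cubes that may meet the
    ball, and those contained in it. *)
Definition outer M (p : {ffun 'I_d -> 'I_M.+1}) := (\sum_i p i ^ 2 < M.+1 ^ 2)%N.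

Definition inner M (p : {ffun 'I_d -> 'I_M.+1}) := (\sum_i (p i).+1 ^ 2 < M.+1 ^ 2)%N.

(** Lowering every coordinate by 1 sends an outer cube with positive coordinates to an inner one,
    injectively. The cubes having some zero coordinate number [M.+1 ^ d - M ^ d]. *)
Lemma outer_le_inner M : (#|@outer M| <= #|@inner M| + (M.+1 ^ d - M ^ d))%N.
Proof.
pose pos : {set {ffun 'I_d -> 'I_M.+1}} := [set p in ffun_on (predC1 ord0)]%SET.
have posE : #|pos| = (M ^ d)%N.
  by rewrite cardsE card_ffun_on card_ord cardC1 card_ord.
pose up (p : {ffun 'I_d -> 'I_M.+1}) : {ffun 'I_d -> 'I_M.+1} :=
  [ffun i => inord (p i).+1].
have sub : ([set p | outer p] \subset (up @: [set p | inner p]) :|: ~: pos)%SET.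
  apply/fintype.subsetP => p; rewrite finset.in_set => op.
  rewrite finset.in_setU finset.in_setC finset.in_set.
  have [/ffun_onP pp|] := boolP (p \in ffun_on (predC1 ord0)); last by rewrite orbT.
  rewrite orbF; apply/imsetP; exists [ffun i => inord (p i).-1]; last first.
    apply/ffunP => i; rewrite !ffunE; apply: val_inj => /=.
    have p0 : (0 < p i)%N by have := pp i; rewrite inE -val_eqE lt0n.
    have pM := ltn_ord (p i).
    have p1 : ((p i).-1 < M.+1)%N by exact: leq_ltn_trans (leq_pred _) pM.
    by rewrite (inordK p1) prednK// inordK.
  rewrite finset.in_set /inner; apply: leq_ltn_trans op; apply: leq_sum => i _.
  have p0 : (0 < p i)%N by have := pp i; rewrite inE -val_eqE lt0n.
  have p1 : ((p i).-1 < M.+1)%N by exact: leq_ltn_trans (leq_pred _) (ltn_ord (p i)).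
  by rewrite ffunE (inordK p1) prednK.
have := subset_leq_card sub; rewrite cardsE => /leq_trans; apply.
rewrite (leq_trans (leq_card_setU _ _))// leq_add//.
  by rewrite (leq_trans (leq_imset_card _ _))// cardsE.
by rewrite cardsCs finset.setCK posE card_ffun !card_ord.
Qed.

(** With [M.+1 = d.+1 * L.+1], all cubes with coordinates at most [L] are inner, since
    [d * L.+1 ^ 2] is less than [M.+1 ^ 2]; inner cubes thus form a fixed proportion of all
    cubes. *)
Lemma inner_ge L : (L.+1 ^ d <= #|@inner (d.+1 * L.+1).-1|)%N.
Proof.
have LM : (L.+1 <= (d.+1 * L.+1).-1.+1)%N by rewrite prednK// leq_pmull.
pose w (p : {ffun 'I_d -> 'I_L.+1}) : {ffun 'I_d -> 'I_(d.+1 * L.+1).-1.+1} :=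
  [ffun i => widen_ord LM (p i)].
have winj : injective w.
  move=> p q /ffunP pq; apply/ffunP => i; apply: val_inj.
  by have := pq i; rewrite !ffunE => /(congr1 val).
rewrite -[X in (X ^ _)%N]card_ord -[X in (_ ^ X)%N](card_ord d) -card_ffun.
rewrite -(card_codom winj); apply: subset_leq_card; apply/fintype.subsetP => _ /codomP[p ->].
rewrite unfold_in.
apply: (@leq_ltn_trans (d * L.+1 ^ 2)).
  apply: (@leq_trans (\sum_(i < d) L.+1 ^ 2)%N); last by rewrite sum_nat_const card_ord.
  apply: leq_sum => i _.
  by rewrite ffunE/= leq_sqr ltn_ord.
rewrite prednK// expnMn ltn_pmul2r ?expn_gt0// (leq_trans (ltnSn d))//.
by rewrite -mulnn leq_pmulr.
Qed.

(** The two counts differ by at most [d * M.+1 ^ (d - 1)], a Bernoulli inequality proved as [bern],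
    while inner cubes number at least [(M.+1 / d.+1) ^ d]. The quotient of these is
    [d * d.+1 ^ d / M.+1], which dictates [L]. *)
Lemma outer_inner_ratio (R : realType) (e : R) : 0 < e ->
  exists M, (0 < #|@inner M|)%N /\ #|@outer M|%:R <= (1 + e) * #|@inner M|%:R :> R.
Proof.
move=> e0; pose L := Num.truncn (d%:R * d.+1%:R ^+ d / e).
exists (d.+1 * L.+1).-1; set M := _.-1.
have ME : M.+1 = (d.+1 * L.+1)%N by rewrite /M prednK.
have hb : L.+1%:R ^+ d <= #|@inner M|%:R :> R by rewrite -natrX ler_nat inner_ge.
split; first by rewrite (leq_trans _ (inner_ge L))// expn_gt0.
have := outer_le_inner M; rewrite -(ler_nat R) natrD => /le_trans; apply.
rewrite mulrDl mul1r lerD2l natrB; last first.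
  by case: (d) => // k; rewrite leq_exp2r.
rewrite !natrX.
set x : R := M.+1%:R; have x1 : x = M%:R + 1 by rewrite /x -addn1 natrD.
have x0 : 0 < x by rewrite ltr0n.
have bern : x * (x ^+ d - M%:R ^+ d) <= d%:R * x ^+ d.
  elim: (d) => [|k ih]; first by rewrite !expr0 subrr mulr0 mul0r.
  have M0 : 0 <= M%:R :> R by exact: ler0n.
  have k0 : 0 <= k%:R * x ^+ k by rewrite mulr_ge0// exprn_ge0// ltW.
  have := ler_wpM2l (ler0n R M) ih; rewrite !exprS -[k.+1]addn1 natrD.
  move: k0; rewrite x1; move: (M%:R : R) (k%:R : R) => a b.
  by move: ((a + 1) ^+ k) (a ^+ k) => y t *; lra.
have xE : x = d.+1%:R * L.+1%:R by rewrite /x ME natrM.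
have {}hb : x ^+ d <= d.+1%:R ^+ d * #|@inner M|%:R.
  by rewrite xE exprMn ler_wpM2l// exprn_ge0.
have Le : d%:R * d.+1%:R ^+ d <= e * x.
  rewrite [leRHS]mulrC -ler_pdivrMr// (le_trans (ltW (truncnS_gt _)))//.
  by rewrite xE ler_peMl// ler1n.
rewrite -(ler_pM2l x0) (le_trans bern)//.
rewrite (le_trans (ler_wpM2l (ler0n R d) hb))// !mulrA ler_wpM2r//.
by rewrite [x * e]mulrC.
Qed.

End cube_counting.

Section cubes.
Context (R : realType) (d : nat).
Implicit Types (y : 'rV[int]_d -> R) (c : R).

Definition box_averaging y c := forall s (e : R), 0 < e ->
  exists N, forall K (n : {ffun 'I_d -> 'I_K.+2}), (forall i, N <= n i)%N ->
    `|\sum_(u : {ffun 'I_d -> 'I_K.+1} | in_box (enum 'I_d) (fun i => n i) u)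
        y (signed_vec s u) - c * \prod_i (n i)%:R| <= e * \prod_i (n i)%:R.

Lemma prod_bool (I : finType) (b : I -> bool) :
  \prod_i (b i)%:R = [forall i, b i]%:R :> R.
Proof.
have [/forallP h|/forallPn[i bi]] := boolP [forall i, b i].
  by rewrite big1// => i _; rewrite h.
by rewrite (bigD1 i)//= (negbTE bi) mul0r.
Qed.

Lemma divn_eq_diff (t p u : nat) : (0 < t)%N ->
  (u %/ t == p)%N%:R = (u < t * p.+1)%N%:R - (u < t * p)%N%:R :> R.
Proof.
move=> t0; have -> : (u %/ t == p)%N = (u < t * p.+1)%N && ~~ (u < t * p)%N.
  by rewrite eqn_leq -ltnS ltn_divLR// leq_divRL// -leqNgt mulnC [(p * t)%N]mulnC.
have : (u < t * p -> u < t * p.+1)%N by move/leq_trans; apply; rewrite leq_pmul2l.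
case: (u < t * p)%N => [->//|_]; first by rewrite subrr.
by rewrite subr0 andbT.
Qed.

(* Inclusion-exclusion writes a cube as a signed sum of boxes anchored at 0. *)
Lemma cube_average y c (s : {ffun 'I_d -> bool}) M (e : R) :
  box_averaging y c -> 0 < e ->
  exists N, forall t K (p : {ffun 'I_d -> 'I_M.+1}), (N <= t)%N ->
    (t * M.+1 <= K.+1)%N ->
    `|\sum_(u : {ffun 'I_d -> 'I_K.+1} | [forall i, (u i %/ t)%N == p i])
        y (signed_vec s u) - c * t%:R ^+ d| <= e * t%:R ^+ d.
Proof.
move=> yc e0.
(* There are [2 ^ d] signed boxes, each of volume at most [(t * M.+1) ^ d]; a tolerance [e / B] for
   each adds up to [e * t ^ d]. *)
pose B : R := #|{set 'I_d}|%:R * M.+1%:R ^+ d.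
have B0 : 0 < B.
  rewrite mulr_gt0 ?exprn_gt0 ?ltr0n//.
  by apply/card_gt0P; exists finset.set0.
have [N hN] := yc s (e / B) (divr_gt0 e0 B0).
exists (maxn N 1) => t K p; rewrite geq_max => /andP[Nt t0] tK.
pose sg (J : {set 'I_d}) : R := \prod_i (if i \in J then 1 else -1).
pose nJ (J : {set 'I_d}) i : nat := if i \in J then (t * (p i).+1)%N else (t * p i)%N.
have nJ_le J i : (nJ J i <= t * M.+1)%N.
  rewrite /nJ; case: ifP => _; apply: leq_mul => //.
  exact: ltnW (ltn_ord _).
pose n J : {ffun 'I_d -> 'I_K.+2} := [ffun i => inord (nJ J i)].
have nE J i : n J i = nJ J i :> nat.
  by rewrite ffunE inordK// ltnS (leq_trans (nJ_le J i))// (leq_trans tK).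
pose S J := \sum_(u : {ffun 'I_d -> 'I_K.+1} | in_box (enum 'I_d) (fun i => n J i) u)
  y (signed_vec s u).
have sgM (J : {set 'I_d}) (F G : 'I_d -> R) : \prod_i (if i \in J then F i else - G i) =
    sg J * \prod_i (if i \in J then F i else G i).
  rewrite -big_split/=; apply: eq_bigr => i _.
  by case: ifP => _; rewrite ?mul1r ?mulN1r.
(* The indicator of the cube is a product of differences of indicators of initial segments. Its
   expansion has one box for each set [J] of coordinates in which the far end is kept, with sign
   [sg J]. *)
have SE : \sum_(u : {ffun 'I_d -> 'I_K.+1} | [forall i, (u i %/ t)%N == p i])
    y (signed_vec s u) = \sum_J sg J * S J.
  rewrite big_mkcond/=.
  under [RHS]eq_bigr do rewrite /S big_mkcond/= mulr_sumr.
  rewrite exchange_big/=; apply: eq_bigr => u _.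
  transitivity (y (signed_vec s u) * [forall i, (u i %/ t)%N == p i]%:R).
    by case: ifP => _; rewrite ?mulr1 ?mulr0.
  rewrite -prod_bool; under eq_bigr do rewrite divn_eq_diff//.
  rewrite bigA_distr mulr_sumr; apply: eq_bigr => J _.
  rewrite sgM mulrCA; congr (_ * _).
  transitivity (y (signed_vec s u) * \prod_i (u i < n J i)%N%:R).
    congr (_ * _); apply: eq_bigr => i _; rewrite nE /nJ.
    by case: ifP.
  rewrite prod_bool (_ : [forall i, _] = in_box (enum 'I_d) (fun i => n J i) u).
    by case: ifP => _; rewrite ?mulr1 ?mulr0.
  by apply: eq_forallb => i; rewrite mem_enum.
have tE : t%:R ^+ d = \sum_J sg J * \prod_i (n J i)%:R.
  transitivity (\prod_(i < d) ((t * (p i).+1)%:R - (t * p i)%:R : R)).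
    rewrite -[in LHS](card_ord d) -prodr_const; apply: eq_bigr => i _.
    by rewrite mulnS natrD addrK.
  rewrite bigA_distr; apply: eq_bigr => J _; rewrite sgM; congr (_ * _).
  by apply: eq_bigr => i _; rewrite nE /nJ; case: ifP.
rewrite SE tE mulr_sumr -sumrB -tE.
rewrite (le_trans (ler_norm_sum _ _ _))//.
apply: (@le_trans _ _ (\sum_(J : {set 'I_d}) (e / B) * (t * M.+1)%:R ^+ d)).
  apply: ler_sum => J _.
  rewrite mulrCA -mulrBr normrM (_ : `|sg J| = 1) ?mul1r; last first.
    by rewrite normr_prod big1// => i _; case: ifP; rewrite ?normrN normr1.
  apply: (@le_trans _ _ (e / B * \prod_i (n J i)%:R)); last first.
    apply: ler_wpM2l; first exact: ltW (divr_gt0 e0 B0).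
    rewrite -[in leRHS](card_ord d) -prodr_const; apply: ler_prod => i _.
    by rewrite ler0n nE ler_nat nJ_le.
  (* A nonzero side is a positive multiple of [t], hence past the threshold [N]. If a side vanishes,
     both the sum and the volume are 0 and no threshold is involved. *)
  have [/forallP nJ0|/forallPn[i ni0]] := boolP [forall i, (0 < n J i)%N].
    apply: hN => i; have := nJ0 i; rewrite nE /nJ.
    case: ifP => _; rewrite muln_gt0 => /andP[_ pi0].
      by rewrite (leq_trans Nt)// leq_pmulr.
    by rewrite (leq_trans Nt)// leq_pmulr.
  move: ni0; rewrite -eqn0Ngt => /eqP n0.
  rewrite (bigD1 i)//= n0 mul0r !mulr0 subr0 /S big1 ?normr0// => u.
  by move/forallP/(_ i); rewrite mem_enum/= n0.
rewrite sumr_const natrM exprMn -[leLHS]mulr_natr.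
rewrite [X in _ * X%:R](_ : _ = #|{set 'I_d}|); last exact: eq_card.
rewrite [leLHS](_ : _ = e * t%:R ^+ d * (B / B)).
  by rewrite divff ?gt_eqF// mulr1.
by rewrite [in RHS]/B; move: B^-1 => b; ring.
Qed.

End cubes.

Section balls.
Context (R : realType) (d : nat).

Definition int_sign (z : int) : bool := if z is Posz _ then true else false.

Definition int_rank (z : int) : nat := match z with Posz n => n | Negz n => n end.

Lemma signed_intK z : signed_int (int_sign z) (int_rank z) = z.
Proof. by case: z. Qed.

Lemma signed_int_inj s s' u u' : signed_int s u = signed_int s' u' ->
  s = s' /\ u = u'.
Proof. by case: s; case: s' => //= -[]. Qed.

Lemma signed_vec_inj K :
  injective (fun q : {ffun 'I_d -> bool} * {ffun 'I_d -> 'I_K} => signed_vec q.1 q.2).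
Proof.
move=> [s u] [s' u'] /= /rowP h.
have {}h i : s i = s' i /\ u i = u' i :> nat.
  by apply: signed_int_inj; have := h i; rewrite !mxE.
congr (_, _); apply/ffunP => i; first by case: (h i).
by apply: val_inj; case: (h i).
Qed.

Lemma fsbig_signed_vec K (A : set 'rV[int]_d) (y : 'rV[int]_d -> R) :
  (forall x, A x -> forall i, (int_rank (x ord0 i) < K.+1)%N) ->
  \sum_(x \in A) y x = \sum_(s : {ffun 'I_d -> bool})
    \sum_(u : {ffun 'I_d -> 'I_K.+1}) (signed_vec s u \in A)%:R * y (signed_vec s u).
Proof.
move=> AK.
pose h (q : {ffun 'I_d -> bool} * {ffun 'I_d -> 'I_K.+1}) := signed_vec q.1 q.2.
have hb : set_bij (h @^-1` A) A h.
  split => //; first by move=> p q _ _; exact: signed_vec_inj.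
  move=> x Ax; exists ([ffun i => int_sign (x ord0 i)],
                      [ffun i => inord (int_rank (x ord0 i))]).
    rewrite /h /preimage/= (_ : signed_vec _ _ = x)//.
    by apply/rowP => i; rewrite mxE !ffunE inordK ?AK// signed_intK.
  by apply/rowP => i; rewrite mxE !ffunE inordK ?AK// signed_intK.
rewrite (reindex_fsbig h (h @^-1` A))//.
rewrite fsbig_mkcond (@fsbigE _ _ _ _ _ (index_enum _))//=; last 2 first.
- exact: index_enum_uniq.
- by move=> q _; rewrite mem_index_enum.
rewrite pair_bigA/=; apply: eq_big => [q|q _]; first by rewrite in_setT.
rewrite patchE (_ : (q \in h @^-1` A) = (h q \in A)).
  by rewrite /h; case: ifP => _; rewrite ?mul1r ?mul0r.
by apply/idP/idP; rewrite !inE.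
Qed.

Lemma enorm_ltE (x : 'rV[R]_d) r : 0 < r -> (enorm x < r) = (dotp x x < r ^+ 2).
Proof.
move=> r0; rewrite /enorm -{1}[r]gtr0_norm// -sqrtr_sqr ltr_sqrt//.
by rewrite exprn_gt0.
Qed.

Lemma outer_of_ball M t (p : {ffun 'I_d -> 'I_M.+1}) (x : 'rV[R]_d) r :
  (0 < t)%N -> r <= (t * M.+1)%:R -> 0 < r -> dotp x x < r ^+ 2 ->
  (forall i, (t * p i)%:R <= `|x ord0 i|) -> outer p.
Proof.
move=> t0 rM r0 xr px.
have t0' : 0 < t%:R ^+ 2 :> R by rewrite exprn_gt0// ltr0n.
rewrite /outer -(ltr_nat R) natr_sum -(ltr_pM2l t0').
apply: (@le_lt_trans _ _ (dotp x x)).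
  rewrite mulr_sumr /dotp; apply: ler_sum => i _.
  rewrite natrX -exprMn -natrM -expr2 -[leRHS](real_normK (num_real _)).
  by rewrite ler_sqr ?nnegrE.
apply: (lt_le_trans xr); rewrite natrX -exprMn -natrM.
by rewrite ler_sqr ?nnegrE// ltW.
Qed.

(** A strict inequality between integers leaves a gap of at least 1, hence [t ^ 2] after scaling by
    [t]. The first hypothesis makes this gap exceed the terms linear in [t] coming from the
    displacement [k] and from having only [t.-1] in the radius. *)
Lemma ball_of_inner M t k (p : {ffun 'I_d -> 'I_M.+1}) (x : 'rV[R]_d) r :
  (2 * d * k * M.+1 + 2 * M.+1 ^ 2 + d * k ^ 2 < t)%N ->
  (t.-1 * M.+1)%:R <= r -> inner p ->
  (forall i, `|x ord0 i| <= (t * (p i).+1 + k)%:R) -> dotp x x < r ^+ 2.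
Proof.
move=> kt tr ip px.
apply: (@le_lt_trans _ _ (\sum_(i < d) (t * (p i).+1 + k) ^ 2)%N%:R).
  rewrite natr_sum /dotp; apply: ler_sum => i _.
  rewrite natrX -expr2 -[leLHS](real_normK (num_real _)) ler_sqr ?nnegrE//.
apply: (@lt_le_trans _ _ ((t.-1 * M.+1) ^ 2)%N%:R); last first.
  by rewrite natrX ler_sqr ?nnegrE// (le_trans _ tr).
rewrite ltr_nat.
apply: (@leq_ltn_trans (t ^ 2 * (M.+1 ^ 2 - 1) + 2 * t * k * (d * M.+1) + d * k ^ 2)).
  apply: (@leq_trans (\sum_(i < d) (t ^ 2 * (p i).+1 ^ 2 + 2 * t * k * M.+1 + k ^ 2))).
    apply: leq_sum => i _; rewrite sqrnD expnMn addnAC leq_add2r leq_add2l.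
    rewrite (_ : 2 * t * k * M.+1 = 2 * (t * M.+1 * k))%N; last by ring.
    by rewrite leq_mul2l/= leq_mul2r leq_mul2l ltn_ord !orbT.
  rewrite !big_split/= -big_distrr/= !sum_nat_const card_ord.
  rewrite leq_add2r leq_add//; last by rewrite mulnCA.
  rewrite leq_mul2l; apply/orP; right.
  by rewrite -ltnS subn1 prednK ?expn_gt0.
case: t kt {tr px} => // t kt /=.
move: kt; move: (M.+1) (ltn0Sn M) => m m0 kt.
have : (t.+1 * (2 * d * k * m + 2 * m ^ 2 + d * k ^ 2) <= t.+1 * t)%N.
  by rewrite leq_mul2l.
nia.
Qed.

End balls.

Section ball_volume.
Context (R : realType) (d : nat).

Let cube M t (q : {ffun 'I_d -> bool} * {ffun 'I_d -> 'I_M.+1}) : set 'rV[R]_d :=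
  rbox (fun i => t%:R * (signed_vec q.1 q.2 ord0 i)%:~R) t%:R.

Let Q M (O : pred {ffun 'I_d -> 'I_M.+1}) :
    set ({ffun 'I_d -> bool} * {ffun 'I_d -> 'I_M.+1}) :=
  [set q | O q.2].

Lemma lebesgue_cubes M t (O : pred {ffun 'I_d -> 'I_M.+1}) : (0 < t)%N ->
  lebesgue_rV d (\bigcup_(q in Q O) cube t q : set (borel_rV R d)) =
  (#|{ffun 'I_d -> bool}|%:R * t%:R ^+ d * #|O|%:R)%:E.
Proof.
move=> t0; have t0' : 0 < t%:R :> R by rewrite ltr0n.
rewrite measure_fin_bigcup; last 3 first.
- exact: finite_finset.
- move=> q q' _ _ [x [xq xq']]; apply: (@signed_vec_inj d M.+1); apply/rowP => i.
  have /andP[h1 h2] := xq i; have /andP[h3 h4] := xq' i.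
  have aux (a b : int) : t%:R * a%:~R < t%:R * b%:~R + t%:R :> R -> (a <= b)%R.
    rewrite -[X in _ + X]mulr1 -mulrDr ltr_pM2l// -[X in _ + X]/(1%:~R) -intrD.
    by rewrite ltr_int ltzD1.
  by apply/le_anti; rewrite (aux _ _ (le_lt_trans h1 h4)) (aux _ _ (le_lt_trans h3 h2)).
- by move=> q _; exact: measurable_rbox.
rewrite fsbig_mkcond (@fsbigE _ _ _ _ _ (index_enum _))//=; last 2 first.
- exact: index_enum_uniq.
- by move=> q _; rewrite mem_index_enum.
transitivity (\sum_(q : {ffun 'I_d -> bool} * {ffun 'I_d -> 'I_M.+1} | O q.2)
  (t%:R ^+ d)%:E : \bar R)%E.
  rewrite [RHS]big_mkcond; apply: eq_big => [q|q _]; first by rewrite in_setT.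
  rewrite patchE mem_setE lebesgue_rbox//.
rewrite sumEFin; congr EFin.
rewrite -(pair_big xpredT O (fun _ _ => t%:R ^+ d))/=.
rewrite !sumr_const -mulrnA -[LHS]mulr_natr natrM.
rewrite [X in _ * (_ * X%:R)](_ : _ = #|{ffun 'I_d -> bool}|); last exact: eq_card.
rewrite [X in _ * (X%:R * _)](_ : _ = #|O|); last exact: eq_card.
by rewrite mulrA mulrC mulrA.
Qed.

Lemma measurable_eball r : measurable (eball r : set (borel_rV R d)).
Proof.
have [r0|r0] := ltP 0 r; last first.
  rewrite (_ : eball r = set0)//; apply/seteqP; split => // x.
  by rewrite /eball/= ltNge (le_trans r0)// sqrtr_ge0.
rewrite (_ : eball r = (fun x : borel_rV R d => dotp x x) @^-1` `]-oo, r ^+ 2[).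
  rewrite -[X in measurable X]setTI.
  have mD : measurable_fun [set: borel_rV R d] (fun x : borel_rV R d => dotp x x).
    apply: measurable_sum => i.
    by apply: measurable_funM; exact: measurable_borel_coord.
  exact: mD (measurable_itv _).
by apply/seteqP; split => x; rewrite /eball/= enorm_ltE//.
Qed.

(** Because -1 has rank 0, an interval of rank [p] lies at distance between [t * p] and [t * p.+1]
    from 0 on either side. Reflection swaps the closed and open ends, so both inequalities are
    weak. *)
Lemma signed_int_bounds (t p : nat) s (x : R) :
  t%:R * (signed_int s p)%:~R <= x < t%:R * (signed_int s p)%:~R + t%:R ->
  (t * p)%:R <= `|x| <= (t * p.+1)%:R.
Proof.
have tp0 : 0 <= t%:R * p%:R :> R by rewrite mulr_ge0.
have pS : p.+1%:R = p%:R + 1 :> R by rewrite -addn1 natrD.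
rewrite !natrM pS; case: s => /= /andP[].
  rewrite -[(Posz p)%:~R]/(p%:R : R) => h1 h2.
  by rewrite ger0_norm ?(le_trans tp0)//; apply/andP; split; lra.
rewrite NegzE mulrNz -[(Posz p.+1)%:~R]/(p.+1%:R : R) pS => h1 h2.
by rewrite ler0_norm; [apply/andP; split; lra|lra].
Qed.

Lemma rank_of_real (t : nat) (x : R) : (0 < t)%N ->
  exists z : int, t%:R * z%:~R <= x < t%:R * z%:~R + t%:R.
Proof.
move=> t0; have t0' : 0 < t%:R :> R by rewrite ltr0n.
exists (Num.floor (x / t%:R)).
have /andP[h1 h2] := real_floor_itv (num_real (x / t%:R)).
rewrite mulrC -ler_pdivlMr// h1/= -[X in _ + X]mul1r -mulrDl -ltr_pdivrMr//.
by rewrite -[X in _ + X]/(1%:~R) -intrD.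
Qed.

Let inner_sub M t r : (2 * M.+1 ^ 2 < t)%N ->
  (t.-1 * M.+1)%:R <= r -> 0 < r ->
  \bigcup_(q in Q (@inner d M)) cube t q `<=` eball r.
Proof.
move=> Mt tr r0 x [[s p] /= ip xp]; rewrite /eball/= enorm_ltE//.
apply: (@ball_of_inner _ _ _ t 0 p) => // [|i]; first by rewrite muln0 mul0n add0n exp0n// muln0 addn0.
rewrite addn0; have := xp i; rewrite /= mxE => /signed_int_bounds.
by case/andP.
Qed.

Let sub_outer M t r : (0 < t)%N -> r <= (t * M.+1)%:R -> 0 < r ->
  eball r `<=` \bigcup_(q in Q (@outer d M)) cube t q.
Proof.
move=> t0 rt r0 x; rewrite /eball/= enorm_ltE// => xr.
have /choice[z hz] i := rank_of_real (x ord0 i) t0.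
have zx i : (t * int_rank (z i))%:R <= `|x ord0 i|.
  have := hz i; rewrite -{1 2}(signed_intK (z i)) => /signed_int_bounds.
  by case/andP.
have zM i : (int_rank (z i) < M.+1)%N.
  rewrite -(ltn_pmul2l t0) -(ltr_nat R) (le_lt_trans (zx i))// (lt_le_trans _ rt)//.
  rewrite -[ltRHS]gtr0_norm// -ltr_sqr ?nnegrE// !real_normK ?num_real//.
  apply: le_lt_trans xr; rewrite /dotp (bigD1 i)//= -expr2 lerDl.
  by apply: sumr_ge0 => j _; rewrite -expr2 sqr_ge0.
exists ([ffun i => int_sign (z i)], [ffun i => inord (int_rank (z i))]).
  apply: (outer_of_ball t0 rt r0 xr) => i.
  by rewrite ffunE inordK.
by move=> i; rewrite mxE !ffunE inordK//= signed_intK.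
Qed.

(** The ball contains the inner cubes of all orthants and is covered by the outer ones. *)
Lemma volume_bounds M t r : (2 * M.+1 ^ 2 < t)%N ->
  (t.-1 * M.+1)%:R <= r -> r <= (t * M.+1)%:R -> 0 < r ->
  let v := #|{ffun 'I_d -> bool}|%:R * t%:R ^+ d in
  v * #|@inner d M|%:R <= fine (lebesgue_rV d (eball r : set (borel_rV R d)))
    <= v * #|@outer d M|%:R.
Proof.
move=> Mt tr rt r0 /=; set v := _ * t%:R ^+ d; have t0 : (0 < t)%N by exact: leq_ltn_trans Mt.
have mcubes O : measurable (\bigcup_(q in Q O) cube t q : set (borel_rV R d)).
  by apply: fin_bigcup_measurable => // q _; exact: measurable_rbox.
have le1 : ((v * #|@inner d M|%:R)%:E <= lebesgue_rV d (eball r : set (borel_rV R d)))%E.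
  rewrite -lebesgue_cubes//; apply: le_measure; rewrite ?inE//.
    exact: measurable_eball.
  exact: inner_sub.
have le2 : (lebesgue_rV d (eball r : set (borel_rV R d)) <= (v * #|@outer d M|%:R)%:E)%E.
  rewrite -lebesgue_cubes//; apply: le_measure; rewrite ?inE//.
    exact: measurable_eball.
  exact: sub_outer.
have fV : lebesgue_rV d (eball r : set (borel_rV R d)) \is a fin_num.
  by rewrite ge0_fin_numE// (le_lt_trans le2)// ltry.
by rewrite -!lee_fin fineK// le1 le2.
Qed.

End ball_volume.

Section ball_average.
Context (R : realType) (d : nat).
Variables (y : 'rV[int]_d -> R) (c : R) (k : 'rV[int]_d).
Hypothesis yc : box_averaging y c.
Hypothesis y0 : forall x, 0 <= y x.
Hypothesis c01 : 0 <= c <= 1.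

Let A r : set 'rV[int]_d := [set x | @enorm R d (lattice_pt x) < r /\
  @enorm R d (lattice_pt (x + k)) < r].

Let dotp_lattice_rank (x : 'rV[int]_d) i :
  (int_rank (x ord0 i))%:R <= `|@lattice_pt R d x ord0 i|.
Proof.
rewrite /lattice_pt mxE; case: (x ord0 i) => n /=; first by rewrite ler_norm.
by rewrite NegzE mulrNz normrN ger0_norm// ler_nat.
Qed.

Lemma lattice_ball_rank r n (x : 'rV[int]_d) i : r <= n%:R ->
  @enorm R d (lattice_pt x) < r -> (int_rank (x ord0 i) < n)%N.
Proof.
move=> rn xr; have r0 : 0 < r by apply: le_lt_trans xr; exact: sqrtr_ge0.
rewrite -(ltr_nat R) (le_lt_trans (dotp_lattice_rank x i))//.
apply: lt_le_trans rn; move: xr; rewrite enorm_ltE// => xr.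
rewrite -[ltRHS]gtr0_norm// -ltr_sqr ?nnegrE// !real_normK ?num_real//.
apply: le_lt_trans xr; rewrite /dotp (bigD1 i)//= -expr2 lerDl.
by apply: sumr_ge0 => j _; rewrite -expr2 sqr_ge0.
Qed.

Let inA_outer M t (s : {ffun 'I_d -> bool}) (p : {ffun 'I_d -> 'I_M.+1}) K
    (u : {ffun 'I_d -> 'I_K.+1}) r : (0 < t)%N -> r <= (t * M.+1)%:R -> 0 < r ->
  (forall i, (u i %/ t)%N = p i) -> A r (signed_vec s u) -> outer p.
Proof.
move=> t0 rt r0 up [+ _]; rewrite enorm_ltE// => ur.
apply: (outer_of_ball t0 rt r0 ur) => i.
apply: le_trans (dotp_lattice_rank _ i); rewrite ler_nat mxE -up.
rewrite (_ : int_rank _ = u i); first by rewrite mulnC leq_trunc_div.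
by case: (s i).
Qed.

(** The successor accounts for [Negz n], whose absolute value is [n.+1]. *)
Let kmax := (\max_(i < d) int_rank (k ord0 i)).+1.

Let inner_inA M t (s : {ffun 'I_d -> bool}) (p : {ffun 'I_d -> 'I_M.+1}) K
    (u : {ffun 'I_d -> 'I_K.+1}) r :
  (2 * d * kmax * M.+1 + 2 * M.+1 ^ 2 + d * kmax ^ 2 < t)%N ->
  (t.-1 * M.+1)%:R <= r -> 0 < r ->
  (forall i, (u i %/ t)%N = p i) -> inner p -> A r (signed_vec s u).
Proof.
move=> kt tr r0 up ip; have t0 : (0 < t)%N by exact: leq_ltn_trans kt.
have sgn_le z b : (`|(signed_int b z)%:~R : R| <= z.+1%:R).
  case: b => /=; first by rewrite -[_%:~R]/(z%:R) ger0_norm// ler_nat.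
  by rewrite NegzE mulrNz normrN ger0_norm.
have uS i : ((u i).+1 <= t * (p i).+1)%N by rewrite mulnC -ltn_divLR// up.
split; rewrite enorm_ltE//; apply: (ball_of_inner kt tr ip) => i.
  rewrite !mxE (le_trans (sgn_le _ _))// ler_nat (leq_trans (uS i))//.
  exact: leq_addr.
rewrite !mxE intrD (le_trans (ler_normD _ _))// natrD lerD//.
  by rewrite (le_trans (sgn_le _ _))// ler_nat.
rewrite -[k ord0 i]signed_intK (le_trans (sgn_le _ _))// ler_nat ltnS.
exact: (leq_bigmax (F := fun i => int_rank (k ord0 i))).
Qed.

Let V r := fine (lebesgue_rV d (eball r : set (borel_rV R d))).

(** As [y] is nonnegative, the sum over [A r] is at least the sum over the inner cubes, entirely
    contained in [A r] despite the shift by [k], and at most the full sum over the outer ones. On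
    each cube the average is within [e] of [c]. *)
Let D_bounds M t (e : R) r :
  (2 * d * kmax * M.+1 + 2 * M.+1 ^ 2 + d * kmax ^ 2 < t)%N ->
  (t.-1 * M.+1)%:R <= r -> r <= (t * M.+1)%:R -> 0 < r ->
  (forall s K (p : {ffun 'I_d -> 'I_M.+1}), (t * M.+1 <= K.+1)%N ->
    `|\sum_(u : {ffun 'I_d -> 'I_K.+1} | [forall i, (u i %/ t)%N == p i])
        y (signed_vec s u) - c * t%:R ^+ d| <= e * t%:R ^+ d) ->
  let v := #|{ffun 'I_d -> bool}|%:R * t%:R ^+ d in
  (c - e) * (v * #|@inner d M|%:R) <= \sum_(x \in A r) y x
    <= (c + e) * (v * #|@outer d M|%:R).
Proof.
move=> kt tr rt r0 cube /=; set v := _ * t%:R ^+ d.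
have t0 : (0 < t)%N by exact: leq_ltn_trans kt.
(* With this [K] the quotients by [t] of the indices range exactly over ['I_M.+1]. *)
pose K := (t * M.+1).-1.
have KE : K.+1 = (t * M.+1)%N by rewrite prednK// muln_gt0 t0.
rewrite (@fsbig_signed_vec R d K); last first.
  by move=> x [xr _] i; rewrite KE; exact: lattice_ball_rank xr.
pose S (s : {ffun 'I_d -> bool}) (p : {ffun 'I_d -> 'I_M.+1}) :=
  \sum_(u : {ffun 'I_d -> 'I_K.+1} | [forall i, (u i %/ t)%N == p i])
    (signed_vec s u \in A r)%:R * y (signed_vec s u).
have S0 s p : 0 <= S s p by apply: sumr_ge0 => u _; rewrite mulr_ge0.
have -> : \sum_(s : {ffun 'I_d -> bool}) \sum_(u : {ffun 'I_d -> 'I_K.+1})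
    (signed_vec s u \in A r)%:R * y (signed_vec s u) = \sum_s \sum_p S s p.
  apply: eq_bigr => s _.
  rewrite (partition_big (fun u : {ffun 'I_d -> 'I_K.+1} =>
    [ffun i => inord (u i %/ t)] : {ffun 'I_d -> 'I_M.+1}) xpredT)//=.
  apply: eq_bigr => p _; apply: eq_bigl => u.
  have uM i : (u i %/ t < M.+1)%N.
    by rewrite ltn_divLR// mulnC -KE.
  apply/eqP/forallP => [<- i|h]; first by rewrite ffunE inordK.
  by apply/ffunP => i; rewrite ffunE; apply: val_inj; rewrite /= inordK//; exact/eqP.
have sumO (O : pred {ffun 'I_d -> 'I_M.+1}) (x : R) :
    \sum_(p | O p) x * t%:R ^+ d = x * (t%:R ^+ d * #|O|%:R).
  by rewrite sumr_const -[LHS]mulr_natr -mulrA.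
have sumB (x : R) : \sum_(s : {ffun 'I_d -> bool}) x = #|{ffun 'I_d -> bool}|%:R * x.
  by rewrite sumr_const -[LHS]mulr_natl.
have cubeK s p := cube s K p (eq_leq (esym KE)).
apply/andP; split.
  rewrite /v -[_ * _ * _%:R]mulrA mulrCA -sumB; apply: ler_sum => s _.
  rewrite -sumO// (bigID (@inner d M) xpredT)/= -[leLHS]addr0 lerD//; last first.
    exact: sumr_ge0.
  apply: ler_sum => p ip.
  have -> : S s p = \sum_(u : {ffun 'I_d -> 'I_K.+1} | [forall i, (u i %/ t)%N == p i])
      y (signed_vec s u).
    apply: eq_bigr => u /forallP up.
    rewrite mem_set ?mul1r//; 
    exact: (@inner_inA M t s p K u r kt tr r0 (fun i => eqP (up i)) ip).
  by have := cubeK s p; rewrite ler_norml => /andP[+ _]; lra.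
rewrite /v -[_ * _ * _%:R]mulrA mulrCA -sumB; apply: ler_sum => s _.
rewrite -sumO// (bigID (@outer d M) xpredT)/= [X in _ + X]big1 ?addr0; last first.
  move=> p op; rewrite /S big1// => u /forallP up.
  rewrite memNset ?mul0r// => uA; move/negP: op; apply.
  exact: (@inA_outer M t s p K u r t0 rt r0 (fun i => eqP (up i)) uA).
apply: ler_sum => p op; apply: (@le_trans _ _ (\sum_(u : {ffun 'I_d -> 'I_K.+1} |
    [forall i, (u i %/ t)%N == p i]) y (signed_vec s u))).
  apply: ler_sum => u _; rewrite ler_piMl//.
  by rewrite lern1; case: (_ \in _).
by have := cubeK s p; rewrite ler_norml => /andP[_]; lra.
Qed.

(** [M] is fixed by the tolerance alone, and only the side [t] grows with [r]. The sum and the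
    volume are then squeezed between multiples of the same two cube counts, whose ratio is at most
    [1 + e]. *)
Lemma ball_average : (V r)^-1 * \sum_(x \in A r) y x @[r --> +oo] --> c.
Proof.
apply/cvgrPdist_le => eps eps0.
(* Since [c] and [e] are at most 1, [(c + e) * (1 + e)] is at most [c + 3 * e], hence the division
   by 3. *)
pose e := Num.min 1 (eps / 3).
have e0 : 0 < e by rewrite lt_min ltr01 divr_gt0.
have e1 : e <= 1 by rewrite ge_min lexx.
have e3 : 3 * e <= eps by rewrite mulrC -ler_pdivlMr// ge_min lexx orbT.
clearbody e.
have [M [b0 ab]] := @outer_inner_ratio d R e e0.
have /choice[N hN] s := cube_average s M yc e0.
pose T0 := maxn (\max_s N s) (2 * d * kmax * M.+1 + 2 * M.+1 ^ 2 + d * kmax ^ 2)%N.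
near=> r.
have r0 : 0 < r by near: r; exact: nbhs_pinfty_gt.
have rT : (T0.+1 * M.+1)%:R <= r by near: r; exact: nbhs_pinfty_ge.
pose t := (Num.truncn (r / M.+1%:R)).+1.
have M0 : 0 < M.+1%:R :> R by rewrite ltr0n.
have rt : r <= (t * M.+1)%:R.
  by rewrite natrM -ler_pdivrMr// ltW// truncnS_gt.
have tr : (t.-1 * M.+1)%:R <= r.
  rewrite natrM -ler_pdivlMr//= truncn_le//.
  by rewrite divr_ge0// ltW.
have Tt : (T0 < t)%N.
  by move: (le_trans rT rt); rewrite ler_nat leq_pmul2r.
have kt : (2 * d * kmax * M.+1 + 2 * M.+1 ^ 2 + d * kmax ^ 2 < t)%N.
  by rewrite (leq_ltn_trans _ Tt)// leq_maxr.
have cube s K (p : {ffun 'I_d -> 'I_M.+1}) : (t * M.+1 <= K.+1)%N ->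
    `|\sum_(u : {ffun 'I_d -> 'I_K.+1} | [forall i, (u i %/ t)%N == p i])
        y (signed_vec s u) - c * t%:R ^+ d| <= e * t%:R ^+ d.
  move=> tK; apply: hN => //; rewrite (leq_trans _ (ltnW Tt))//.
  by rewrite (leq_trans _ (leq_maxl _ _))// (leq_bigmax s).
have := D_bounds kt tr rt r0 cube.
have Mt : (2 * M.+1 ^ 2 < t)%N by rewrite (leq_ltn_trans _ kt)// -addnA addnCA leq_addr.
have := @volume_bounds R d M t r Mt tr rt r0.
rewrite /= -/(V r); set v := _ * t%:R ^+ d.
have v0 : 0 < v.
  rewrite mulr_gt0 ?exprn_gt0 ?ltr0n//.
  by apply/card_gt0P; exists [ffun=> true].
set D := \sum_(x \in _) _ => /andP[V1 V2] /andP[D1 D2].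
have vb : 0 < v * #|@inner d M|%:R by rewrite mulr_gt0// ltr0n.
have vab : v * #|@outer d M|%:R <= (1 + e) * (v * #|@inner d M|%:R).
  by rewrite mulrCA ler_wpM2l// ltW.
move: vb vab V1 V2 D1 D2; move: (v * _) (v * _) => a b b0' hab V1 V2 D1 D2.
have V0 : 0 < V r by exact: lt_le_trans V1.
have /andP[c0 c1] := c01.
have ce : c * e <= e by rewrite ler_piMl// ltW.
have ee : e * e <= e by rewrite ler_piMl// ltW.
have ee0 : 0 <= e * e by rewrite mulr_ge0// ltW.
have D0 : 0 <= D by rewrite /D fsumr_ge0.
have up : D <= (c + 3 * e) * V r.
  have h1 : D <= (c + e) * ((1 + e) * b).
    by rewrite (le_trans D2)// ler_wpM2l// addr_ge0// ltW.
  have h2 : (c + e) * (1 + e) <= c + 3 * e by lra.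
  have := ler_wpM2r (ltW b0') h2.
  have : (c + 3 * e) * b <= (c + 3 * e) * V r by rewrite ler_wpM2l// addr_ge0// mulr_ge0// ltW.
  lra.
have lo : (c - 3 * e) * V r <= D.
  (* A negative factor would reverse the upper bound on [V r]; in that case the claim follows from
     [D] being nonnegative. *)
  have [c3|c3] := leP (c - 3 * e) 0.
    by rewrite (le_trans _ D0)// mulr_le0_ge0// ltW.
  have h1 : (c - 3 * e) * V r <= (c - 3 * e) * ((1 + e) * b).
    by rewrite ler_wpM2l//; [exact: ltW|exact: le_trans V2 hab].
  have h2 : (c - 3 * e) * (1 + e) <= c - e by lra.
  have := ler_wpM2r (ltW b0') h2.
  lra.
rewrite distrC ler_norml mulrC; apply/andP; split.
  by rewrite lerBrDl ler_pdivlMr//; apply: le_trans lo; rewrite ler_wpM2r//; [exact: ltW|lra].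
by rewrite lerBlDl ler_pdivrMr//; apply: le_trans up _; rewrite ler_wpM2r//; [exact: ltW|lra].
Unshelve. all: by end_near. Qed.

End ball_average.

(** * Measures carried by the lattice, and the autocorrelation *)

Section Rintegral_sums.
Context dT (T : measurableType dT) (R : realType).
Variable m : {measure set T -> \bar R}.

Lemma integrable_bigsum (I : eqType) (s : seq I) (f : I -> T -> R) :
  (forall i, i \in s -> m.-integrable setT (EFin \o f i)) ->
  m.-integrable setT (EFin \o (fun x => \sum_(i <- s) f i x)).
Proof.
elim: s => [|i s ih] fs.
  rewrite (_ : EFin \o _ = cst 0%E); first exact: integrable0.
  by apply/funext => x /=; rewrite big_nil.
rewrite (_ : EFin \o _ = (EFin \o f i) \+ (EFin \o (fun x => (\sum_(i <- s) f i x)%R)))%E.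
  apply: integrableD => //; first by apply: fs; rewrite mem_head.
  by apply: ih => j js; apply: fs; rewrite inE js orbT.
by apply/funext => x /=; rewrite big_cons EFinD.
Qed.

Lemma Rintegral_bigsum (I : eqType) (s : seq I) (f : I -> T -> R) :
  (forall i, i \in s -> m.-integrable setT (EFin \o f i)) ->
  \int[m]_x (\sum_(i <- s) f i x) = \sum_(i <- s) \int[m]_x f i x.
Proof.
elim: s => [|i s ih] fs.
  by under eq_Rintegral do rewrite big_nil; rewrite Rintegral_cst// mul0r big_nil.
have fs' j : j \in s -> m.-integrable setT (EFin \o f j).
  by move=> js; apply: fs; rewrite inE js orbT.
under eq_Rintegral do rewrite big_cons.
rewrite RintegralD// ?big_cons ?ih//.
- by apply: fs; rewrite mem_head.
- exact: integrable_bigsum.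
Qed.

Lemma integrable_indic_lty (A : set T) : measurable A -> (m A < +oo)%E ->
  m.-integrable setT (EFin \o (\1_A : T -> R)).
Proof.
move=> mA Afin; apply/integrableP; split.
  by apply/measurable_EFinP; exact: measurable_indic.
rewrite (eq_integral (fun x => (\1_A x)%:E)); last first.
  by move=> x _; rewrite /= ger0_norm.
by rewrite integral_indic// setIT.
Qed.

End Rintegral_sums.

Section lattice_measures.
Context (R : realType) (d : nat).
Implicit Types (m : {measure set (borel_rV R d) -> \bar R}).

Lemma lattice_pt_inj : injective (@lattice_pt R d).
Proof.
move=> x y /rowP h; apply/rowP => i; have := h i; rewrite !mxE.
exact: intr_inj.
Qed.

Lemma measurable_rV_set1 (a : 'rV[R]_d) : measurable ([set a] : set (borel_rV R d)).
Proof.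
rewrite (_ : [set a] = \bigcap_(i in [set: 'I_d])
    ((fun x : borel_rV R d => x ord0 i) @^-1` [set a ord0 i])).
  apply: fin_bigcap_measurable => // i _.
  rewrite -[X in measurable X]setTI.
  exact: (measurable_borel_coord i measurableT (measurable_set1 _)).
apply/seteqP; split => [x -> //|x h]; apply/rowP => i.
exact: (h i I).
Qed.

Lemma measurable_lattice : measurable (range (@lattice_pt R d) : set (borel_rV R d)).
Proof.
rewrite (_ : range _ = \bigcup_(k in [set: 'rV[int]_d]) [set lattice_pt k]).
  by apply: countable_bigcupT_measurable => // k; exact: measurable_rV_set1.
by apply/seteqP; split => [_ [k _ <-]|x [k _ ->]]; exists k.
Qed.

Lemma continuous_measurable_rV (f : 'rV[R]_d -> R) : continuous f ->
  measurable_fun [set: borel_rV R d] (f : borel_rV R d -> R).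
Proof.
move=> /continuousP cf; apply: (measurability _ (RGenOInfty.measurableE R)).
move=> _ [_ [x ->] <-]; rewrite setTI; apply: sub_sigma_algebra.
by apply: cf; exact: interval_open.
Qed.

Lemma compact_coord_bounded (K : set 'rV[R]_d) : compact K ->
  exists n : nat, forall x, K x -> forall i, `|x ord0 i| <= n%:R.
Proof.
move=> cK.
have /choice[b hb] (i : 'I_d) : exists n : nat, forall x, K x -> `|x ord0 i| <= n%:R.
  have : compact ((fun x : 'rV[R]_d => x ord0 i) @` K).
    apply: continuous_compact => //; apply: continuous_subspaceT.
    exact: coord_continuous.
  move=> /compact_bounded[M [_ hM]].
  exists (Num.truncn (`|M| + 1)).+1 => x Kx.
  rewrite (@le_trans _ _ (`|M| + 1))//; last exact: ltW (truncnS_gt _).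
  by apply: (hM (`|M| + 1)); [rewrite ltr_pwDr// ler_norm|exists x].
exists (\max_i b i)%N => x Kx i; rewrite (le_trans (hb i x Kx))// ler_nat.
exact: leq_bigmax.
Qed.

(** Reduces vague convergence to convergence of the masses at single points: a compactly supported
    test function sees finitely many lattice points. *)
Lemma lattice_integral m (f : 'rV[R]_d -> R) (s : seq 'rV[int]_d) :
  m (~` range (@lattice_pt R d)) = 0%E -> uniq s ->
  (forall k, k \in s -> (m [set lattice_pt k] < +oo)%E) ->
  (forall k, k \notin s -> f (lattice_pt k) = 0) ->
  measurable_fun [set: borel_rV R d] (f : borel_rV R d -> R) ->
  (\int[m]_x f x)%R = \sum_(k <- s) f (lattice_pt k) * fine (m [set lattice_pt k]).
Proof.
move=> m0 us mfin fs mf.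
pose g (x : borel_rV R d) : R :=
  \sum_(k <- s) f (lattice_pt k) * \1_[set @lattice_pt R d k] x.
have m1 k : measurable_fun [set: borel_rV R d]
    (fun x => f (lattice_pt k) * \1_[set @lattice_pt R d k] x).
  apply: measurable_funM => //; apply: measurable_indic.
  exact: measurable_rV_set1.
have mg : measurable_fun setT g by apply: measurable_sum => k; exact: m1.
transitivity (\int[m]_x g x)%R.
  rewrite /Rintegral; congr fine; apply: ae_eq_integral => //.
  - exact/measurable_EFinP.
  - exact/measurable_EFinP.
  exists (~` range (@lattice_pt R d)); split => //.
    by apply: measurableC; exact: measurable_lattice.
  apply: subsetC => _ [k _ <-] _ /=; congr EFin; rewrite /g.
  have [ks|ks] := boolP (k \in s).
    rewrite (bigD1_seq k)//= indicE mem_set// mulr1 big1 ?addr0// => j jk.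
    rewrite indicE memNset ?mulr0//= => /lattice_pt_inj kj.
    by rewrite kj eqxx in jk.
  rewrite fs// big_seq big1// => j js.
  rewrite indicE memNset ?mulr0//= => /lattice_pt_inj kj.
  by rewrite kj js in ks.
have i1 k : k \in s -> m.-integrable setT
    (EFin \o (\1_[set @lattice_pt R d k] : borel_rV R d -> R)).
  by move=> ks; apply: integrable_indic_lty; [exact: measurable_rV_set1|exact: mfin].
rewrite /g Rintegral_bigsum; last first.
  move=> k ks; rewrite (_ : EFin \o _ = fun x => ((f (lattice_pt k))%:E *
      (EFin \o (\1_[set @lattice_pt R d k] : borel_rV R d -> R)) x)%E).
    by apply: integrableZl => //; exact: i1.
  by apply/funext => x /=; rewrite EFinM.
rewrite [LHS]big_seq [RHS]big_seq; apply: eq_bigr => k ks.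
rewrite RintegralZl//; last exact: i1.
congr (_ * _); rewrite /Rintegral integral_indic ?setIT//.
exact: measurable_rV_set1.
Qed.

End lattice_measures.

Section autocorrelation.
Context (R : realType) (d : nat).

Definition box_seq K : seq 'rV[int]_d :=
  [seq signed_vec q.1 q.2 | q : {ffun 'I_d -> bool} * {ffun 'I_d -> 'I_K.+1}].

Lemma box_seq_uniq K : uniq (box_seq K).
Proof. by rewrite map_inj_uniq ?enum_uniq//; exact: signed_vec_inj. Qed.

Lemma mem_box_seq K (x : 'rV[int]_d) : (forall i, (int_rank (x ord0 i) < K.+1)%N) -> x \in box_seq K.
Proof.
move=> xK; apply/mapP.
exists ([ffun i => int_sign (x ord0 i)], [ffun i => inord (int_rank (x ord0 i))]).
  by rewrite mem_enum.
by apply/rowP => i; rewrite mxE !ffunE inordK//= signed_intK.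
Qed.

Lemma finite_int_rank K (A : set 'rV[int]_d) :
  (forall x, A x -> forall i, (int_rank (x ord0 i) < K.+1)%N) -> finite_set A.
Proof.
move=> AK; apply: (sub_finite_set (B := [set` box_seq K])) => [x Ax|].
  exact: mem_box_seq (AK x Ax).
exact: finite_seq.
Qed.

Lemma int_rank_lattice (x : 'rV[int]_d) i n :
  `|@lattice_pt R d x ord0 i| <= n%:R -> (int_rank (x ord0 i) <= n)%N.
Proof.
move=> xn; rewrite -(ler_nat R); apply: le_trans xn.
rewrite mxE; case: (x ord0 i) => j /=; first by rewrite ler_norm.
by rewrite NegzE mulrNz normrN ger0_norm// ler_nat.
Qed.

Section comb.
Context (dT : measure_display) (T : measurableType dT) (P : probability T R).
Variable X : 'rV[int]_d -> {mfun T >-> bool}.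

Lemma correlation_le1 k : correlation P X k <= 1.
Proof.
rewrite /correlation unlock -/(Rintegral P setT _) -[leRHS](Rintegral_probability_cst P).
have mX j : measurable_fun setT (fun w => (X j w)%:R : R).
  rewrite (_ : (fun w => _) = \1_(X j @^-1` [set true])).
    by apply: measurable_indic; rewrite -[X in measurable X]setTI; exact: measurable_funPT.
  apply/funext => w; rewrite indicE; case Xw: (X j w); first by rewrite mem_set.
  by rewrite memNset//= Xw.
apply: le_Rintegral => //.
- apply: (@bounded_integrable _ _ _ _ _ 1); first exact: measurable_funM.
  by move=> w; case: (X 0 w); case: (X k w); rewrite /= ?mul0r ?mulr0 ?mulr1 ?normr0 ?normr1 ?ler01.
- exact: finite_measure_integrable_cst.
- by move=> w _; case: (X 0 w); case: (X k w); rewrite /= ?mul0r ?mulr0 ?mulr1 ?ler01.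
Qed.

Lemma correlation_combE (A : set (borel_rV R d)) : correlation_comb P X A =
  \esum_(k in [set k | A (lattice_pt k)]) (correlation P X k)%:E.
Proof.
rewrite /correlation_comb/= /esum_measure [RHS]esum_mkcond; apply: eq_esum => k _.
transitivity ((correlation P X k)%:E * (@dirac _ (borel_rV R d) (lattice_pt k) R A))%E => //.
rewrite diracE.
rewrite (_ : (k \in [set k | A (lattice_pt k)]) = (lattice_pt k \in A)).
  by case: ifP => _; rewrite ?mule1 ?mule0.
by apply/idP/idP; rewrite !inE.
Qed.

Lemma correlation_comb_pt k :
  correlation_comb P X [set lattice_pt k] = (correlation P X k)%:E.
Proof.
rewrite correlation_combE (_ : mkset _ = [set k]).
  by rewrite esum_set1// lee_fin correlation_ge0.
by apply/seteqP; split => [j /= /lattice_pt_inj//|j ->].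
Qed.

Lemma correlation_comb_lattice :
  correlation_comb P X (~` range (@lattice_pt R d)) = 0%E.
Proof.
rewrite correlation_combE (_ : mkset _ = set0) ?esum_set0//.
by apply/seteqP; split => // k /= []; exists k.
Qed.

Lemma correlation_comb_locally_finite : locally_finite_measure (correlation_comb P X).
Proof.
move=> K /compact_coord_bounded[n Kn].
have fin : finite_set [set k | K (lattice_pt k)].
  apply: (@finite_int_rank n) => x Kx i; rewrite ltnS.
  by apply: int_rank_lattice; exact: Kn.
rewrite correlation_combE esum_fset//.
  by rewrite fsumEFin// ltry.
by move=> k _; rewrite lee_fin correlation_ge0.
Qed.

Variable w : T.

Lemma point_set_locally_finite : @locally_finite R d (point_set X w).
Proof.
move=> r; apply: (sub_finite_set (B := lattice_pt @` [set k | @enorm R d (lattice_pt k) < r])).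
  by move=> _ [[k _ <-] kr]; exists k.
apply: finite_image.
apply: (@finite_int_rank (Num.truncn r)) => x xr i.
by apply: lattice_ball_rank xr; exact: ltW (truncnS_gt _).
Qed.

Let V r := fine (lebesgue_rV d (eball r : set (borel_rV R d))).

Lemma averaged_differences_lattice r :
  averaged_differences (point_set X w) r (~` range (@lattice_pt R d)) = 0%E.
Proof.
rewrite /averaged_differences/= /mscale/= /esum_measure esum1 ?mule0//.
move=> [_ _] /= [[[k _ <-] _] [[j _ <-] _]].
rewrite diracE memNset//=; apply; exists (j - k) => //.
by rewrite /lattice_pt map_mxB.
Qed.

(** A pair of points with difference [k] is determined by its first member, so the double sum over
    pairs becomes a sum over one lattice point. *)
Lemma averaged_differences_pt r k :
  averaged_differences (point_set X w) r [set lattice_pt k] =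
  ((V r)^-1 * \sum_(x \in [set x | @enorm R d (lattice_pt x) < r /\
      @enorm R d (lattice_pt (x + k)) < r]) ((X x w)%:R * (X (x + k) w)%:R : R))%:E.
Proof.
rewrite /averaged_differences/= /mscale/= EFinM; congr (_ * _)%E.
set A := mkset _; set S := (X in esum_measure X).
have finA : finite_set A.
  apply: (@finite_int_rank (Num.truncn r)) => x [xr _] i.
  by apply: lattice_ball_rank xr; exact: ltW (truncnS_gt _).
pose J := [set xy : 'rV[R]_d * 'rV[R]_d | xy.2 - xy.1 = lattice_pt k].
pose A' := A `&` [set x | X x w && X (x + k) w].
transitivity (\esum_(xy in S `&` J) (1%:E : \bar R)).
  rewrite esum_mkcondr; apply: eq_esum => xy _.
  transitivity (@dirac _ (borel_rV R d) (xy.2 - xy.1) R [set lattice_pt k]) => //.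
  rewrite diracE.
  rewrite (_ : (xy.2 - xy.1 \in _) = (xy \in J)); first by case: ifP.
  by apply/idP/idP; rewrite !inE.
rewrite (reindex_esum A' _ (fun x => (lattice_pt x, lattice_pt (x + k)))); last first.
  have lD x : lattice_pt (x + k) = lattice_pt x + lattice_pt k :> 'rV[R]_d.
    by rewrite /lattice_pt map_mxD.
  split.
  - move=> x [[/= h1 h2] /andP[Xx Xk]]; split.
      by split => /=; split => //; [exists x|exists (x + k)].
    by rewrite /J/= lD addrC addKr.
  - by move=> x x' _ _ [] /lattice_pt_inj.
  - move=> [_ _] /= [[/= [[x Xx <-] xr] [[x' Xx' <-] xr']]].
    rewrite /J/= => /eqP; rewrite subr_eq addrC -lD => /eqP/lattice_pt_inj E.
    by rewrite E in xr' Xx' *; exists x => //; split => //=; rewrite Xx Xx'.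
rewrite esum_mkcondr -fsumEFin//.
rewrite (eq_esum (b := fun x => ((X x w)%:R * (X (x + k) w)%:R)%:E)).
  by rewrite esum_fset// => x _; rewrite lee_fin mulr_ge0.
move=> x _; rewrite -natrM mulnb.
by case: ifPn; [rewrite inE/= => ->|rewrite notin_setE/= => /negP/negbTE ->].
Qed.

Hypothesis Xbox : forall k,
  box_averaging (fun x => (X x w)%:R * (X (x + k) w)%:R) (correlation P X k).

Lemma point_set_autocorrelation :
  is_autocorrelation (point_set X w) (correlation_comb P X).
Proof.
split; [exact: point_set_locally_finite|exact: correlation_comb_locally_finite|].
move=> f cf cK; have [n fn] := compact_coord_bounded cK.
have f0 k : k \notin box_seq n -> f (lattice_pt k) = 0.
  move=> kn; apply: contraNeq kn => fk; apply: mem_box_seq => i; rewrite ltnS.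
  by apply: int_rank_lattice; apply: fn; exact: subset_closure.
have mf := continuous_measurable_rV cf.
rewrite (lattice_integral correlation_comb_lattice (box_seq_uniq n) _ f0 mf); last first.
  by move=> k _; rewrite correlation_comb_pt ltry.
under eq_cvg => r.
  rewrite (lattice_integral (averaged_differences_lattice r) (box_seq_uniq n) _ f0 mf);
    last by move=> k _; rewrite averaged_differences_pt ltry.
  over.
apply: cvg_big => [|k _]; first exact: add_continuous.
apply: cvgMr; rewrite correlation_comb_pt/=.
under eq_cvg do rewrite averaged_differences_pt/=.
apply: ball_average => //.
by rewrite correlation_ge0 correlation_le1.
Qed.

End comb.

(** Each [k] has its own null set. Enumerating Z^d by [pickle_inv] gathers them into a single one,
    off which every mass converges. *)
Lemma ae_autocorrelation (dT : measure_display) (T : measurableType dT)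
    (P : probability T R) (X : 'rV[int]_d -> {mfun T >-> bool}) :
  stationary P X -> ergodic P X ->
  {ae P, forall w, is_autocorrelation (point_set X w) (correlation_comb P X)}.
Proof.
move=> stat erg.
have : {ae P, forall w, forall n, if @pickle_inv 'rV[int]_d n is Some k then
    box_averaging (fun x => (X x w)%:R * (X (x + k) w)%:R) (correlation P X k)
    else True}.
  apply/ae_foralln => n; case: (pickle_inv n) => [k|]; last by apply: aeW.
  exact: process_box_averages.
apply: filterS => w h; apply: point_set_autocorrelation => k.
by have := h (pickle k); rewrite pickleK_inv.
Qed.

End autocorrelation.

Section esum_measure_integral.
Local Open Scope ereal_scope.
Context dT (T : measurableType dT) (R : realType) (I : countType).

(** Turns a sum over a countable type into a series, padded by 0 at the numbers that code nothing,
    so that series of measures can be used. *)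
Lemma esum_pickle (a : I -> \bar R) : (forall i, 0 <= a i) ->
  \esum_(i in [set: I]) a i = \sum_(n <oo) oapp a 0 (pickle_inv n).
Proof.
move=> a0; have a0' n : 0 <= oapp a 0 (@pickle_inv I n) by case: (pickle_inv n).
rewrite nneseries_esumT//.
rewrite [RHS](_ : _ = \esum_(n in range (@pickle I)) oapp a 0 (pickle_inv n)).
  rewrite (reindex_esum setT (range (@pickle I)) (@pickle I)).
    by apply: eq_esum => i _; rewrite pickleK_inv.
  by apply: inj_bij => i j _ _; exact: (pcan_inj (@pickleK_inv I)).
rewrite [RHS]esum_mkcond; apply: eq_esum => n _; case: ifPn => //.
rewrite notin_setE/= => nI; case E: (pickle_inv n) => [i|//].
by exfalso; apply: nI; exists i => //; have := @pickle_invK I n; rewrite E.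
Qed.

Lemma ge0_integral_esum_measure (m : I -> {measure set T -> \bar R}) (f : T -> \bar R) :
  measurable_fun setT f -> (forall x, 0 <= f x) ->
  \int[esum_measure setT m]_x f x = \esum_(i in [set: I]) \int[m i]_x f x.
Proof.
move=> mf f0.
pose m' n : {measure set T -> \bar R} := oapp m mzero (@pickle_inv I n).
transitivity (\int[mseries m' 0]_x f x).
  apply: eq_measure_integral => A mA _.
  rewrite [LHS]esum_pickle/=; last by move=> i; exact: measure_ge0.
  by apply: eq_eseriesr => n _; rewrite /m'; case: (pickle_inv n).
rewrite ge0_integral_measure_series// esum_pickle; last first.
  by move=> i; apply: integral_ge0 => x _.
apply: eq_eseriesr => n _; rewrite /m'; case: (pickle_inv n) => //=.
by rewrite integral_measure_zero.
Qed.

End esum_measure_integral.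

(** * The Dirac comb and periodization *)

Section dirac_comb.
Context (R : realType) (d : nat).

Definition dirac_comb : set (borel_rV R d) -> \bar R :=
  esum_measure [set: 'rV[int]_d] (fun k => @dirac _ (borel_rV R d) (lattice_pt k) R).

HB.instance Definition _ := Measure.on dirac_comb.

Lemma ge0_integral_dirac_comb (f : borel_rV R d -> \bar R) :
  measurable_fun setT f -> (forall x, 0 <= f x)%E ->
  (\int[dirac_comb]_x f x = \esum_(k in [set: 'rV[int]_d]) f (lattice_pt k))%E.
Proof.
move=> mf f0; rewrite [LHS]ge0_integral_esum_measure//.
by apply: eq_esum => k _; rewrite integral_dirac// diracT mul1e.
Qed.

Lemma dirac_combE (A : set (borel_rV R d)) : dirac_comb A =
  (\esum_(k in [set k | A (lattice_pt k)]) 1)%E.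
Proof.
rewrite /dirac_comb /esum_measure [RHS]esum_mkcond; apply: eq_esum => k _.
transitivity (@dirac _ (borel_rV R d) (lattice_pt k) R A) => //.
rewrite diracE (_ : (k \in [set k | A (lattice_pt k)]) = (lattice_pt k \in A)).
  by case: ifP.
by apply/idP/idP; rewrite !inE.
Qed.

Lemma dirac_comb_pt k : dirac_comb [set lattice_pt k] = 1%E.
Proof.
rewrite dirac_combE (_ : mkset _ = [set k]) ?esum_set1//.
by apply/seteqP; split => [j /= /lattice_pt_inj//|j ->].
Qed.

Lemma dirac_comb_lattice : dirac_comb (~` range (@lattice_pt R d)) = 0%E.
Proof.
rewrite dirac_combE (_ : mkset _ = set0) ?esum_set0//.
by apply/seteqP; split => // k /= []; exists k.
Qed.

Let dirac_comb_sigma_finite : sigma_finite setT dirac_comb.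
Proof.
(* Index 0 holds the complement of the lattice, which is null; index [n'.+1] holds the lattice point
   of code [n'], if any. *)
exists (fun n => if n is n'.+1 then oapp (fun k => [set lattice_pt k]) set0
  (@pickle_inv 'rV[int]_d n') else ~` range (@lattice_pt R d)).
  apply/seteqP; split => // x _.
  have [[k _ <-]|nx] := pselect (range (@lattice_pt R d) x); last by exists 0%N.
  by exists (pickle k).+1 => //=; rewrite pickleK_inv.
case=> [|n] /=.
  split; first by apply: measurableC; exact: measurable_lattice.
  by rewrite dirac_comb_lattice.
case: (pickle_inv n) => [k|] /=; last by rewrite measure0.
by rewrite dirac_comb_pt ltry; split => //; exact: measurable_rV_set1.
Qed.

HB.instance Definition _ := Measure_isSigmaFinite.Build _ _ _ dirac_comb
  dirac_comb_sigma_finite.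

End dirac_comb.
Arguments dirac_comb : clear implicits.

Section weight.
Context (R : realType) (d : nat).

(** The common dominating function: summable over the lattice, Lebesgue integrable, comparable with
    its translates, and a majorant up to a factor of any function bounded against finitely many
    monomials. *)
Definition weight (x : 'rV[R]_d) : R := \prod_i (1 + x ord0 i ^+ 2)^-1.

Lemma weight_gt0 x : 0 < weight x.
Proof. by apply: prodr_gt0 => i _; rewrite invr_gt0 ltr_wpDr// sqr_ge0. Qed.

Lemma measurable_weight : measurable_fun [set: borel_rV R d] (weight : borel_rV R d -> R).
Proof.
apply: measurable_prod => i _.
rewrite (_ : (fun x => _) = (fun z : R => (1 + z ^+ 2)^-1) \o
  (fun x : borel_rV R d => x ord0 i))//.
apply: measurableT_comp; last exact: measurable_borel_coord.
apply: continuous_measurable_fun => z.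
apply: cvgV; first by rewrite gt_eqF// ltr_wpDr// sqr_ge0.
by apply: cvgD; [exact: cvg_cst|exact: exprn_continuous].
Qed.

(** The factor is 3 per coordinate: [z ^ 2] is at most [2 (z + v) ^ 2 + 2 v ^ 2], so [1 + z ^ 2] is
    at most [3 (1 + (z + v) ^ 2)] when [v ^ 2] is at most 1. *)
Lemma weight_shift (x u : 'rV[R]_d) : (forall i, `|u ord0 i| <= 1) ->
  weight (x + u) <= 3 ^+ d * weight x.
Proof.
move=> u1; rewrite /weight (_ : 3 ^+ d = \prod_(i < d) 3); last by rewrite prodr_const card_ord.
rewrite -big_split/=.
apply: ler_prod => i _; rewrite invr_ge0 addr_ge0 ?sqr_ge0//=.
have h (z : R) : 0 < 1 + z ^+ 2 by rewrite ltr_wpDr// sqr_ge0.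
rewrite mxE; move: (x ord0 i) (u ord0 i) (u1 i) => z v v1.
rewrite -[3]invrK -invfM lef_pV2 ?posrE ?h ?mulr_gt0 ?invr_gt0//.
rewrite ler_pdivrMl//.
have : v ^+ 2 <= 1 by rewrite -[v ^+ 2]real_normK ?num_real// expr_le1.
have := sqr_ge0 (z + 2 * v); rewrite !expr2; nra.
Qed.

(** Telescoping: for [x >= 1], [1 / (1 + x ^ 2)] is at most [2 / x - 2 / (x + 1)]. The total 3 is 1
    for [j = 0] plus 2. *)
Lemma sum_inv_sqr K : \sum_(j < K) (1 + j%:R ^+ 2)^-1 <= 3 :> R.
Proof.
suff h : \sum_(j < K.+1) (1 + j%:R ^+ 2)^-1 <= 3 - 2 / K.+1%:R :> R.
  apply: le_trans (le_trans h _); last by rewrite gerBl divr_ge0.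
  by rewrite big_ord_recr/= lerDl invr_ge0 addr_ge0 ?sqr_ge0.
elim: K => [|K ih].
  by rewrite big_ord1 expr0n/= addr0 invr1; lra.
rewrite big_ord_recr/=.
have : (1 + K.+1%:R ^+ 2)^-1 <= 2 / K.+1%:R - 2 / K.+2%:R :> R.
  have x0 : 0 < K.+1%:R :> R by rewrite ltr0n.
  have x1 : 1 <= K.+1%:R :> R by rewrite ler1n.
  rewrite -[K.+2]addn1 natrD; move: (K.+1%:R) x0 x1 => x x0 x1.
  rewrite [leRHS](_ : _ = 2 / (x * (x + 1))); last by field; lra.
  have h1 : 0 < 1 + x ^+ 2 by rewrite ltr_wpDr// sqr_ge0.
  have h2 : 0 < x * (x + 1) by rewrite mulr_gt0//; lra.
  rewrite -[leLHS]mul1r ler_pdivrMr// mulrAC ler_pdivlMr// expr2; nra.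
move: ih; move: (2 / K.+2%:R) (2 / K.+1%:R) ((1 + K.+1%:R ^+ 2)^-1) => a b e.
by move: (\sum_(_ < _) _) => t *; lra.
Qed.

Lemma dirac_comb_weight : (\int[dirac_comb R d]_x (weight x)%:E < +oo)%E.
Proof.
have mw : measurable_fun [set: borel_rV R d] (fun x : borel_rV R d => (weight x)%:E).
  by apply/measurable_EFinP; exact: measurable_weight.
rewrite ge0_integral_dirac_comb//; last by move=> x; rewrite lee_fin ltW ?weight_gt0.
(* Each coordinate contributes 6, that is 3 from [sum_inv_sqr] for each of the two half-lines. *)
apply: (@le_lt_trans _ _ (6 ^+ d)%:E); last exact: ltry.
apply: ge_ereal_sup => _ [A [finA _] <-].
rewrite fsumEFin// lee_fin.
have [K AK] : exists K, forall x, A x -> forall i, (int_rank (x ord0 i) < K.+1)%N.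
  have /finite_seqP[q qA] := finA.
  exists (\max_(x <- q) \max_i int_rank (x ord0 i))%N => x; rewrite qA /= => xq i.
  rewrite ltnS (leq_trans (leq_bigmax (F := fun i => int_rank (x ord0 i)) i))//.
  exact: (@leq_bigmax_seq _ q xpredT (fun x : 'rV[int]_d => \max_i int_rank (x ord0 i))%N).
rewrite (fsbig_signed_vec _ AK).
pose psi (b : bool) (j : 'I_K.+1) : R := (1 + (signed_int b j)%:~R ^+ 2)^-1.
apply: (@le_trans _ _ (\prod_(i < d) \sum_(b : bool) \sum_(j < K.+1) psi b j)).
  rewrite bigA_distr_bigA/=; apply: ler_sum => s _.
  rewrite bigA_distr_bigA/=; apply: ler_sum => u _.
  rewrite (le_trans (_ : _ <= weight (lattice_pt (signed_vec s u))))//.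
    by rewrite ler_piMl ?(ltW (weight_gt0 _))// lern1; case: (_ \in _).
  rewrite /weight/psi le_eqVlt; apply/orP; left; apply/eqP.
  by apply: eq_bigr => i _; rewrite !mxE.
rewrite (_ : 6 ^+ d = \prod_(i < d) 6); last by rewrite prodr_const card_ord.
apply: ler_prod => i _; rewrite sumr_ge0/=; last first.
  by move=> b _; apply: sumr_ge0 => j _; rewrite invr_ge0 addr_ge0 ?sqr_ge0.
have psi_le b j : psi b j <= (1 + j%:R ^+ 2)^-1.
  rewrite lef_pV2 ?posrE ?ltr_wpDr ?sqr_ge0// lerD2l.
  case: b => /=; first by [].
  by rewrite NegzE mulrNz sqrrN -[_%:~R]/(j.+1%:R) ler_sqr ?nnegrE// ler_nat.
rewrite big_bool/= (_ : 6 = 3 + 3); last by lra.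
by apply: lerD; rewrite (le_trans _ (sum_inv_sqr K.+1))//; apply: ler_sum => j _.
Qed.

End weight.

(** * Translation invariance, and Lebesgue measure as a periodization *)

Section lebesgue_translation.
Context (R : realType).

Lemma lebesgue_measure_translation (a : R) (A : set (measurableTypeR R)) : measurable A ->
  lebesgue_measure ((fun x : R => x + a) @^-1` A) = lebesgue_measure A.
Proof.
move=> mA; pose t (x : measurableTypeR R) : measurableTypeR R := x + a.
have mt : measurable_fun setT t by apply: measurable_funD.
pose m := pushforward (@lebesgue_measure R) t.
have mE X : ocitv X -> lebesgue_measure X = m X.
  move=> [[x y] /= _ <-]; rewrite /m /pushforward.
  rewrite (_ : t @^-1` _ = `]x - a, y - a]%classic); last first.
    apply/seteqP; split => z; rewrite /preimage/= !in_itv/= /t.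
      by rewrite ltrBlDr lerBrDr.
    by rewrite ltrBlDr lerBrDr.
  transitivity (lebesgue_measure (`]x, y]%classic : set R)) => //.
  transitivity (lebesgue_measure (`]x - a, y - a]%classic : set R)) => //.
  rewrite !lebesgue_measure_itv/= !lte_fin ltrD2r; case: ifP => // _.
  by rewrite -!EFinB; congr EFin; lra.
exact/esym/(@lebesgue_measure_unique R (HB.pack m (Measure.on m)) mE A mA).
Qed.

Lemma measurable_rV_translation d (h : 'rV[R]_d) :
  measurable_fun [set: borel_rV R d] ((fun x => x + h) : borel_rV R d -> borel_rV R d).
Proof.
apply: measurable_fun_rV => i; under eq_fun do rewrite mxE.
by apply: measurable_funD => //; exact: measurable_borel_coord.
Qed.

Lemma lebesgue_rV_translation d (h : 'rV[R]_d) (A : set (borel_rV R d)) : measurable A ->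
  lebesgue_rV d ((fun x : 'rV[R]_d => x + h) @^-1` A) = lebesgue_rV d A.
Proof.
elim: d h A => [|d ih] h A mA.
  congr (_ _); apply/seteqP; split => x; rewrite /preimage/=;
    by rewrite (_ : x + h = x)//; apply/rowP => -[].
pose h' : 'rV[R]_d := \row_i h ord0 (lift ord0 i).
pose t (p : measurableTypeR R * borel_rV R d) : measurableTypeR R * borel_rV R d :=
  (p.1 + h ord0 ord0, (p.2 : 'rV[R]_d) + h').
have mt : measurable_fun setT t.
  apply: measurable_fun_pair; first by apply: measurable_funD => //; exact: measurable_fst.
  exact: (measurableT_comp (measurable_rV_translation h') measurable_snd).
have mcA : measurable (@cons_rV R d @^-1` A : set (measurableTypeR R * borel_rV R d)).
  by rewrite -[X in measurable X]setTI; exact: measurable_cons_rV.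
rewrite /= /lebesgue_cons {1 2}/pushforward.
rewrite [in RHS](@product_measure_unique _ _ _ _ _ _ _
   (pushforward (lebesgue_measure \x (lebesgue_rV d))%E t) _ _ mcA).
  rewrite /pushforward; congr (_ _); apply/seteqP; split => -[x y];
    rewrite /preimage/= (_ : cons_rV (x, y) + h = cons_rV (t (x, y)))//;
    apply/rowP => i; case: (unliftP ord0 i) => [j ->|->];
    by rewrite mxE ?cons_rVS ?cons_rV0//= ?mxE.
move=> B D mB mD; rewrite /= /pushforward.
rewrite (_ : t @^-1` _ = ((fun x : R => x + h ord0 ord0) @^-1` B) `*`
  ((fun x : 'rV[R]_d => x + h') @^-1` D))//.
have mB' : measurable ((fun x : R => x + h ord0 ord0) @^-1` B : set (measurableTypeR R)).
  have ma : measurable_fun setT (fun x : measurableTypeR R => x + h ord0 ord0).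
    by apply: measurable_funD.
  by rewrite -[X in measurable X]setTI; exact: ma.
have mD' : measurable ((fun x : 'rV[R]_d => x + h') @^-1` D : set (borel_rV R d)).
  by rewrite -[X in measurable X]setTI; exact: measurable_rV_translation.
rewrite product_measure1E//; congr (_ * _)%E; last exact: ih.
exact: lebesgue_measure_translation.
Qed.

End lebesgue_translation.

Section periodization_integral.
Context (R : realType) (d : nat).

Let add (p : borel_rV R d * borel_rV R d) : borel_rV R d :=
  (p.1 : 'rV[R]_d) + (p.2 : 'rV[R]_d).

Lemma measurable_add_rV : measurable_fun setT add.
Proof.
apply: measurable_fun_rV => i; under eq_fun do rewrite mxE.
apply: measurable_funD.
  exact: (measurableT_comp (measurable_borel_coord i) measurable_fst).
exact: (measurableT_comp (measurable_borel_coord i) measurable_snd).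
Qed.

Section finite.
Variable m : {finite_measure set (borel_rV R d) -> \bar R}.
Local Open Scope ereal_scope.

(** The periodization is the convolution of [m] with the Dirac comb, the image of the product
    measure under addition; Fubini and Tonelli then compute its integrals. *)
Lemma periodization_product (A : set (borel_rV R d)) : measurable A ->
  periodization m A = (m \x dirac_comb R d) (add @^-1` A).
Proof.
move=> mA.
have mB : measurable (add @^-1` A).
  by rewrite -[X in measurable X]setTI; exact: measurable_add_rV.
rewrite (@product_measure_unique _ _ _ _ _ m (dirac_comb R d)
  (m \x^ dirac_comb R d))//; last first.
  by move=> B D mB' mD; exact: product_measure2E.
rewrite periodizationE /esum_measure /product_measure2/=.
apply/esym; apply: etrans (@ge0_integral_dirac_comb R d
  (fun y => m (ysection (add @^-1` A) y)) _ _) _ => //.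
  exact: measurable_fun_ysection.
apply: eq_esum => k _; rewrite /= /translate /pushforward; congr (m _).
by apply/seteqP; split => x; rewrite /ysection/= inE.
Qed.

Lemma ge0_integral_periodization (f : borel_rV R d -> \bar R) :
  measurable_fun setT f -> (forall x, 0 <= f x) ->
  \int[periodization m]_x f x =
  \int[m]_s \int[dirac_comb R d]_x f ((s : 'rV[R]_d) + (x : 'rV[R]_d))%R.
Proof.
move=> mf f0.
have mfa : measurable_fun setT (f \o add).
  by apply: measurableT_comp => //; exact: measurable_add_rV.
have := @fubini_tonelli1 _ _ _ _ _ m (dirac_comb R d) (f \o add) mfa
  (fun xy => f0 (add xy)).
rewrite [in X in _ = X]/= => <-.
have := @ge0_integral_pushforward _ _ _ _ R add measurable_add_rV
  (m \x dirac_comb R d) setT f measurableT mf.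
rewrite preimage_setT => <-; last by move=> y _; exact: f0.
apply: eq_measure_integral; first exact: measurable_add_rV.
by move=> ? A mA _; exact: periodization_product.
Qed.

Lemma integrable_periodization (f : borel_rV R d -> \bar R) :
  (periodization m).-integrable setT f ->
  (m \x dirac_comb R d).-integrable setT (f \o add).
Proof.
move=> /integrableP[mf foo].
have mfa : measurable_fun setT (f \o add).
  by apply: measurableT_comp => //; exact: measurable_add_rV.
apply/integrable12ltyP => //.
apply: le_lt_trans foo.
have mabs : measurable_fun setT (abse \o f) by exact: measurableT_comp.
have abs0 x : 0 <= (abse \o f) x by exact: abse_ge0.
have := ge0_integral_periodization mabs abs0.
by rewrite le_eqVlt => E; apply/orP; left; apply/eqP/esym; exact: E.
Qed.

Lemma integral_periodization (f : borel_rV R d -> \bar R) :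
  (periodization m).-integrable setT f ->
  \int[periodization m]_x f x =
  \int[m]_s \int[dirac_comb R d]_x f ((s : 'rV[R]_d) + (x : 'rV[R]_d))%R.
Proof.
move=> intf; have intfa := integrable_periodization intf.
have mf := measurable_int _ intf.
rewrite (@integral12_prod_meas1 _ _ _ _ _ m (dirac_comb R d) (f \o add) intfa).
have := @integral_pushforward _ _ _ _ R add measurable_add_rV
  (m \x dirac_comb R d) setT f mf.
rewrite preimage_setT => /(_ intfa measurableT) <-.
apply: eq_measure_integral; first exact: measurable_add_rV.
by move=> ? A mA _; exact: periodization_product.
Qed.

(** On the cube carrying [m] the translates of [weight] are uniformly comparable with it. This
    serves the spectral measure and, through [cell_measure], Lebesgue measure. *)
Lemma weight_periodization :
  m (~` [set x : 'rV[R]_d | forall i, (`|x ord0 i| <= 1)%R]) = 0 ->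
  \int[periodization m]_x (weight x)%:E < +oo.
Proof.
move=> m0.
have mw : measurable_fun [set: borel_rV R d] (fun x : borel_rV R d => (weight x)%:E).
  by apply/measurable_EFinP; exact: measurable_weight.
have w0 (x : borel_rV R d) : 0 <= (weight x)%:E by rewrite lee_fin ltW ?weight_gt0.
rewrite ge0_integral_periodization//.
apply: (@le_lt_trans _ _ (\int[m]_s ((3 ^+ d)%:E * \int[dirac_comb R d]_x (weight x)%:E))).
  apply: ae_ge0_le_integral => //.
  - by move=> s _; apply: integral_ge0.
  - have mwa : measurable_fun setT ((fun x : borel_rV R d => (weight x)%:E) \o add).
      by apply: measurableT_comp => //; exact: measurable_add_rV.
    exact: (@measurable_fun_fubini_tonelli_F _ _ _ _ R (dirac_comb R d) _ mwa (fun p => w0 (add p))).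
  - by move=> s _; rewrite mule_ge0 ?lee_fin ?exprn_ge0//; exact: integral_ge0.
  exists (~` [set x : 'rV[R]_d | forall i, (`|x ord0 i| <= 1)%R]); split => //.
    apply: measurableC.
    rewrite (_ : mkset _ = \bigcap_(i in [set: 'I_d])
        ((fun x : borel_rV R d => x ord0 i) @^-1` `[(-1)%R, 1%R]%classic)).
      apply: fin_bigcap_measurable => // i _.
      rewrite -[X in measurable X]setTI.
      exact: (measurable_borel_coord i measurableT (measurable_itv _)).
    apply/seteqP; split => x h i.
      by move=> _; rewrite /preimage/= in_itv/= -ler_norml; exact: h.
    by have := h i I; rewrite /preimage/= in_itv/= -ler_norml.
  apply: subsetC => s s1 _.
  rewrite -ge0_integralZl// ?lee_fin ?exprn_ge0//.
  apply: ge0_le_integral => //.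
  - have h : measurable_fun [set: borel_rV R d]
        (fun x : borel_rV R d => weight ((x : 'rV[R]_d) + s)%R).
      exact: measurableT_comp (@measurable_weight R d) (measurable_rV_translation s).
    by under eq_fun do rewrite addrC; exact/measurable_EFinP.
  - exact: emeasurable_funM.
  - by move=> x _; rewrite -EFinM lee_fin addrC; exact: weight_shift.
rewrite integral_cst// lte_mul_pinfty//.
- by rewrite mule_ge0 ?lee_fin ?exprn_ge0//; exact: integral_ge0.
- rewrite fin_numM//; rewrite ge0_fin_numE; [exact: dirac_comb_weight|exact: integral_ge0].
- exact: fin_num_fun_lty.
Qed.

End finite.
End periodization_integral.

Section cell.
Context (R : realType) (d : nat).

(* Centred at 0, so that 0 is an interior point in the uniqueness argument. *)
Definition cell : set (borel_rV R d) := rbox (fun=> - 2^-1) 1.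

Lemma measurable_cell : measurable cell.
Proof. exact: measurable_rbox. Qed.

Lemma lebesgue_cell_lty : (lebesgue_rV d cell < +oo)%E.
Proof. by rewrite lebesgue_rbox// ltry. Qed.

Definition cell_measure : {finite_measure set (borel_rV R d) -> \bar R} :=
  mfrestr measurable_cell lebesgue_cell_lty.

Lemma cell_measureE A : cell_measure A = lebesgue_rV d (A `&` cell).
Proof. by []. Qed.

Lemma cell_norm (x : 'rV[R]_d) : cell x -> forall i, `|x ord0 i| <= 1.
Proof. by move=> xC i; have /andP[h1 h2] := xC i; rewrite ler_norml; apply/andP; split; lra. Qed.

Lemma cell_unique (x : 'rV[R]_d) : exists k : 'rV[int]_d, forall j : 'rV[int]_d,
  cell (x + lattice_pt j) <-> j = k.
Proof.
pose k : 'rV[int]_d := \row_i - Num.floor (x ord0 i + 2^-1).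
exists k => j; split => [xj|->].
  apply/rowP => i; have /andP[] := xj i; rewrite !mxE => h1 h2.
  rewrite (@floor_def _ _ (- j ord0 i)) ?opprK// intrD mulrNz; apply/andP; split; lra.
move=> i; rewrite !mxE mulrNz.
have /andP[] := real_floor_itv (num_real (x ord0 i + 2^-1)).
by rewrite intrD => h1 h2; apply/andP; split; lra.
Qed.

(** The lattice translates of the cell tile space, and translation invariance carries each piece of
    [A] back into the cell. *)
Lemma lebesgue_periodization (A : set (borel_rV R d)) : measurable A ->
  lebesgue_rV d A = periodization cell_measure A.
Proof.
move=> mA; rewrite periodizationE /esum_measure.
pose F (k : 'rV[int]_d) : set (borel_rV R d) :=
  A `&` [set x : 'rV[R]_d | cell (x + lattice_pt (- k))].
have mF k : measurable (F k).
  apply: measurableI => //.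
  rewrite -[X in measurable X]setTI.
  by apply: (measurable_rV_translation (lattice_pt (- k)) measurableT) => //;
    exact: measurable_cell.
transitivity (\esum_(k in [set: 'rV[int]_d]) lebesgue_rV d (F k)); last first.
  apply: eq_esum => k _.
  transitivity (lebesgue_rV d ((translation k @^-1` A) `&` cell)) => //.
  rewrite -(lebesgue_rV_translation (lattice_pt k)) ?mF//; congr (lebesgue_rV d _).
  apply/seteqP; split => x; rewrite /F /preimage/= /translation.
    rewrite /lattice_pt map_mxN addrK => -[]//.
  by rewrite /lattice_pt map_mxN addrK => -[].
rewrite esum_pickle; last by move=> k; exact: measure_ge0.
pose G n : set (borel_rV R d) := oapp F set0 (@pickle_inv 'rV[int]_d n).
have -> : A = \bigcup_n G n.
  apply/seteqP; split => [x Ax|x [n _]]; last first.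
    by rewrite /G; case: (pickle_inv n) => //= k [].
  have [k hk] := cell_unique x.
  exists (pickle (- k)) => //; rewrite /G pickleK_inv/=; split => //=.
  by rewrite opprK; apply/hk.
rewrite measure_bigcup; last 2 first.
- by move=> n _; rewrite /G; case: (pickle_inv n) => [k|] /=.
- move=> n n' _ _ [x []]; rewrite /G.
  case E: (pickle_inv n) => [k|//]; case E': (pickle_inv n') => [k'|//] /=.
  move=> [_ /= h] [_ /= h']; have [j hj] := cell_unique x.
  have kk' : k = k' by apply: oppr_inj; exact: etrans ((hj _).1 h) (esym ((hj _).1 h')).
  have := @pickle_invK 'rV[int]_d n; have := @pickle_invK 'rV[int]_d n'.
  by rewrite E E' /= kk' => <- <-.
rewrite (@eq_eseriesl _ _ xpredT); last by move=> n; rewrite in_setT.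
by apply: eq_eseriesr => n _; rewrite /G; case: (pickle_inv n) => //=; rewrite measure0.
Qed.

Lemma lebesgue_weight : (\int[lebesgue_rV d]_x (@weight R d x)%:E < +oo)%E.
Proof.
rewrite (eq_measure_integral (periodization cell_measure)); last first.
  by move=> A mA _; exact: lebesgue_periodization.
apply: weight_periodization; rewrite cell_measureE.
rewrite (_ : _ `&` _ = set0) ?measure0//.
by apply/seteqP; split => // x [/= h xC]; apply: h => i; exact: cell_norm.
Qed.

End cell.

(** * Rapidly decreasing functions and tempered measures *)

Section schwartz_bounds.
Context (R : realType) (d : nat).

Let B : R := #|{set 'I_d}|%:R.

(** The inverse of [weight x] expands into [B = 2 ^ d] monomials, one for each set of coordinates,
    with exponents 0 or 2. *)
Lemma weight_bound_of_monomials (g : 'rV[R]_d -> R) (M : R) x :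
  (forall a : 'I_d -> nat, (forall i, a i <= 2)%N -> `|monomial a x * g x| <= M) ->
  `|g x| <= B * M * weight x.
Proof.
move=> h.
have W : weight x * \prod_i (1 + x ord0 i ^+ 2) = 1.
  rewrite /weight -big_split/= big1// => i _; rewrite mulVf// gt_eqF//.
  by rewrite ltr_wpDr// sqr_ge0.
rewrite [leLHS](_ : _ = weight x * (\prod_i (1 + x ord0 i ^+ 2) * `|g x|)); last first.
  by rewrite mulrA W mul1r.
rewrite [leRHS]mulrC; apply: ler_wpM2l; first exact: ltW (weight_gt0 _).
under eq_bigr do rewrite addrC; rewrite bigA_distr mulr_suml.
apply: (@le_trans _ _ (\sum_(J : {set 'I_d}) M)); last first.
  by rewrite sumr_const -[leLHS]mulr_natl.
apply: ler_sum => J _.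
have := h (fun i => if i \in J then 2 else 0)%N.
rewrite normrM => /(_ _)/(le_trans _); apply; last by move=> i; case: ifP.
rewrite ler_wpM2r// /monomial normr_prod; apply: ler_prod => i _.
case: ifP => _; rewrite ?sqr_ge0 ?expr0 ?normr1 ?ler01 ?lexx//=.
by rewrite normrX real_normK ?num_real.
Qed.

Lemma Re_mul_real (a : R) (z : R[i]) : complex.Re (a%:C%C * z) = a * complex.Re z /\
  complex.Im (a%:C%C * z) = a * complex.Im z.
Proof. by case: z => u v /=; rewrite !mul0r subr0 addr0. Qed.

Lemma Re_Im_le_norm (z : R[i]) (M : R) : `|z| <= M%:C%C ->
  `|complex.Re z| <= M /\ `|complex.Im z| <= M.
Proof.
rewrite normc_def lecR => zM; split; apply: le_trans zM;
  by rewrite -sqrtr_sqr ler_wsqrtr// ?lerDl ?lerDr sqr_ge0.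
Qed.

Lemma norm_le_Re_Im (z : R[i]) : `|z| <= (`|complex.Re z| + `|complex.Im z|)%:C%C.
Proof.
rewrite normc_def lecR -[leRHS]ger0_norm ?addr_ge0// -sqrtr_sqr ler_wsqrtr//.
by rewrite sqrrD !real_normK ?num_real// lerD2r lerDl mulrn_wge0// mulr_ge0.
Qed.

Lemma seminorm_Re_Im a s (f : 'rV[R]_d -> R[i]) M : seminorm_le a s f M ->
  forall x, `|monomial a x * pderive s (fun y => complex.Re (f y)) x| <= M /\
            `|monomial a x * pderive s (fun y => complex.Im (f y)) x| <= M.
Proof.
move=> h x; have [h1 h2] := Re_Im_le_norm (h x).
have [e1 e2] := Re_mul_real (monomial a x) (cpderive s f x).
by rewrite e1 in h1; rewrite e2 in h2.
Qed.

Definition rapid (g : 'rV[R]_d -> R) :=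
  smooth g /\ forall a s, exists M, forall x, `|monomial a x * pderive s g x| <= M.

Lemma schwartz_rapid f : schwartz f ->
  rapid (fun y => complex.Re (f y)) /\ rapid (fun y => complex.Im (f y)).
Proof.
move=> [[sR sI] h]; split; split => // a s; have [M hM] := h a s; exists M => x;
  by have [] := seminorm_Re_Im hM x.
Qed.

Lemma rapid_weight (g : 'rV[R]_d -> R) s : rapid g ->
  exists2 C, 0 <= C & forall x, `|pderive s g x| <= C * weight x.
Proof.
move=> [_ h].
(* Only the finitely many exponent vectors with entries in {0, 1, 2} matter, so their constants can
   be summed. *)
have /choice[M hM] (a : {ffun 'I_d -> 'I_3}) := h (fun i => a i) s.
have M0 a : 0 <= M a by exact: le_trans (normr_ge0 _) (hM a 0).
exists (B * \sum_a M a); first by rewrite mulr_ge0// sumr_ge0.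
move=> x; apply: weight_bound_of_monomials => a a2.
have -> : monomial a x = monomial (fun i => [ffun i => inord (a i)] i : 'I_3) x.
  by apply: eq_bigr => i _; rewrite ffunE inordK// ltnS.
by rewrite (le_trans (hM _ x))// (bigD1 [ffun i => inord (a i)])//= lerDl sumr_ge0.
Qed.

Lemma rapid_measurable g : rapid g ->
  measurable_fun [set: borel_rV R d] (g : borel_rV R d -> R).
Proof. by move=> [sg _]; apply: continuous_measurable_rV; have [] := sg [::]. Qed.

Section weighted_measure.
Variable m : {measure set (borel_rV R d) -> \bar R}.
Hypothesis mw : (\int[m]_x (weight x)%:E < +oo)%E.

Lemma integrable_weight : m.-integrable setT (EFin \o (@weight R d : borel_rV R d -> R)).
Proof.
apply/integrableP; split; first by apply/measurable_EFinP; exact: measurable_weight.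
rewrite (eq_integral (fun x : borel_rV R d => (weight x)%:E))// => x _.
by rewrite /= ger0_norm// ltW// weight_gt0.
Qed.

Lemma integrable_weight_bound (g : borel_rV R d -> R) C : measurable_fun setT g ->
  (forall x, `|g x| <= C * weight x) -> m.-integrable setT (EFin \o g).
Proof.
move=> mg gC.
have iC : m.-integrable setT (fun x => C%:E * (EFin \o (@weight R d : borel_rV R d -> R)) x)%E.
  by apply: integrableZl => //; exact: integrable_weight.
apply: le_integrable iC => //; first exact/measurable_EFinP.
move=> x _; rewrite /= lee_fin (le_trans (gC x))//.
by rewrite ler_norm.
Qed.

Lemma Rintegral_weight_bound (g : borel_rV R d -> R) C : measurable_fun setT g ->
  (forall x, `|g x| <= C * weight x) ->
  `|\int[m]_x g x| <= C * \int[m]_x weight x.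
Proof.
move=> mg gC; have ig := integrable_weight_bound mg gC.
rewrite (le_trans (le_normr_Rintegral _ _))// -RintegralZl//; last exact: integrable_weight.
apply: le_Rintegral => //.
- exact: integrable_norm.
- rewrite (_ : EFin \o _ = fun x => C%:E * (EFin \o (@weight R d : borel_rV R d -> R)) x)%E.
    by apply: integrableZl => //; exact: integrable_weight.
  by apply/funext => x /=; rewrite EFinM.
Qed.

Lemma rapid_integrable g : rapid g -> m.-integrable setT (EFin \o (g : borel_rV R d -> R)).
Proof.
move=> rg; have [C _ gC] := rapid_weight [::] rg.
exact: integrable_weight_bound (rapid_measurable rg) gC.
Qed.

Lemma weight_tempered : tempered m.
Proof.
split.
  move=> f /schwartz_rapid[rR rI].
  by split; exact: rapid_integrable.
(* Exponents at most 2 in each coordinate give total degree at most [2 * d], with no derivative. The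
   leading 2 accounts for real and imaginary parts. *)
exists (2 * d)%N, (2 * (B * \int[m]_x weight x)) => f M sf hM.
have [rR rI] := schwartz_rapid sf.
have fM a : (forall i, a i <= 2)%N -> seminorm_le a [::] f M.
  move=> a2; apply: hM => //; rewrite (leq_trans (leq_sum _ (fun i _ => a2 i)))//.
  by rewrite sum_nat_const card_ord mulnC.
have bR x : `|complex.Re (f x)| <= B * M * weight x.
  apply: (@weight_bound_of_monomials (fun y => complex.Re (f y))) => a a2.
  by have [] := seminorm_Re_Im (fM a a2) x.
have bI x : `|complex.Im (f x)| <= B * M * weight x.
  apply: (@weight_bound_of_monomials (fun y => complex.Im (f y))) => a a2.
  by have [] := seminorm_Re_Im (fM a a2) x.
have hR := Rintegral_weight_bound (rapid_measurable rR) bR.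
have hI := Rintegral_weight_bound (rapid_measurable rI) bI.
rewrite (le_trans (norm_le_Re_Im _))// lecR /= (le_trans (lerD hR hI))//.
by rewrite le_eqVlt; apply/orP; left; apply/eqP; ring.
Qed.

End weighted_measure.
End schwartz_bounds.

(** * Poisson summation *)

Section dotp_theory.
Context (R : realType) (d : nat).
Implicit Types (x y t u : 'rV[R]_d) (k : 'rV[int]_d).

Lemma dotpDr x t u : dotp x (t + u) = dotp x t + dotp x u.
Proof. by rewrite /dotp -big_split/=; apply: eq_bigr => i _; rewrite mxE mulrDr. Qed.

Lemma dotpDl x y t : dotp (x + y) t = dotp x t + dotp y t.
Proof. by rewrite /dotp -big_split/=; apply: eq_bigr => i _; rewrite mxE mulrDl. Qed.

Lemma dotpNl x t : dotp (- x) t = - dotp x t.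
Proof. by rewrite /dotp -sumrN; apply: eq_bigr => i _; rewrite mxE mulNr. Qed.

Lemma dotpZ_delta x (a : R) i : dotp x (a *: delta_mx ord0 i) = a * x ord0 i.
Proof.
rewrite /dotp (bigD1 i)//= big1 => [|j ji]; last first.
  by rewrite !mxE (negbTE ji) andbF mulr0 mulr0.
by rewrite !mxE !eqxx mulr1 addr0 mulrC.
Qed.

Lemma dotp_lattice k l : exists z : int, dotp (lattice_pt k) (lattice_pt l) = z%:~R :> R.
Proof.
exists (\sum_i k ord0 i * l ord0 i).
by rewrite /dotp rmorph_sum/=; apply: eq_bigr => i _; rewrite !mxE rmorphM.
Qed.

Lemma cos_period_int (a : R) (z : int) : cos (a + 2 * pi * z%:~R) = cos a.
Proof.
have h (n : nat) (b : R) : cos (b + 2 * pi * n%:R) = cos b.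
  elim: n b => [|n ih] b; first by rewrite mulr0 addr0.
  rewrite [n.+1%:R]mulrSr mulrDr mulr1 addrA [X in _ + X]mulr_natl mulr2n.
  by rewrite addrA !cosDpi opprK ih.
case: z => n; first exact: h.
by rewrite NegzE mulrNz mulrN -[LHS](h n.+1) subrK.
Qed.

Lemma measurable_dotp2 :
  measurable_fun setT (fun p : borel_rV R d * borel_rV R d => dotp p.1 p.2).
Proof.
apply: measurable_sum => i; apply: measurable_funM.
  exact: (measurableT_comp (measurable_borel_coord i) measurable_fst).
exact: (measurableT_comp (measurable_borel_coord i) measurable_snd).
Qed.

Lemma measurable_dotp x : measurable_fun setT (fun t : borel_rV R d => dotp x t).
Proof.
by apply: measurable_sum => i; apply: measurable_funM => //; exact: measurable_borel_coord.
Qed.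

(* The phase makes cos (th = 0) and - sin (th = pi / 2) instances of one function. *)
Definition wave x (th : R) t : R := cos (2 * pi * dotp x t + th).

Lemma wave_le1 x th t : `|wave x th t| <= 1.
Proof. by rewrite ler_norml cos_geN1 cos_le1. Qed.

Lemma measurable_cos (dT : measure_display) (T : measurableType dT) (f : T -> R) :
  measurable_fun setT f -> measurable_fun setT (fun z => cos (f z)).
Proof.
move=> mf; apply: measurableT_comp => //.
by apply: continuous_measurable_fun; exact: continuous_cos.
Qed.

Lemma measurable_wave x th : measurable_fun [set: borel_rV R d] (wave x th : borel_rV R d -> R).
Proof.
apply: measurable_cos; apply: measurable_funD => //.
by apply: measurable_funM => //; exact: measurable_dotp.
Qed.

Lemma wave_lattice k th t l : wave (lattice_pt k) th (t + lattice_pt l) = wave (lattice_pt k) th t.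
Proof.
have [z kl] := dotp_lattice k l.
by rewrite /wave dotpDr kl mulrDr addrAC cos_period_int.
Qed.

End dotp_theory.

(** * Orthogonality of waves on the unit cell *)

Section orthogonality.
Context (R : realType) (d : nat).

Lemma ge0_lebesgue_translation (h : 'rV[R]_d) (f : borel_rV R d -> \bar R) :
  measurable_fun setT f -> (forall x, 0 <= f x)%E ->
  (\int[lebesgue_rV d]_t f ((t : 'rV[R]_d) + h)%R = \int[lebesgue_rV d]_t f t)%E.
Proof.
move=> mf f0.
have := @ge0_integral_pushforward _ _ _ _ R _ (measurable_rV_translation h)
  (lebesgue_rV d) setT f measurableT mf (fun x _ => f0 x).
rewrite preimage_setT => E; rewrite -[LHS]E.
apply: eq_measure_integral; first exact: measurable_rV_translation.
by move=> ? A mA _; exact: lebesgue_rV_translation.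
Qed.

Lemma Rintegral_lebesgue_translation (h : 'rV[R]_d) (f : borel_rV R d -> R) :
  (lebesgue_rV d).-integrable setT (EFin \o f) ->
  (lebesgue_rV d).-integrable setT (EFin \o (fun t : 'rV[R]_d => f (t + h))) /\
  \int[lebesgue_rV d]_t f ((t : 'rV[R]_d) + h) = \int[lebesgue_rV d]_t f t.
Proof.
move=> intf; have mf := measurable_int _ intf.
have /integrableP[_ foo] := intf.
have mfh : measurable_fun setT (EFin \o (fun t : 'rV[R]_d => f (t + h)) : borel_rV R d -> \bar R).
  exact: (measurableT_comp mf (measurable_rV_translation h)).
have intfh : (lebesgue_rV d).-integrable setT (EFin \o (fun t : 'rV[R]_d => f (t + h))).
  apply/integrableP; split => //; apply: le_lt_trans foo.
  have mabs : measurable_fun setT (fun x => `|(EFin \o f) x|)%E by exact: measurableT_comp.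
  rewrite le_eqVlt; apply/orP; left; apply/eqP.
  exact: (ge0_lebesgue_translation h mabs (fun x => abse_ge0 _)).
split => //; rewrite /Rintegral; congr fine.
have := @integral_pushforward _ _ _ _ R _ (measurable_rV_translation h)
  (lebesgue_rV d) setT (EFin \o f) mf.
rewrite preimage_setT => /(_ intfh measurableT) E; rewrite -[LHS]E.
apply: eq_measure_integral; first exact: measurable_rV_translation.
by move=> ? A mA _; exact: lebesgue_rV_translation.
Qed.

Lemma measurable_indic_translation (A : set (borel_rV R d)) (b : 'rV[R]_d) : measurable A ->
  measurable_fun [set: borel_rV R d]
    (fun t : borel_rV R d => (\1_A ((t : 'rV[R]_d) + b)%R)%:E : \bar R).
Proof.
move=> mA; apply/measurable_EFinP.
have mi : measurable_fun setT (\1_A : borel_rV R d -> R) by exact: measurable_indic.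
exact: (measurableT_comp mi (measurable_rV_translation b)).
Qed.

(** Lebesgue measure is unfolded over the lattice: each orbit of lattice translations meets the
    translated cell exactly once, so for a periodic integrand exactly one term survives. *)
Let shifted_cell (a : 'rV[R]_d) (psi : borel_rV R d -> \bar R) :
  measurable_fun setT psi -> (forall x, 0 <= psi x)%E ->
  (forall x k, psi ((x : 'rV[R]_d) + lattice_pt k)%R = psi x) ->
  (\int[lebesgue_rV d]_t ((\1_(@cell R d) ((t : 'rV[R]_d) - a)%R)%:E * psi t) =
   \int[cell_measure R d]_t psi t)%E.
Proof.
move=> mpsi psi0 per.
have mF : measurable_fun [set: borel_rV R d]
    (fun t : borel_rV R d => (\1_(@cell R d) ((t : 'rV[R]_d) - a)%R)%:E * psi t)%E.
  by apply: emeasurable_funM => //; apply: measurable_indic_translation; exact: measurable_cell.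
rewrite (eq_measure_integral (periodization (cell_measure R d))); last first.
  by move=> A mA _; exact: lebesgue_periodization.
rewrite ge0_integral_periodization; last 2 first.
- exact: mF.
- by move=> x; rewrite mule_ge0.
apply: eq_integral => s _.
rewrite [LHS]ge0_integral_dirac_comb; last 2 first.
- have mT := measurable_rV_translation (s : 'rV[R]_d).
  have := measurableT_comp mF mT; apply: eq_measurable_fun => x _ /=.
  by rewrite [(x : 'rV[R]_d) + s]addrC.
- by move=> x; rewrite mule_ge0.
have [k hk] := cell_unique ((s : 'rV[R]_d) - a).
transitivity (\esum_(l in [set: 'rV[int]_d]) if l \in [set k] then psi s else 0)%E.
  apply: eq_esum => l _; rewrite per indicE.
  rewrite (_ : (_ \in @cell R d) = (l \in [set k])).
    by case: ifP => _; rewrite ?mul1e ?mul0e.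
  by apply/idP/idP; rewrite !inE addrAC => /hk.
by rewrite -esum_mkcond esum_set1.
Qed.

Lemma ge0_cell_shift (h : 'rV[R]_d) (phi : borel_rV R d -> \bar R) :
  measurable_fun setT phi -> (forall x, 0 <= phi x)%E ->
  (forall x k, phi ((x : 'rV[R]_d) + lattice_pt k)%R = phi x) ->
  (\int[cell_measure R d]_t phi ((t : 'rV[R]_d) + h)%R = \int[cell_measure R d]_t phi t)%E.
Proof.
move=> mphi phi0 per.
have mh := measurable_rV_translation h.
rewrite -[RHS](shifted_cell h mphi phi0 per).
have mphih : measurable_fun setT (fun t : borel_rV R d => phi ((t : 'rV[R]_d) + h)).
  exact: measurableT_comp mphi mh.
rewrite -(shifted_cell 0 mphih) => [|x //|x k]; last by rewrite addrAC per.
rewrite -[RHS](ge0_lebesgue_translation h).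
- by apply: eq_integral => t _; rewrite subr0 addrK.
- by apply: emeasurable_funM => //; apply: measurable_indic_translation; exact: measurable_cell.
- by move=> x; rewrite mule_ge0.
Qed.

Lemma cell_measureT : cell_measure R d setT = 1%E.
Proof. by rewrite cell_measureE setTI lebesgue_rbox// expr1n. Qed.

Lemma integrable_wave (x : 'rV[R]_d) th :
  (cell_measure R d).-integrable setT (EFin \o (wave x th : borel_rV R d -> R)).
Proof. exact: (@bounded_integrable _ _ _ (cell_measure R d) _ 1 (measurable_wave x th) (wave_le1 x th)). Qed.

(** If [k] is nonzero, a shift by half a period along some coordinate negates the wave while
    preserving its integral over the cell. *)
Lemma cell_wave (k : 'rV[int]_d) (th : R) :
  \int[cell_measure R d]_t wave (lattice_pt k) th t = (k == 0)%:R * cos th.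
Proof.
have [->|k0] := eqVneq k 0.
  rewrite mul1r (@eq_Rintegral _ _ _ (cell_measure R d) _ (fun=> cos th)) => [|t _].
    rewrite Rintegral_cst// -[RHS]mulr1; congr (_ * _).
    exact: (congr1 fine cell_measureT).
  rewrite /wave (_ : dotp _ _ = 0) ?mulr0 ?add0r//.
  by rewrite /dotp big1// => i _; rewrite !mxE mul0r.
rewrite mul0r.
have [i ki] : exists i, k ord0 i != 0.
  apply/existsP; apply: contraNT k0 => /existsPn h; apply/eqP/rowP => i.
  by have := h i; rewrite mxE negbK => /eqP.
have ki0 : (k ord0 i)%:~R != 0 :> R by rewrite intr_eq0.
pose h : 'rV[R]_d := (2 * (k ord0 i)%:~R)^-1 *: delta_mx ord0 i.
have kh t : wave (lattice_pt k) th (t + h) = - wave (lattice_pt k) th t.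
  rewrite /wave dotpDr dotpZ_delta mxE.
  rewrite (_ : 2 * pi * _ + th = 2 * pi * dotp (lattice_pt k) t + th + pi) ?cosDpi//.
  by field.
pose I := \int[cell_measure R d]_t wave (lattice_pt k) th t.
(* Adding 1 makes the integrand nonnegative, as [ge0_cell_shift] requires. *)
have E : \int[cell_measure R d]_t (1 + wave (lattice_pt k) th ((t : 'rV[R]_d) + h)) =
    \int[cell_measure R d]_t (1 + wave (lattice_pt k) th t).
  rewrite /Rintegral; congr fine.
  apply: (@ge0_cell_shift h (fun t => (1 + wave (lattice_pt k) th t)%:E)).
  - by apply/measurable_EFinP; apply: measurable_funD => //; exact: measurable_wave.
  - by move=> t; rewrite lee_fin -lerBlDl sub0r; have := wave_le1 (lattice_pt k) th t;
      rewrite ler_norml => /andP[].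
  - by move=> t l; rewrite wave_lattice.
have i1 : (cell_measure R d).-integrable setT (EFin \o (cst 1 : borel_rV R d -> R)).
  exact: finite_measure_integrable_cst.
have iw := integrable_wave (lattice_pt k) th.
move: E; under eq_Rintegral do rewrite kh.
by rewrite RintegralB// RintegralD// -/I => /addrI; lra.
Qed.

End orthogonality.

(** * Second differences and decay of Fourier integrals *)

Section second_differences.
Context (R : realType) (d : nat).
Implicit Types (g : 'rV[R]_d -> R) (x a v : 'rV[R]_d) (i : 'I_d) (h : 'I_d -> R).

Let e i : 'rV[R]_d := delta_mx ord0 i.

Definition diff2 i (r : R) g x : R := g x - 2 * g (x + r *: e i) + g (x + (2 * r) *: e i).

Fixpoint diffs2 (s : seq 'I_d) h g : 'rV[R]_d -> R :=
  if s is i :: s' then diff2 i (h i) (diffs2 s' h g) else g.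

(** The head goes last because [diffs2_bound] moves the second derivative in [i] inside, onto [g],
    before treating the other coordinates. *)
Fixpoint double_seq (s : seq 'I_d) : seq 'I_d :=
  if s is i :: s' then double_seq s' ++ [:: i; i] else [::].

Lemma diff2_shift i r g a : diff2 i r (fun x => g (x + a)) = fun x => diff2 i r g (x + a).
Proof. by apply/funext => x; rewrite /diff2 ![x + a + _]addrAC. Qed.

Lemma diffs2_shift s h g a : diffs2 s h (fun x => g (x + a)) = fun x => diffs2 s h g (x + a).
Proof. by elim: s => [//|i s ih]/=; rewrite ih diff2_shift. Qed.

Lemma pderive_cat s s' g : pderive (s ++ s') g = pderive s (pderive s' g).
Proof. by elim: s => [//|i s ih]/=; rewrite ih. Qed.

Lemma smooth_pderive s g : smooth g -> smooth (pderive s g).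
Proof. by move=> sg s'; rewrite -pderive_cat; exact: sg. Qed.

Lemma is_derive_shift g x v a (df : R) : is_derive (x + a) v g df ->
  is_derive x v (fun y => g (y + a)) df.
Proof.
have E : (fun r : R => r^-1 *: ((fun y => g (y + a)) (r *: v + x) - g (x + a))) =
    (fun r : R => r^-1 *: (g (r *: v + (x + a)) - g (x + a))).
  by apply/funext => r; rewrite addrA.
move=> [dg <-]; split; first by rewrite /derivable E.
by rewrite /derive E.
Qed.

Lemma is_derive_diff2 i r g x v : (forall y, derivable g y v) ->
  is_derive x v (diff2 i r g) (diff2 i r (fun y => 'D_v g y) x).
Proof.
move=> dg.
have d0 y : is_derive y v g ('D_v g y) by exact: derivableP.
have d1 a := is_derive_shift (d0 (x + a)).
have := is_deriveD (is_deriveB (d0 x) (is_deriveZ 2 (d1 (r *: e i)))) (d1 ((2 * r) *: e i)).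
by [].
Qed.

Lemma pderive_diff2 i r g s : smooth g ->
  pderive s (diff2 i r g) = diff2 i r (pderive s g).
Proof.
move=> sg; elim: s => [//|j s ih]/=; apply/funext => x; rewrite ih.
have [_ dg] := sg s.
by have [_ ->] := @is_derive_diff2 i r _ x (delta_mx ord0 j) (dg j).
Qed.

Lemma continuous_rV_shift g a : continuous g -> continuous (fun x => g (x + a)).
Proof.
move=> cg x; have ca : (fun y : 'rV[R]_d => y + a) @ x --> x + a.
  exact: (cvgD (@cvg_id _ (nbhs x)) (cvg_cst a)).
exact: (cvg_comp _ _ ca (cg (x + a))).
Qed.

Lemma smooth_diff2 i r g : smooth g -> smooth (diff2 i r g).
Proof.
move=> sg s; rewrite pderive_diff2//; have [cg dg] := sg s; split; last first.
  by move=> j x; have [] := @is_derive_diff2 i r _ x (delta_mx ord0 j) (dg j).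
have cs a : continuous (fun x => pderive s g (x + a)) by exact: continuous_rV_shift.
move=> x; have nx : Filter (nbhs (x : 'rV[R]_d)) by exact: nbhs_filter.
have c1 := cvgM (cvg_cst (2 : R)) (cs (r *: e i) x).
have c2 := cvgB (cg x) (c1 nx nx).
exact: (cvgD (c2 nx) (cs ((2 * r) *: e i) x)).
Qed.

Lemma smooth_diffs2 s h g : smooth g -> smooth (diffs2 s h g).
Proof. by move=> sg; elim: s => [//|i s ih]/=; exact: smooth_diff2. Qed.

Lemma pderive_diffs2 s' s h g : smooth g ->
  pderive s' (diffs2 s h g) = diffs2 s h (pderive s' g).
Proof.
move=> sg; elim: s => [//|i s ih]/=.
by rewrite pderive_diff2 ?ih//; exact: smooth_diffs2.
Qed.

Lemma is_derive_line g x v (t : R) : derivable g (x + t *: v) v ->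
  is_derive t 1 (fun u : R => g (x + u *: v)) ('D_v g (x + t *: v)).
Proof.
have E : (fun r : R => r^-1 *: (g (x + (r *: (1 : R) + t) *: v) - g (x + t *: v))) =
    (fun r : R => r^-1 *: (g (r *: v + (x + t *: v)) - g (x + t *: v))).
  by apply/funext => r; rewrite [r *: (1:R)]mulr1 scalerDl addrCA.
move=> dg; split; first by rewrite /derivable E.
by rewrite /derive E.
Qed.

(** The mean value theorem twice: for the first difference [psi] between 0 and [r], then for the
    derivative [f1] between [xi] and [xi + r]. *)
Lemma diff2_mean_value i (r : R) g x : 0 < r -> smooth g ->
  exists2 c, 0 <= c <= 2 * r & diff2 i r g x = r ^+ 2 * pderive [:: i; i] g (x + c *: e i).
Proof.
move=> r0 sg.
pose f (u : R) := g (x + u *: e i).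
pose f1 (u : R) := pderive [:: i] g (x + u *: e i).
pose f2 (u : R) := pderive [:: i; i] g (x + u *: e i).
have df (u : R) : is_derive u 1 f (f1 u) by apply: is_derive_line; exact: (sg [::]).2.
have df1 (u : R) : is_derive u 1 f1 (f2 u) by apply: is_derive_line; exact: (sg [:: i]).2.
pose psi (u : R) := f (u + r) - f u.
have dpsi (u : R) : is_derive u 1 psi (f1 (u + r) - f1 u).
  have d1 : is_derive u 1 (fun y => f (y + r)) (f1 (u + r)).
    have E : (fun q : R => q^-1 *: (f (q *: (1 : R) + u + r) - f (u + r))) =
        (fun q : R => q^-1 *: (f (q *: (1 : R) + (u + r)) - f (u + r))).
      by apply/funext => q; rewrite addrA.
    by have [h1 h2] := df (u + r); split; rewrite /derivable /derive ?E.
  exact: is_deriveB.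
have der_cont (F F' : R -> R) (a b : R) : (forall u : R, is_derive u 1 F (F' u)) ->
    {within `[a, b], continuous F}.
  move=> dF; apply: continuous_subspaceT => u; apply: differentiable_continuous.
  by apply/derivable1_diffP; have [] := dF u.
have [xi] := MVT r0 (fun u _ => dpsi u) (der_cont _ _ _ _ dpsi).
rewrite in_itv/= => /andP[xi0 xir] E1.
have xixi : xi < xi + r by rewrite ltrDl.
have [c] := MVT xixi (fun u _ => df1 u) (der_cont _ _ _ _ df1).
rewrite in_itv/= => /andP[c0 cr] E2.
exists c; first by apply/andP; split; lra.
transitivity (psi r - psi 0).
  rewrite /psi /f /diff2 scale0r addr0 add0r (_ : 2 * r = r + r); last by lra.
  by lra.
rewrite E1 E2 subr0 (_ : xi + r - xi = r) ?expr2; last by ring.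
by rewrite -[RHS]/(r * r * f2 c); move: (f2 c) => z; ring.
Qed.

(** Each application of [diff2_mean_value] moves the base point by [c] along a new coordinate, with
    [0 <= c <= 2 * h i <= 1]. Requiring [u] to vanish off [s] keeps the moves from accumulating in
    one coordinate. *)
Lemma diffs2_bound s h g x (M : R) : uniq s -> smooth g ->
  (forall i, i \in s -> 0 < h i <= 2^-1) ->
  (forall u : 'rV[R]_d, (forall i, `|u ord0 i| <= 1) ->
     (forall i, i \notin s -> u ord0 i = 0) ->
     `|pderive (double_seq s) g (x + u)| <= M) ->
  `|diffs2 s h g x| <= \prod_(i <- s) h i ^+ 2 * M.
Proof.
elim: s g x => [|i s ih] g x /=.
  move=> _ _ _ /(_ 0); rewrite addr0 big_nil mul1r; apply => j *; rewrite mxE ?normr0//.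
move=> /andP[si us] sg hh hM.
have /andP[hi0 hi1] := hh i (mem_head _ _).
have [c /andP[c0 cr] ->] := diff2_mean_value i x hi0 (smooth_diffs2 s h sg).
rewrite big_cons pderive_diffs2// normrM ger0_norm ?sqr_ge0// -mulrA ler_wpM2l ?sqr_ge0//.
apply: ih => //; first exact: smooth_pderive.
  by move=> j js; apply: hh; rewrite in_cons js orbT.
move=> u u1 us0; rewrite -pderive_cat -addrA; apply: hM => j.
  rewrite !mxE; have [->|ji] := eqVneq j i.
    by rewrite eqxx/= mulr1 us0// addr0 ger0_norm//; lra.
  by rewrite andbF mulr0 add0r.
rewrite in_cons negb_or => /andP[ji js]; rewrite !mxE us0//.
have -> : (j == i) = false by exact: negbTE.
by rewrite andbF mulr0 add0r.
Qed.

(* What the decay of Fourier integrals needs of a smooth function; unlike bounds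
   on derivatives, it is visibly preserved by translations. *)
Definition nice g := continuous g /\ exists2 C, 0 <= C &
  forall (A : {set 'I_d}) h, (forall i, i \in A -> 0 < h i <= 2^-1) ->
  forall x, `|diffs2 (enum A) h g x| <= C * \prod_(i in A) h i ^+ 2 * weight x.

Lemma rapid_nice g : rapid g -> nice g.
Proof.
move=> rg; have [sg _] := rg; split; first by have [] := sg [::].
have /choice[C hC] (A : {set 'I_d}) : exists C, 0 <= C /\ forall x,
    `|pderive (double_seq (enum A)) g x| <= C * weight x.
  by have [C C0 hC] := rapid_weight (double_seq (enum A)) rg; exists C.
have C0 A := (hC A).1.
exists (3 ^+ d * \sum_A C A); first by rewrite mulr_ge0 ?exprn_ge0// sumr_ge0.
move=> A h hA x; rewrite mulrAC [leRHS]mulrC.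
have -> : \prod_(i in A) h i ^+ 2 = \prod_(i <- enum A) h i ^+ 2 by rewrite big_enum.
apply: diffs2_bound => //; first exact: enum_uniq.
  by move=> i; rewrite mem_enum; exact: hA.
move=> u u1 _; rewrite (le_trans ((hC A).2 _))//.
rewrite (le_trans (ler_wpM2l (C0 A) (weight_shift x u1)))//.
rewrite mulrCA mulrA ler_wpM2r ?(ltW (weight_gt0 _))// ler_wpM2l ?exprn_ge0//.
by rewrite (bigD1 A)//= lerDl sumr_ge0.
Qed.

Lemma nice_weight g : nice g -> exists2 C, 0 <= C & forall x, `|g x| <= C * weight x.
Proof.
move=> [_ [C C0 hC]]; exists C => // x.
have := hC finset.set0 (fun=> 2^-1) => /(_ _ x).
by rewrite enum_set0 finset.big_set0 mulr1; apply => i; rewrite finset.in_set0.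
Qed.

Lemma nice_translation g a : (forall i, `|a ord0 i| <= 1) -> nice g ->
  nice (fun x => g (x + a)).
Proof.
move=> a1 [cg [C C0 hC]]; split; first exact: continuous_rV_shift.
exists (3 ^+ d * C); first by rewrite mulr_ge0 ?exprn_ge0.
move=> A h hA x; rewrite diffs2_shift (le_trans (hC A h hA _))//.
rewrite -!mulrA [leRHS]mulrCA ler_wpM2l// [leRHS]mulrCA ler_wpM2l ?weight_shift//.
by apply: prodr_ge0 => i _; exact: sqr_ge0.
Qed.

End second_differences.

Section wave_decay.
Context (R : realType) (d : nat).
Implicit Types (g : borel_rV R d -> R) (k : 'rV[int]_d) (th : R) (i : 'I_d).

Let leb := (@lebesgue_rV R d).

Definition wave_integral g (x : 'rV[R]_d) th : R := \int[leb]_t (g t * wave x th t).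

Lemma integrable_mul_wave (m : {measure set (borel_rV R d) -> \bar R}) g (x : 'rV[R]_d) th :
  m.-integrable setT (EFin \o g) ->
  m.-integrable setT (EFin \o (fun t => g t * wave x th t)).
Proof.
move=> ig; have mg := measurable_int _ ig.
apply: le_integrable ig => //.
  apply/measurable_EFinP; apply: measurable_funM; first exact/measurable_EFinP.
  exact: measurable_wave.
by move=> t _; rewrite /= lee_fin normrM ler_piMr ?wave_le1.
Qed.

Lemma integrable_diff2 i r g : leb.-integrable setT (EFin \o g) ->
  leb.-integrable setT (EFin \o (diff2 i r g : borel_rV R d -> R)).
Proof.
move=> ig.
have [i1 _] := Rintegral_lebesgue_translation (r *: delta_mx ord0 i) ig.
have [i2 _] := Rintegral_lebesgue_translation ((2 * r) *: delta_mx ord0 i) ig.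
have i1' := integrableZl (measurableT) 2 i1.
exact: (integrableD measurableT (integrableB measurableT ig i1') i2).
Qed.

Lemma wave_half_period k th i (t : 'rV[R]_d) : k ord0 i != 0 ->
  wave (lattice_pt k) th (t + (2 * `|(k ord0 i)%:~R|)^-1 *: delta_mx ord0 i) =
  - wave (lattice_pt k) th t.
Proof.
move=> ki; have ki0 : (k ord0 i)%:~R != 0 :> R by rewrite intr_eq0.
rewrite /wave dotpDr dotpZ_delta mxE.
set a := 2 * pi * dotp (lattice_pt k) t + th.
move: (k ord0 i)%:~R ki0 => z z0.
have [zp|zn] := ltrP 0 z.
  rewrite gtr0_norm// (_ : 2 * pi * _ + th = a + pi) ?cosDpi//.
  by rewrite /a; field; rewrite gt_eqF.
rewrite ler0_norm// -[LHS]opprK -cosDpi; congr (- cos _).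
by rewrite /a; field.
Qed.

(** A half-period translation changes the sign of the wave, so the coefficients 1, -2, 1 of the
    second difference contribute 1, 2, 1. *)
Lemma wave_integral_diff2 k th i g : k ord0 i != 0 ->
  leb.-integrable setT (EFin \o g) ->
  wave_integral (diff2 i (2 * `|(k ord0 i)%:~R|)^-1 g) (lattice_pt k) th =
  4 * wave_integral g (lattice_pt k) th.
Proof.
move=> ki ig; rewrite /wave_integral.
set r := (2 * _)^-1; set w := wave _ th.
pose e : 'rV[R]_d := delta_mx ord0 i.
have w1 (t : 'rV[R]_d) : w (t + r *: e) = - w t by exact: wave_half_period.
have w2 (t : 'rV[R]_d) : w (t + (2 * r) *: e) = w t.
  by rewrite mulr_natl mulr2n scalerDl addrA !w1 opprK.
have iF := integrable_mul_wave (lattice_pt k) th ig.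
have [i1 e1] := Rintegral_lebesgue_translation (r *: e) iF.
have [i2 e2] := Rintegral_lebesgue_translation ((2 * r) *: e) iF.
pose F (t : borel_rV R d) := g t * w t.
rewrite (@eq_Rintegral _ _ _ leb _ (fun t : borel_rV R d => F t + 2 * F ((t : 'rV[R]_d) + r *: e)
  + F ((t : 'rV[R]_d) + (2 * r) *: e))); last first.
  by move=> t _; rewrite /F w1 w2 /diff2 -/e; ring.
rewrite RintegralD//; last first.
  exact: (integrableD measurableT iF (integrableZl measurableT 2 i1)).
rewrite RintegralD//; last exact: (integrableZl measurableT 2 i1).
rewrite RintegralZl// e1 e2 -/w; move: (\int[leb]_t _) => z; ring.
Qed.

Lemma wave_integral_diffs2 k th (s : seq 'I_d) g :
  {in s, forall i, k ord0 i != 0} -> leb.-integrable setT (EFin \o g) ->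
  leb.-integrable setT (EFin \o (diffs2 s (fun i => (2 * `|(k ord0 i)%:~R|)^-1) g
    : borel_rV R d -> R)) /\
  wave_integral (diffs2 s (fun i => (2 * `|(k ord0 i)%:~R|)^-1) g) (lattice_pt k) th =
  4 ^+ size s * wave_integral g (lattice_pt k) th.
Proof.
move=> + ig; elim: s => [|i s ih] sk; first by rewrite mul1r.
have [|is1 es] := ih; first by move=> j js; apply: sk; rewrite in_cons js orbT.
split; first exact: integrable_diff2.
by rewrite /= wave_integral_diff2 ?sk ?mem_head// es mulrA -exprS.
Qed.

Lemma nice_measurable g : nice g -> measurable_fun setT g.
Proof. by move=> [cg _]; exact: continuous_measurable_rV. Qed.

Lemma nice_integrable g : nice g -> leb.-integrable setT (EFin \o g).
Proof.
move=> ng; have [C _ hC] := nice_weight ng.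
exact: (integrable_weight_bound (@lebesgue_weight R d) (nice_measurable ng) hC).
Qed.

(** Differences are taken exactly in the coordinates where [k] is nonzero, with steps of half a
    period; these are at most 1/2 since [k] is integral. The factor 4 gained for each is divided
    out. *)
Lemma wave_integral_decay g : nice g -> exists2 C, 0 <= C &
  forall k th, `|wave_integral g (lattice_pt k) th| <= C * weight (lattice_pt k : 'rV[R]_d).
Proof.
move=> ng; have [_ [C C0 hC]] := ng; have ig := nice_integrable ng.
have W0 : 0 <= \int[leb]_x weight x.
  by apply: Rintegral_ge0 => x _; exact: ltW (weight_gt0 _).
exists (C * \int[leb]_x weight x); first by rewrite mulr_ge0.
move=> k th.
pose h i : R := (2 * `|(k ord0 i)%:~R|)^-1.
pose A : {set 'I_d} := [set i | k ord0 i != 0]%SET.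
have sk : {in enum A, forall i, k ord0 i != 0}.
  by move=> i; rewrite mem_enum finset.in_set.
have [is1 es] := wave_integral_diffs2 th sk ig.
have hA i : i \in A -> 0 < h i <= 2^-1.
  rewrite finset.in_set => ki; rewrite invr_gt0 pmulr_rgt0// normr_gt0 intr_eq0 ki/=.
  rewrite lef_pV2 ?posrE ?pmulr_rgt0 ?normr_gt0 ?intr_eq0//.
  by rewrite ler_peMr// -intr_norm ler1z -gtz0_ge1 normr_gt0.
have mD : measurable_fun setT
    (fun t : borel_rV R d => diffs2 (enum A) h g t * wave (lattice_pt k) th t).
  apply/measurable_EFinP; exact: (measurable_int _ (integrable_mul_wave _ _ is1)).
have bD (t : borel_rV R d) : `|diffs2 (enum A) h g t * wave (lattice_pt k) th t| <=
    C * \prod_(i in A) h i ^+ 2 * weight t.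
  by rewrite normrM (le_trans _ (hC A h hA t))// ler_piMr ?wave_le1.
have := Rintegral_weight_bound (@lebesgue_weight R d) mD bD.
rewrite -/(wave_integral _ _ _) es normrM normrX -cardE.
have -> : `|4| = 4 :> R by rewrite ger0_norm.
rewrite mulrC -ler_pdivlMr ?exprn_gt0// => /le_trans; apply.
rewrite [leLHS]mulrAC [leRHS]mulrAC ler_wpM2r// -mulrA ler_wpM2l//.
rewrite -exprVn -prodr_const -big_split/= /weight [leLHS]big_mkcond/=.
apply: ler_prod => i _; rewrite finset.in_set mxE.
have [->|ki] := eqVneq; first by rewrite expr0n addr0 invr1 ler01 lexx.
(* A nonzero integer [k_i] satisfies [1 + k_i ^ 2 <= 16 * k_i ^ 2]. The other coordinates have
   weight factor 1 and were dealt with just above. *)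
have hi : h i ^+ 2 / 4 = (16 * (k ord0 i)%:~R ^+ 2)^-1.
  rewrite /h exprVn exprMn real_normK ?num_real//.
  by field; rewrite intr_eq0.
rewrite hi; have k1 : 1 <= (k ord0 i)%:~R ^+ 2 :> R.
  by rewrite -[X in _ <= X]real_normK ?num_real// -intr_norm exprn_ege1// ler1z -gtz0_ge1 normr_gt0.
rewrite invr_ge0 mulr_ge0 ?sqr_ge0//= lef_pV2 ?posrE; lra.
Qed.

End wave_decay.

Lemma measurable_Rintegral_param (d1 d2 : measure_display) (T1 : measurableType d1)
    (T2 : measurableType d2) (R : realType) (m : {sigma_finite_measure set T2 -> \bar R})
    (f : T1 * T2 -> R) : measurable_fun setT f ->
  measurable_fun setT (fun x => \int[m]_y f (x, y)).
Proof.
move=> mf; have mF : measurable_fun setT (EFin \o f) by exact/measurable_EFinP.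
apply: (measurableT_comp (@fine_measurable R setT measurableT)) => //.
suff : measurable_fun setT (fun x => \int[m]_y (EFin \o f)^\+ (x, y) -
    \int[m]_y (EFin \o f)^\- (x, y))%E.
  apply: eq_measurable_fun => x _; rewrite [RHS]integralE.
  by congr (_ - _)%E; apply: eq_integral => y _; rewrite ?funeposE ?funenegE.
apply: emeasurable_funB.
  have h := @measurable_fun_fubini_tonelli_F _ _ T1 T2 R m (EFin \o f)^\+%E
    (measurable_funepos mF) (fun z => funepos_ge0 _ z).
  exact: h.
have h := @measurable_fun_fubini_tonelli_F _ _ T1 T2 R m (EFin \o f)^\-%E
  (measurable_funeneg mF) (fun z => funeneg_ge0 _ z).
exact: h.
Qed.

Section weight_translation.
Context (R : realType) (d : nat).
Implicit Types (x u : 'rV[R]_d).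

(** Compared with [weight_shift], the translation is arbitrary and the constant depends on it, a
    factor [2 * (1 + u_i ^ 2)] for each coordinate. *)
Lemma weight_translation u : exists2 C, 0 <= C &
  forall x, weight (x + u) <= C * weight x.
Proof.
exists (\prod_i (2 * (1 + u ord0 i ^+ 2))).
  by apply: prodr_ge0 => i _; rewrite mulr_ge0// addr_ge0// sqr_ge0.
move=> x; rewrite /weight -big_split/=; apply: ler_prod => i _.
rewrite invr_ge0 addr_ge0 ?sqr_ge0//= mxE; move: (x ord0 i) (u ord0 i) => z v.
have h (y : R) : 0 < 1 + y ^+ 2 by rewrite ltr_wpDr// sqr_ge0.
rewrite ler_pdivlMr// mulrC ler_pdivrMr//.
have := sqr_ge0 (z + 2 * v); have := mulr_ge0 (sqr_ge0 v) (sqr_ge0 (z + v)); rewrite !expr2; nra.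
Qed.

End weight_translation.

Section dirac_comb_integral.
Context (R : realType) (d : nat).

Lemma eq_integral_dirac_comb (f1 f2 : borel_rV R d -> \bar R) :
  measurable_fun setT f1 -> measurable_fun setT f2 ->
  (forall k, f1 (lattice_pt k) = f2 (lattice_pt k)) ->
  (\int[dirac_comb R d]_x f1 x = \int[dirac_comb R d]_x f2 x)%E.
Proof.
move=> mf1 mf2 f12; apply: ae_eq_integral => //.
exists (~` range (@lattice_pt R d)); split.
- by apply: measurableC; exact: measurable_lattice.
- exact: dirac_comb_lattice.
- by apply: subsetC => _ [k _ <-] _; exact: f12.
Qed.

Lemma eq_Rintegral_dirac_comb (f1 f2 : borel_rV R d -> R) :
  measurable_fun setT f1 -> measurable_fun setT f2 ->
  (forall k, f1 (lattice_pt k) = f2 (lattice_pt k)) ->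
  \int[dirac_comb R d]_x f1 x = \int[dirac_comb R d]_x f2 x.
Proof.
move=> mf1 mf2 f12; congr fine; apply: eq_integral_dirac_comb.
- exact/measurable_EFinP.
- exact/measurable_EFinP.
- by move=> k; rewrite f12.
Qed.

Lemma Rintegral_dirac_comb_indic k :
  \int[dirac_comb R d]_x \1_[set lattice_pt k] x = 1.
Proof.
rewrite /Rintegral integral_indic ?setIT//; last exact: measurable_rV_set1.
exact: (congr1 fine (dirac_comb_pt R k)).
Qed.

End dirac_comb_integral.

Section wave_products.
Context (R : realType) (d : nat).
Implicit Types (g : borel_rV R d -> R) (x t u : 'rV[R]_d) (j k : 'rV[int]_d) (th : R).

Lemma cosM (a b : R) : cos a * cos b = 2^-1 * (cos (b - a) + cos (a + b)).
Proof. rewrite cosB cosD; lra. Qed.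

Lemma waveM j k (a b : R) t : wave (lattice_pt k) a t * wave (lattice_pt j) b t =
  2^-1 * (wave (lattice_pt (j - k)) (b - a) t + wave (lattice_pt (k + j)) (a + b) t).
Proof.
rewrite /wave cosM /lattice_pt map_mxB map_mxD !dotpDl dotpNl.
by congr (_ * (cos _ + cos _)); ring.
Qed.

Lemma cell_waveM j k (a b : R) :
  \int[cell_measure R d]_t (wave (lattice_pt k) a t * wave (lattice_pt j) b t) =
  2^-1 * ((k == j)%:R * cos (b - a) + (k == - j)%:R * cos (a + b)).
Proof.
under eq_Rintegral do rewrite waveM.
have iw l c := integrable_wave (lattice_pt l : 'rV[R]_d) c.
rewrite RintegralZl//; last exact: (integrableD measurableT (iw _ _) (iw _ _)).
by rewrite RintegralD// !cell_wave subr_eq0 addr_eq0 [j == k]eq_sym.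
Qed.

Lemma wave_decomp x th t : wave x th t = wave x 0 t * cos th + wave x (pi / 2) t * sin th.
Proof. by rewrite /wave cosD addr0 cosDpihalf; ring. Qed.

Lemma wave_opp x th t : wave (- x) (- th) t = wave x th t.
Proof. by rewrite /wave dotpNl mulrN -opprD cosN. Qed.

Lemma wave_integral_opp g x th : wave_integral g (- x) (- th) = wave_integral g x th.
Proof. by apply: eq_Rintegral => t _; rewrite wave_opp. Qed.

Lemma wave_integral_decomp g x th : (lebesgue_rV d).-integrable setT (EFin \o g) ->
  wave_integral g x th = wave_integral g x 0 * cos th + wave_integral g x (pi / 2) * sin th.
Proof.
move=> ig; rewrite /wave_integral.
have i0 := integrable_mul_wave x 0 ig; have i1 := integrable_mul_wave x (pi / 2) ig.
rewrite -!RintegralZr// -RintegralD//; last 2 first.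
- exact: (integrableZr measurableT (cos th) i0).
- exact: (integrableZr measurableT (sin th) i1).
by apply: eq_Rintegral => t _; rewrite wave_decomp; ring.
Qed.

Lemma measurable_wave_integral g (dT : measure_display) (T : measurableType dT)
    (x : T -> borel_rV R d) (th : T -> R) :
  measurable_fun setT g -> measurable_fun setT x -> measurable_fun setT th ->
  measurable_fun setT (fun z => wave_integral g (x z) (th z)).
Proof.
move=> mg mx mth.
apply: (@measurable_Rintegral_param _ _ T (borel_rV R d) R (@lebesgue_rV R d)
  (fun p => g p.2 * wave (x p.1) (th p.1) p.2)).
apply: measurable_funM; first exact: (measurableT_comp mg measurable_snd).
apply: measurable_cos; apply: measurable_funD.
  apply: measurable_funM => //.
  have mp : measurable_fun setT (fun p : T * borel_rV R d => (x p.1, p.2)).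
    by apply: measurable_fun_pair; [exact: (measurableT_comp mx measurable_fst)|
      exact: measurable_snd].
  exact: (measurableT_comp (@measurable_dotp2 R d) mp).
exact: (measurableT_comp mth measurable_fst).
Qed.

End wave_products.

Section Rintegral_fubini.
Context (d1 d2 : measure_display) (T1 : measurableType d1) (T2 : measurableType d2).
Context (R : realType) (m1 : {sigma_finite_measure set T1 -> \bar R}).
Context (m2 : {sigma_finite_measure set T2 -> \bar R}).

Lemma EFin_Rintegral (d : measure_display) (T : measurableType d)
    (m : {measure set T -> \bar R}) (f : T -> R) : m.-integrable setT (EFin \o f) ->
  ((\int[m]_x f x)%:E = \int[m]_x (f x)%:E)%E.
Proof. by move=> mf; rewrite /Rintegral fineK//; exact: integrable_fin_num. Qed.

Lemma Rintegral_fubini (f : T1 * T2 -> R) : (m1 \x m2)%E.-integrable setT (EFin \o f) ->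
  (forall x, m2.-integrable setT (EFin \o (fun y => f (x, y)))) ->
  (forall y, m1.-integrable setT (EFin \o (fun x => f (x, y)))) ->
  \int[m1]_x \int[m2]_y f (x, y) = \int[m2]_y \int[m1]_x f (x, y).
Proof.
move=> intf i2 i1; rewrite /Rintegral; congr fine.
under eq_integral do rewrite -/(Rintegral _ _ _) (EFin_Rintegral (i2 _)).
under [RHS]eq_integral do rewrite -/(Rintegral _ _ _) (EFin_Rintegral (i1 _)).
exact: (Fubini intf).
Qed.

(* A bound by an integrable function of the second variable alone gives
   joint integrability over a finite measure. *)
Lemma integrable_prod_bound (f : T1 * T2 -> R) (w : T2 -> R) : (m1 setT < +oo)%E ->
  measurable_fun setT f -> (forall p, `|f p| <= w p.2) ->
  m2.-integrable setT (EFin \o w) -> (m1 \x m2)%E.-integrable setT (EFin \o f).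
Proof.
move=> m1T mf fw iw; have mw := measurable_int _ iw.
have mF : measurable_fun setT (EFin \o f) by exact/measurable_EFinP.
apply: (@le_integrable _ _ _ _ _ measurableT _ (fun p => (w p.2)%:E)) => //.
  by move=> p _; rewrite /= lee_fin (le_trans (fw p))// ler_norm.
apply/integrable12ltyP; first exact: (measurableT_comp mw measurable_snd).
have /integrableP[_ foo] := iw; rewrite /= integral_cst//.
by rewrite lte_mul_pinfty// ?integral_ge0// ge0_fin_numE ?integral_ge0.
Qed.

End Rintegral_fubini.

(** * Fourier coefficients of the two sides of Poisson summation *)

Section poisson_coefficients.
Context (R : realType) (d : nat).
Variable g : borel_rV R d -> R.
Hypothesis ng : nice g.

Let Z := dirac_comb R d.
Let cm := cell_measure R d.
Let ig := nice_integrable ng.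

(* The Fourier integral at x of the translate of g by - u, set to 0 off the lattice. *)
Definition frequency_term (u x : borel_rV R d) : R :=
  \1_(range (@lattice_pt R d)) x * wave_integral g x (- (2 * pi * dotp x u)).

Lemma measurable_frequency_term :
  measurable_fun setT (fun p : borel_rV R d * borel_rV R d => frequency_term p.1 p.2).
Proof.
apply: measurable_funM.
  have mi : measurable_fun setT (\1_(range (@lattice_pt R d)) : borel_rV R d -> R).
    by apply: measurable_indic; exact: measurable_lattice.
  exact: (measurableT_comp mi measurable_snd).
apply: measurable_wave_integral; first exact: nice_measurable.
  exact: measurable_snd.
apply: measurableT_comp => //; apply: measurable_funM => //.
have mp : measurable_fun setT (fun p : borel_rV R d * borel_rV R d => (p.2, p.1)).
  by apply: measurable_fun_pair; [exact: measurable_snd|exact: measurable_fst].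
exact: (measurableT_comp (@measurable_dotp2 R d) mp).
Qed.

Lemma frequency_term_bound : exists2 C, 0 <= C &
  forall u x, `|frequency_term u x| <= C * weight x.
Proof.
have [C C0 hC] := wave_integral_decay ng; exists C => // u x.
rewrite /frequency_term indicE; have [[k _ <-]|nx] := pselect (range (@lattice_pt R d) x).
  by rewrite mem_set ?mul1r//; exists k.
by rewrite memNset// mul0r normr0 mulr_ge0// ltW ?weight_gt0.
Qed.

Definition frequency_sum u := \int[Z]_x frequency_term u x.

Definition space_sum (u : 'rV[R]_d) := \int[Z]_x g (u + (x : 'rV[R]_d)).

Lemma integrable_frequency_term u : Z.-integrable setT (EFin \o frequency_term u).
Proof.
have [C _ hC] := frequency_term_bound.
apply: (integrable_weight_bound (@dirac_comb_weight R d) _ (hC u)).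
exact: (measurableT_comp measurable_frequency_term (measurable_pair1 u)).
Qed.

Lemma measurable_frequency_sum : measurable_fun setT frequency_sum.
Proof.
exact: (@measurable_Rintegral_param _ _ _ _ R (dirac_comb R d) _ measurable_frequency_term).
Qed.

Lemma integrable_frequency_sum : cm.-integrable setT (EFin \o frequency_sum).
Proof.
have [C _ hC] := frequency_term_bound.
apply: (@bounded_integrable _ _ _ cm _ (C * \int[Z]_x weight x) measurable_frequency_sum).
move=> u; apply: (Rintegral_weight_bound (@dirac_comb_weight R d) _ (hC u)).
exact: (measurableT_comp measurable_frequency_term (measurable_pair1 u)).
Qed.

(** With real waves, orthogonality leaves two frequencies, [j] and [- j], each carrying half of the
    coefficient. The two halves fall on the same point when [j = 0], which the sum of two indicators
    covers as well. *)
Lemma frequency_sum_coef j th :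
  \int[cm]_u (frequency_sum u * wave (lattice_pt j) th u) =
  wave_integral g (lattice_pt j) th.
Proof.
have [C C0 hC] := frequency_term_bound.
have iw := integrable_weight (@dirac_comb_weight R d).
have mS := measurable_frequency_term.
have mW := @measurable_wave R d (lattice_pt j) th.
pose F (p : borel_rV R d * borel_rV R d) :=
  frequency_term p.1 p.2 * wave (lattice_pt j) th p.1.
have mF : measurable_fun setT F.
  by apply: measurable_funM => //; exact: (measurableT_comp mW measurable_fst).
have FC p : `|F p| <= C * weight p.2.
  by rewrite normrM (le_trans _ (hC p.1 p.2))// ler_piMr ?wave_le1.
have iCw : Z.-integrable setT (EFin \o (fun x => C * weight x)).
  exact: (integrableZl measurableT C iw).
have cmT : (cm setT < +oo)%E by exact: fin_num_fun_lty.
have iF := integrable_prod_bound cmT mF FC iCw.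
have iF2 u : Z.-integrable setT (EFin \o (fun x => F (u, x))).
  apply: (integrable_weight_bound (@dirac_comb_weight R d) _ (fun x => FC (u, x))).
  exact: (measurableT_comp mF (measurable_pair1 u)).
have iF1 x : cm.-integrable setT (EFin \o (fun u => F (u, x))).
  apply: (@bounded_integrable _ _ _ cm _ (C * weight x)).
    exact: (measurableT_comp mF (measurable_pair2 x)).
  by move=> u; exact: (FC (u, x)).
transitivity (\int[cm]_u \int[Z]_x F (u, x)).
  apply: eq_Rintegral => u _; rewrite -RintegralZr//; exact: integrable_frequency_term.
rewrite (Rintegral_fubini iF iF2 iF1).
set w := wave_integral g (lattice_pt j) th.
transitivity (\int[Z]_x (2^-1 * w * \1_[set lattice_pt j] x +
    2^-1 * w * \1_[set lattice_pt (- j)] x)); last first.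
  have ii k : Z.-integrable setT (EFin \o (\1_[set lattice_pt k] : borel_rV R d -> R)).
    apply: integrable_indic_lty; first exact: measurable_rV_set1.
    apply: (@le_lt_trans _ _ 1%E); last exact: ltry.
    by rewrite le_eqVlt; apply/orP; left; apply/eqP; exact: dirac_comb_pt.
  rewrite RintegralD//; last 2 first.
  - exact: (integrableZl measurableT _ (ii _)).
  - exact: (integrableZl measurableT _ (ii _)).
  by rewrite !RintegralZl// !Rintegral_dirac_comb_indic; lra.
apply: eq_Rintegral_dirac_comb.
- apply: (@measurable_Rintegral_param _ _ _ _ R cm (fun q => F (q.2, q.1))).
  have ms : measurable_fun setT (fun q : borel_rV R d * borel_rV R d => (q.2, q.1)).
    by apply: measurable_fun_pair; [exact: measurable_snd|exact: measurable_fst].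
  exact: (measurableT_comp mF ms).
- apply: measurable_funD; apply: measurable_funM => //; apply: measurable_indic;
    exact: measurable_rV_set1.
move=> k; rewrite !indicE.
have inE1 l : (lattice_pt k \in [set (lattice_pt l : 'rV[R]_d)]) = (k == l).
  apply/idP/eqP => [|->]; last by rewrite inE.
  by rewrite inE => /lattice_pt_inj.
rewrite !inE1.
pose a := wave_integral g (lattice_pt k) 0; pose b := wave_integral g (lattice_pt k) (pi / 2).
transitivity (\int[cm]_u (a * (wave (lattice_pt k) 0 u * wave (lattice_pt j) th u) +
    b * (wave (lattice_pt k) (pi / 2) u * wave (lattice_pt j) th u))).
  apply: eq_Rintegral => u _; rewrite /F /frequency_term/= indicE mem_set; last by exists k.
  rewrite mul1r (wave_integral_decomp _ _ ig) -/a -/b cosN sinN /wave addr0 cosDpihalf.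
  by ring.
have iW l al : cm.-integrable setT (EFin \o (fun u => wave (lattice_pt l) al u *
    wave (lattice_pt j) th u)).
  by apply: integrable_mul_wave; exact: integrable_wave.
rewrite RintegralD//; last 2 first.
- exact: (integrableZl measurableT _ (iW _ _)).
- exact: (integrableZl measurableT _ (iW _ _)).
rewrite !RintegralZl// !cell_waveM subr0 add0r cosBpihalf [pi / 2 + th]addrC cosDpihalf.
have w1 : k = j -> a * cos th + b * sin th = w.
  by move=> kj; rewrite /w -kj [RHS]wave_integral_decomp.
have w2 : k = - j -> a * cos th - b * sin th = w.
  move=> kj; rewrite /w -wave_integral_opp /lattice_pt -map_mxN -/(lattice_pt _) -kj.
  by rewrite [wave_integral _ _ (- th)]wave_integral_decomp// cosN sinN mulrN.
have [kj|kj] := eqVneq k j; have [kj'|kj'] := eqVneq k (- j); rewrite ?mul1r ?mul0r ?mulr1 ?mulr0.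
- by have := w1 kj; have := w2 kj'; lra.
- by have := w1 kj; lra.
- by have := w2 kj'; lra.
- by lra.
Qed.

Lemma integrable_space_term u :
  Z.-integrable setT (EFin \o (fun x : borel_rV R d => g (u + (x : 'rV[R]_d)))).
Proof.
have [C C0 hC] := nice_weight ng; have [D D0 hD] := weight_translation u.
apply: (integrable_weight_bound (C := C * D) (@dirac_comb_weight R d)).
  have := measurableT_comp (nice_measurable ng) (measurable_rV_translation u).
  by apply: eq_measurable_fun => x _ /=; rewrite addrC.
move=> x; rewrite (le_trans (hC _))// -mulrA ler_wpM2l// addrC; exact: hD.
Qed.

Let add (p : borel_rV R d * borel_rV R d) : borel_rV R d :=
  (p.1 : 'rV[R]_d) + (p.2 : 'rV[R]_d).

Lemma periodization_cell_integrable (f : borel_rV R d -> R) :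
  (lebesgue_rV d).-integrable setT (EFin \o f) ->
  (periodization cm).-integrable setT (EFin \o f).
Proof.
move=> /integrableP[mf foo]; apply/integrableP; split => //.
rewrite (eq_measure_integral (lebesgue_rV d))// => A mA _.
by apply/esym; exact: lebesgue_periodization.
Qed.

Lemma integrable_space_sum : cm.-integrable setT (EFin \o space_sum).
Proof.
have iP := integrable_periodization (periodization_cell_integrable ig).
have := integrable_fubini_F iP; apply: eq_integrable => // u _.
by rewrite /= EFin_Rintegral//; exact: integrable_space_term.
Qed.

(** Unfolding: the wave is invariant under the lattice, so it enters the sum, and integrating over
    the cell and summing over the lattice amount to integrating over the whole space. *)
Lemma space_sum_coef j th :
  \int[cm]_u (space_sum u * wave (lattice_pt j) th u) = wave_integral g (lattice_pt j) th.
Proof.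
have iF := integrable_mul_wave (lattice_pt j) th ig.
have iP := periodization_cell_integrable iF.
rewrite /wave_integral [RHS]/Rintegral (eq_measure_integral (periodization cm)); last first.
  by move=> A mA _; exact: lebesgue_periodization.
have := integral_periodization iP => /= ->.
congr fine; apply: eq_integral => u _.
have iu := integrable_space_term u.
rewrite -RintegralZr// EFin_Rintegral; last exact: (integrableZr measurableT _ iu).
apply: eq_integral_dirac_comb.
- exact: (measurable_int _ (integrableZr measurableT _ iu)).
- have := measurableT_comp (measurable_int _ iF) (measurable_rV_translation u).
  by apply: eq_measurable_fun => x _ /=; rewrite [u + _]addrC.
- by move=> k; rewrite wave_lattice.
Qed.

End poisson_coefficients.

(** * Continuity at 0 and uniqueness of Fourier coefficients *)

Section coordinate_nbhs.
Context (R : realType) (d : nat).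

Lemma nbhs0_rV (U : set 'rV[R]_d) : nbhs (0 : 'rV[R]_d) U ->
  exists2 e : R, 0 < e & forall u : 'rV[R]_d, (forall i, `|u ord0 i| < e) -> U u.
Proof.
move=> /nbhs_ballP[e /= e0 eU]; exists e => // u ue; apply: eU; split => // j i.
by rewrite (ord1 j) -ball_normE/= mxE sub0r normrN.
Qed.

(** Dominated convergence speaks of sequences: if no radius worked, points chosen in the cubes of
    radius [n.+1%:R^-1] would contradict it. *)
Lemma dominated_continuity (f : 'rV[R]_d -> borel_rV R d -> R) (C : R) :
  (forall u, measurable_fun setT (f u)) ->
  (forall u : 'rV[R]_d, (forall i, `|u ord0 i| <= 1) -> forall x, `|f u x| <= C * weight x) ->
  (forall x, f u x @[u --> (0 : 'rV[R]_d)] --> f 0 x) ->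
  forall e, 0 < e -> exists2 r : R, 0 < r & forall u : 'rV[R]_d,
    (forall i, `|u ord0 i| < r) ->
    `|\int[dirac_comb R d]_x f u x - \int[dirac_comb R d]_x f 0 x| < e.
Proof.
move=> mf fC f0 e e0; apply: contrapT => no.
have /choice[u hu] (n : nat) : exists u : 'rV[R]_d, (forall i, `|u ord0 i| < n.+1%:R^-1) /\
    e <= `|\int[dirac_comb R d]_x f u x - \int[dirac_comb R d]_x f 0 x|.
  apply: contrapT => nu; apply: no; exists n.+1%:R^-1; first by rewrite invr_gt0.
  by move=> u u1; rewrite ltNge; apply/negP => h; apply: nu; exists u.
have u1 n i : `|u n ord0 i| <= 1.
  by rewrite (le_trans (ltW ((hu n).1 i)))// invf_le1// ler1n.
have fu x : (f (u n) x) @[n --> \oo] --> f 0 x.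
  move=> V /(f0 x) /nbhs0_rV[r r0 hr].
  have [N _ hN] := near_infty_natSinv_lt (PosNum r0).
  exists N => // n /hN /= nr; rewrite /= in hr *; apply: (hr (u n)) => i.
  exact: lt_trans ((hu n).1 i) nr.
have iw := integrableZl measurableT C (integrable_weight (@dirac_comb_weight R d)).
have [|||||_ _ cvgI] := @dominated_convergence _ _ R (dirac_comb R d) setT measurableT
  (fun n x => (f (u n) x)%:E) (fun x => (f 0 x)%:E) (fun x => (C * weight x)%:E).
- by move=> n; exact/measurable_EFinP.
- exact/measurable_EFinP.
- by apply: aeW => x _; apply: cvg_EFin; [exact: nearW|exact: fu].
- exact: iw.
- by apply: aeW => x n _; rewrite /= lee_fin; exact: fC.
have ifu (v : 'rV[R]_d) : (forall i, `|v ord0 i| <= 1) -> (dirac_comb R d).-integrable setT (EFin \o f v).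
  by move=> v1; exact: (integrable_weight_bound (@dirac_comb_weight R d) (mf v) (fC v v1)).
have i0 : (dirac_comb R d).-integrable setT (EFin \o f 0).
  by apply: ifu => i; rewrite mxE normr0.
have cvgR : \int[dirac_comb R d]_x f (u n) x @[n --> \oo] --> \int[dirac_comb R d]_x f 0 x.
  apply: fine_cvg; rewrite fineK; first exact: cvgI.
  exact: (@integrable_fin_num _ _ _ (dirac_comb R d) setT measurableT _ i0).
have /cvgrPdist_lt/(_ e e0)[n _ hn] := cvgR.
by have := hn n (leqnn n); rewrite /= distrC ltNge (hu n).2.
Qed.

End coordinate_nbhs.

Section fejer_type_kernel.
Context (R : realType) (d : nat).
Implicit Types (u : 'rV[R]_d) (i : 'I_d) (j : 'rV[int]_d).

(** The square of [cos (pi * u_i)]: a nonnegative trigonometric polynomial that, on the cell, takes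
    the value 1 only where the [i]-th coordinate is 0. *)
Definition hump i u : R := (1 + cos (2 * pi * u ord0 i)) / 2.

Lemma hump_ge0 i u : 0 <= hump i u.
Proof. by rewrite divr_ge0// -lerBlDl sub0r cos_geN1. Qed.

Lemma hump_le1 i u : hump i u <= 1.
Proof. by rewrite /hump; have := cos_le1 (2 * pi * u ord0 i); lra. Qed.

Lemma measurable_hump i : measurable_fun [set: borel_rV R d] (hump i : borel_rV R d -> R).
Proof.
apply: measurable_funM => //; apply: measurable_funD => //; apply: measurable_cos.
by apply: measurable_funM => //; exact: measurable_borel_coord.
Qed.

(** Multiplication by a hump turns a wave into a combination of three waves, so vanishing Fourier
    coefficients keep vanishing against products of humps. *)
Lemma hump_wave i j th u : hump i u * wave (lattice_pt j) th u =
  2^-1 * wave (lattice_pt j) th u + 4^-1 * wave (lattice_pt (j + delta_mx ord0 i)) th u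
  + 4^-1 * wave (lattice_pt (j - delta_mx ord0 i)) th u.
Proof.
have dE : dotp (lattice_pt (delta_mx ord0 i)) u = u ord0 i.
  rewrite /dotp (bigD1 i)//= big1 => [|l li]; last first.
    by rewrite !mxE (negbTE li) andbF mul0r.
  by rewrite !mxE !eqxx mul1r addr0.
rewrite /hump /wave /lattice_pt map_mxB map_mxD !dotpDl dotpNl dE.
set a := 2 * pi * dotp _ u + th; set b := 2 * pi * u ord0 i.
have -> : 2 * pi * (dotp (map_mx intr j) u + u ord0 i) + th = a + b by rewrite /a /b; ring.
have -> : 2 * pi * (dotp (map_mx intr j) u - u ord0 i) + th = a - b by rewrite /a /b; ring.
by clearbody a b; rewrite cosB cosD; move: (cos a) (cos b) (sin a) (sin b) => ca cb sa sb; field.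
Qed.

Lemma cos_lt1_far (r y : R) : 0 < r <= 2^-1 -> r <= `|y| <= 2^-1 ->
  cos (2 * pi * y) <= cos (2 * pi * r).
Proof.
move=> /andP[r0 r1] /andP[ry y1].
have pi0 := pi_gt0 R.
rewrite -[leLHS]cos_norm normrM ger0_norm ?mulr_ge0 ?pi_ge0//.
rewrite leNgt; apply/negP => h.
have h0 (z : R) : 0 <= z <= 2^-1 -> 0 <= 2 * pi * z <= pi.
  by move=> /andP[z0 z1]; rewrite !mulr_ge0 ?pi_ge0//=; nra.
move: h; rewrite ltr_cos ?in_itv/= ?h0 ?(ltW r0) ?r1 ?normr_ge0 ?y1//.
by rewrite ltNge ler_wpM2l// mulr_ge0// pi_ge0.
Qed.

Lemma cos_lt1 (r : R) : 0 < r <= 2^-1 -> cos (2 * pi * r) < 1.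
Proof.
move=> /andP[r0 r1]; have pi0 := pi_gt0 R.
rewrite -[ltRHS](@cos0 R) ltr_cos ?in_itv/= ?lexx ?pi_ge0//.
  by rewrite !mulr_gt0.
by rewrite !mulr_ge0 ?pi_ge0 ?(ltW r0)//=; nra.
Qed.

Lemma prod_hump_near (r : R) : r < 1 ->
  exists2 e : R, 0 < e & forall u, (forall i, `|u ord0 i| < e) -> r < \prod_i hump i u.
Proof.
move=> r1; apply: nbhs0_rV.
have hc i : hump i u @[u --> (0 : 'rV[R]_d)] --> (1 : R).
  have h0 : hump i 0 = 1 by rewrite /hump mxE mulr0 cos0; lra.
  rewrite -[X in _ --> X]h0.
  have nx : Filter (nbhs (0 : 'rV[R]_d)) by exact: nbhs_filter.
  have c1 : (fun u : 'rV[R]_d => u ord0 i) @ nbhs (0 : 'rV[R]_d) --> (0 : 'rV[R]_d) ord0 i.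
    exact: (@coord_continuous R 1 d ord0 i).
  have c2 := cvgM (cvg_cst (2 * pi : R)) c1.
  have c3 := cvg_comp _ _ (c2 nx nx) (@continuous_cos R _).
  have c4 := cvgD (cvg_cst (1 : R)) c3.
  have c5 := cvgM (c4 nx nx) (cvg_cst (2^-1 : R)).
  exact: (c5 nx nx).
have nx : Filter (nbhs (0 : 'rV[R]_d)) by exact: nbhs_filter.
have pc (s : seq 'I_d) :
    (fun u : 'rV[R]_d => \prod_(i <- s) hump i u) @ nbhs (0 : 'rV[R]_d) --> (1 : R).
  elim: s => [|i s ih].
    by under eq_fun do rewrite big_nil; exact: cvg_cst.
  under eq_fun do rewrite big_cons.
  by have := cvgM (hc i) ih; rewrite mulr1; apply.
exact: (@cvgr_gt _ _ _ nx _ _ (pc (index_enum 'I_d)) _ r1).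
Qed.

End fejer_type_kernel.

Section trigonometric_uniqueness.
Context (R : realType) (d : nat).

Let cm := cell_measure R d.

Lemma integrable_mul_le1 (G h : borel_rV R d -> R) :
  cm.-integrable setT (EFin \o G) -> measurable_fun setT h -> (forall u, `|h u| <= 1) ->
  cm.-integrable setT (EFin \o (fun u => G u * h u)).
Proof.
move=> iG mh h1; have mG := measurable_int _ iG.
apply: le_integrable iG => //.
  by apply/measurable_EFinP; apply: measurable_funM => //; exact/measurable_EFinP.
by move=> u _; rewrite /= lee_fin normrM ler_piMr.
Qed.

Lemma eq_Rintegral_cell (f1 f2 : borel_rV R d -> R) :
  measurable_fun setT f1 -> measurable_fun setT f2 ->
  (forall u, @cell R d u -> f1 u = f2 u) -> \int[cm]_u f1 u = \int[cm]_u f2 u.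
Proof.
move=> mf1 mf2 f12; congr fine; apply: ae_eq_integral => //.
- exact/measurable_EFinP.
- exact/measurable_EFinP.
exists (~` @cell R d); split.
- by apply: measurableC; exact: measurable_cell.
- transitivity (lebesgue_rV d (~` @cell R d `&` @cell R d)) => //.
  by rewrite setICl measure0.
- by apply: subsetC => u uC _; rewrite f12.
Qed.

Lemma prod_hump_bounds (l : seq 'I_d) (u : 'rV[R]_d) : 0 <= \prod_(i <- l) hump i u <= 1.
Proof.
elim: l => [|i l /andP[h0 h1]]; first by rewrite big_nil ler01 lexx.
by rewrite big_cons mulr_ge0 ?hump_ge0//= mulr_ile1 ?hump_ge0 ?hump_le1.
Qed.

Lemma measurable_prod_hump (l : seq 'I_d) :
  measurable_fun [set: borel_rV R d] (fun u : borel_rV R d => \prod_(i <- l) hump i u).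
Proof. by apply: measurable_prod => i _; exact: measurable_hump. Qed.

Lemma prod_hump_coef (G : borel_rV R d -> R) : cm.-integrable setT (EFin \o G) ->
  (forall j th, \int[cm]_u (G u * wave (lattice_pt j) th u) = 0) ->
  forall (l : seq 'I_d) j th,
    \int[cm]_u (G u * (\prod_(i <- l) hump i u * wave (lattice_pt j) th u)) = 0.
Proof.
move=> iG G0; elim=> [|i l ih] j th.
  by rewrite -[RHS](G0 j th); apply: eq_Rintegral => u _; rewrite big_nil mul1r.
pose F j' u := G u * (\prod_(i' <- l) hump i' u * wave (lattice_pt j') th u).
have iF j' : cm.-integrable setT (EFin \o F j').
  apply: integrable_mul_le1 => //.
    by apply: measurable_funM; [exact: measurable_prod_hump|exact: measurable_wave].
  move=> u; rewrite normrM mulr_ile1 ?wave_le1//.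
  by have /andP[h0 h1] := prod_hump_bounds l u; rewrite ger0_norm.
transitivity (\int[cm]_u (2^-1 * F j u + 4^-1 * F (j + delta_mx ord0 i) u +
    4^-1 * F (j - delta_mx ord0 i) u)).
  apply: eq_Rintegral => u _; rewrite big_cons mulrAC hump_wave /F; ring.
have iFZ c j' := integrableZl measurableT c (iF j').
rewrite RintegralD//; [|exact: (integrableD measurableT (iFZ _ _) (iFZ _ _))|exact: iFZ].
rewrite RintegralD//; [|exact: iFZ|exact: iFZ].
by rewrite !RintegralZl// /F !ih !mulr0 !addr0.
Qed.

Lemma prod_hump_pow_coef (G : borel_rV R d -> R) : cm.-integrable setT (EFin \o G) ->
  (forall j th, \int[cm]_u (G u * wave (lattice_pt j) th u) = 0) ->
  forall n, \int[cm]_u (G u * (\prod_i hump i u) ^+ n) = 0.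
Proof.
move=> iG G0 n.
(* A power of the full product is a product of humps over a list with repetitions, the form treated
   by [prod_hump_coef]. *)
have [l hl] : exists l : seq 'I_d, forall u : 'rV[R]_d,
    (\prod_i hump i u) ^+ n = \prod_(i <- l) hump i u.
  elim: n => [|n [l ih]]; first by exists [::] => u; rewrite big_nil.
  by exists (index_enum 'I_d ++ l) => u; rewrite exprS ih big_cat.
rewrite -[RHS](prod_hump_coef iG G0 l 0 0); apply: eq_Rintegral => u _.
rewrite hl /wave (_ : dotp _ _ = 0) ?mulr0 ?addr0 ?cos0 ?mulr1//.
by rewrite /dotp big1// => i _; rewrite !mxE mul0r.
Qed.

(** If [G 0] were positive, the vanishing integrals of [G * q ^ n] would be at least a constant
    times [sig ^ n], from a small cube around 0, minus a constant times [rho ^ n], from the points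
    far from 0. As [rho < sig], this fails for large [n]. *)
Let trig_uniqueness_le0 (G : borel_rV R d -> R) : cm.-integrable setT (EFin \o G) ->
  (forall j th, \int[cm]_u (G u * wave (lattice_pt j) th u) = 0) ->
  (forall e, 0 < e -> exists2 r : R, 0 < r & forall u : 'rV[R]_d,
    (forall i, `|u ord0 i| < r) -> `|G u - G 0| < e) ->
  G 0 <= 0.
Proof.
move=> iG G0 Gc; rewrite leNgt; apply/negP => a0; set a := G 0 in a0 Gc.
have [r0 r00 hr0] := Gc (a / 2) (divr_gt0 a0 (ltr0n _ 2)).
(* [r0] bounds the region where [G] stays above [a / 2]. Keeping [r] below 1/2 places the near cube
   in the cell and allows [cos_lt1_far]. *)
pose r := Num.min r0 4^-1.
have rr : 0 < r <= 2^-1.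
  by rewrite lt_min r00 invr_gt0 ltr0n/= ge_min; apply/orP; right; lra.
pose rho := (1 + cos (2 * pi * r)) / 2.
have rho0 : 0 <= rho by rewrite divr_ge0// -lerBlDl sub0r cos_geN1.
have rho1 : rho < 1 by rewrite /rho; have := cos_lt1 rr; lra.
(* Strictly between [rho], the bound on the kernel far from 0, and 1, its value at 0. *)
pose sig := (1 + rho) / 2.
have sig0 : 0 < sig by rewrite /sig; lra.
have sig1 : sig < 1 by rewrite /sig; lra.
have [e0 e00 he0] := @prod_hump_near R d sig sig1.
pose e := Num.min e0 r.
have ee : 0 < e by rewrite lt_min e00; case/andP: rr.
pose N : set (borel_rV R d) := rbox (fun=> - (e / 2)) e.
have mN : measurable N by exact: measurable_rbox.
have Ne u : N u -> forall i, `|u ord0 i| < e.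
  by move=> Nu i; have /andP[h1 h2] := Nu i; rewrite ltr_norml; apply/andP; split; lra.
have er : e <= r by rewrite ge_min lexx orbT.
have rr0 : r <= r0 by rewrite ge_min lexx.
have NC : N `<=` @cell R d.
  move=> u Nu i; have := Ne u Nu i; have /andP[_ r2] := rr.
  by rewrite ltr_norml => /andP[h1 h2]; apply/andP; split; lra.
have volN : fine (cm N) = e ^+ d.
  rewrite -[RHS]/(fine (e ^+ d)%:E); congr fine.
  transitivity (lebesgue_rV d (N `&` @cell R d)) => //.
  by rewrite setIidl// lebesgue_rbox// ltW.
have mG : measurable_fun setT G by apply/measurable_EFinP; exact: measurable_int iG.
pose q (u : borel_rV R d) := \prod_i hump i u.
have q01 u : 0 <= q u <= 1 by exact: prod_hump_bounds.
have mq n : measurable_fun setT (fun u => q u ^+ n).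
  by apply: measurable_funX; exact: measurable_prod_hump.
(* If all coordinates are below [r], then [G] is at least [a / 2], and on [N] the kernel also
   exceeds [sig]. Otherwise one coordinate is at least [r] in absolute value, so the kernel is at
   most [rho], and [G] is only bounded below by [- |G|]. *)
have pw n u : @cell R d u ->
    a / 2 * sig ^+ n * \1_N u - rho ^+ n * `|G u| <= G u * q u ^+ n.
  move=> uC; have /andP[q0 q1] := q01 u; have [near|] := pselect (forall i, `|u ord0 i| < r).
    have Ga : a / 2 <= G u.
      have := hr0 u (fun i => lt_le_trans (near i) rr0).
      by rewrite ltr_norml => /andP[h _]; lra.
    have G0' : 0 <= G u by lra.
    rewrite (le_trans (_ : _ <= a / 2 * sig ^+ n * \1_N u))//.
      by rewrite gerBl mulr_ge0 ?exprn_ge0.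
    rewrite indicE; have [uN|uN] := boolP (u \in N); last by rewrite mulr0 mulr_ge0 ?exprn_ge0.
    rewrite mulr1 ler_pM// ?exprn_ge0 ?(ltW sig0)//; first by lra.
    apply: lerXn2r; rewrite ?nnegrE ?(ltW sig0)//.
    apply/ltW/he0 => i; move: uN; rewrite inE => /Ne/(_ i)/lt_le_trans; apply.
    by rewrite ge_min lexx.
  move=> /existsNP[i /negP]; rewrite -leNgt => far.
  have uN : u \notin N.
    apply/negP; rewrite inE => /Ne/(_ i); rewrite ltNge (le_trans er far)//.
  rewrite indicE (negbTE uN) mulr0 sub0r.
  have qr : q u <= rho.
    rewrite /q (bigD1 i)//= (le_trans (_ : _ <= hump i u))//.
      rewrite ler_piMr ?hump_ge0//.
      apply: (@le_trans _ _ (\prod_(j < d | j != i) 1)); last by rewrite big1.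
      by apply: ler_prod => j _; rewrite hump_ge0 hump_le1.
    rewrite /hump /rho ler_wpM2r ?invr_ge0// lerD2l; apply: cos_lt1_far => //.
    rewrite far/=; have /andP[] := uC i; rewrite ler_norml => h1 h2.
    by apply/andP; split; lra.
  rewrite lerNl -mulNr (le_trans (ler_wpM2r _ (ler_norm _))) ?exprn_ge0// normrN mulrC.
  by rewrite ler_wpM2r// lerXn2r.
have iN : cm.-integrable setT (EFin \o (\1_N : borel_rV R d -> R)).
  by apply: (@bounded_integrable _ _ _ cm _ 1) => [//|u]; rewrite indicE; case: (_ \in _);
    rewrite ?normr0 ?normr1.
have iGn := integrable_norm iG.
have key n : a / 2 * sig ^+ n * e ^+ d <= rho ^+ n * \int[cm]_u `|G u|.
  have iq : cm.-integrable setT (EFin \o (fun u => G u * q u ^+ n)).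
    apply: integrable_mul_le1 => // u.
    by have /andP[q0 q1] := q01 u; rewrite ger0_norm ?exprn_ge0// exprn_ile1.
  (* [pw] is known on the cell only, whereas integrals for [cm] range over all of R^d; multiplying
     by the indicator of the cell reconciles the two. *)
  have mC : measurable_fun setT (\1_(@cell R d) : borel_rV R d -> R).
    by apply: measurable_indic; exact: measurable_cell.
  have C1 u : `|\1_(@cell R d) u| <= 1 :> R.
    by rewrite indicE; case: (_ \in _); rewrite ?normr0 ?normr1.
  pose L u := a / 2 * sig ^+ n * \1_N u - rho ^+ n * `|G u|.
  have iL : cm.-integrable setT (EFin \o L).
    exact: (integrableB measurableT (integrableZl measurableT _ iN) (integrableZl measurableT _ iGn)).
  have mL : measurable_fun setT L by apply/measurable_EFinP; exact: measurable_int iL.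
  have C_id (f : borel_rV R d -> R) : measurable_fun setT f ->
      \int[cm]_u f u = \int[cm]_u (f u * \1_(@cell R d) u).
    move=> mf; apply: eq_Rintegral_cell => // [|u uC]; first exact: measurable_funM.
    by rewrite indicE mem_set// mulr1.
  rewrite -subr_le0 -(prod_hump_pow_coef iG G0 n).
  have -> : a / 2 * sig ^+ n * e ^+ d - rho ^+ n * \int[cm]_u `|G u| = \int[cm]_u L u.
    rewrite RintegralB//; [|exact: (integrableZl measurableT _ iN)|
      exact: (integrableZl measurableT _ iGn)].
    rewrite !RintegralZl//; congr (_ * _ - _).
    by rewrite /Rintegral integral_indic// setIT volN.
  rewrite (C_id L)// (C_id (fun u => G u * _)); last exact: measurable_funM.
  apply: le_Rintegral => //; [exact: integrable_mul_le1|exact: integrable_mul_le1|].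
  move=> u _; rewrite indicE; have [uC|] := boolP (u \in _); last by rewrite !mulr0.
  by rewrite !mulr1; apply: pw; rewrite inE in uC.
set K := \int[cm]_u _ in key.
have c0 : 0 < a / 2 * e ^+ d by rewrite mulr_gt0 ?exprn_gt0//; lra.
have z1 : `|rho / sig| < 1.
  have z0 : 0 <= rho / sig by apply: divr_ge0 => //; exact: ltW.
  by rewrite (ger0_norm z0) ltr_pdivrMr// mul1r /sig; lra.
have cv : (rho / sig) ^+ n * K @[n --> \oo] --> (0 : R).
  by rewrite -(mul0r K); apply: cvgM; [exact: cvg_expr|exact: cvg_cst].
have /cvgrPdist_lt/(_ _ c0)[n _ /(_ n (leqnn n))] := cv.
rewrite /= sub0r normrN ltNge => /negP; apply.
rewrite (le_trans _ (ler_norm _))// expr_div_n [leRHS]mulrAC ler_pdivlMr ?exprn_gt0//.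
by rewrite mulrAC; exact: key.
Qed.

Lemma trig_uniqueness (G : borel_rV R d -> R) : cm.-integrable setT (EFin \o G) ->
  (forall j th, \int[cm]_u (G u * wave (lattice_pt j) th u) = 0) ->
  (forall e, 0 < e -> exists2 r : R, 0 < r & forall u : 'rV[R]_d,
    (forall i, `|u ord0 i| < r) -> `|G u - G 0| < e) ->
  G 0 = 0.
Proof.
move=> iG G0 Gc; apply/eqP; rewrite eq_le trig_uniqueness_le0//= -oppr_le0.
apply: (@trig_uniqueness_le0 (fun u => - G u)).
- exact: (integrableN iG).
- move=> j th; under eq_Rintegral do rewrite mulNr -mulN1r.
  rewrite RintegralZl// ?G0 ?mulr0//.
  by apply: integrable_mul_wave.
- move=> e e0; have [r r0 hr] := Gc e e0; exists r => // u /hr.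
  by rewrite -opprD normrN.
Qed.

End trigonometric_uniqueness.

(** * Equality of the two sums *)

Section poisson.
Context (R : realType) (d : nat).
Implicit Type g : borel_rV R d -> R.

Lemma continuous_wave_integral g (x : 'rV[R]_d) :
  (lebesgue_rV d).-integrable setT (EFin \o g) -> continuous (wave_integral g x).
Proof.
move=> ig th; rewrite (_ : wave_integral g x = fun th => wave_integral g x 0 * cos th +
    wave_integral g x (pi / 2) * sin th); last first.
  by apply/funext => z; exact: wave_integral_decomp.
apply: cvgD; apply: cvgM; try exact: cvg_cst.
  exact: continuous_cos.
exact: continuous_sin.
Qed.

Lemma dotp_cvg (x v : 'rV[R]_d) :
  (fun u : 'rV[R]_d => dotp x u) @ nbhs v --> dotp x v.
Proof.
have nx : Filter (nbhs v) by exact: nbhs_filter.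
have pc (s : seq 'I_d) : (fun u : 'rV[R]_d => \sum_(i <- s) x ord0 i * u ord0 i) @ nbhs v -->
    \sum_(i <- s) x ord0 i * v ord0 i.
  elim: s => [|i s ih].
    by under eq_fun do rewrite big_nil; rewrite big_nil; exact: cvg_cst.
  under eq_fun do rewrite big_cons.
  have c1 : (fun u : 'rV[R]_d => u ord0 i) @ nbhs v --> v ord0 i.
    exact: (@coord_continuous R 1 d ord0 i).
  have c2 := cvgM (cvg_cst (x ord0 i : R)) c1.
  by have := cvgD (c2 nx nx) ih; rewrite big_cons; apply.
exact: pc.
Qed.

Lemma poisson0 g : nice g -> frequency_sum g 0 = space_sum g 0.
Proof.
move=> ng; have ig := nice_integrable ng; have [cg _] := ng.
have ifs := integrable_frequency_sum ng; have iss := integrable_space_sum ng.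
apply/eqP; rewrite -subr_eq0; apply/eqP.
apply: (@trig_uniqueness _ _ (fun u => frequency_sum g u - space_sum g u)).
- exact: (integrableB measurableT ifs iss).
- move=> j th; under eq_Rintegral do rewrite mulrBl.
  rewrite RintegralB ?frequency_sum_coef ?space_sum_coef ?subrr//; exact: integrable_mul_wave.
have [C1 C10 hC1] := frequency_term_bound ng.
have [C2 C20 hC2] := nice_weight ng.
pose f (u : 'rV[R]_d) (x : borel_rV R d) := frequency_term g u x - g (u + (x : 'rV[R]_d)).
have fE u : frequency_sum g u - space_sum g u = \int[dirac_comb R d]_x f u x.
  by rewrite RintegralB//; [exact: integrable_frequency_term|exact: integrable_space_term].
move=> e e0; have [|||r r0 hr] := @dominated_continuity R d f (C1 + C2 * 3 ^+ d) _ _ _ e e0.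
- move=> u; have i1 := integrable_frequency_term ng u; have i2 := integrable_space_term ng u.
  apply/measurable_EFinP; exact: (measurable_int _ (integrableB measurableT i1 i2)).
- move=> u u1 x; rewrite /f (le_trans (ler_normB _ _))// mulrDl lerD// (le_trans (hC2 _))//.
  by rewrite -mulrA ler_wpM2l// addrC weight_shift.
- move=> x.
  have nx : Filter (nbhs (0 : 'rV[R]_d)) by exact: nbhs_filter.
  have c2 := @continuous_rV_shift R d g (x : 'rV[R]_d) cg (0 : 'rV[R]_d).
  have c1 : (fun u : 'rV[R]_d => frequency_term g u x) @ nbhs (0 : 'rV[R]_d) -->
      frequency_term g 0 x.
    rewrite /frequency_term.
    have d1 : (fun u : 'rV[R]_d => - (2 * pi * dotp (x : 'rV[R]_d) u)) @ nbhs (0 : 'rV[R]_d) -->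
        - (2 * pi * dotp (x : 'rV[R]_d) 0).
      have e1 := cvgM (cvg_cst (2 * pi : R)) (@dotp_cvg (x : 'rV[R]_d) (0 : 'rV[R]_d)).
      have e2 := cvgN (e1 nx nx).
      exact: (e2 nx).
    have d2 := cvg_comp _ _ d1 (@continuous_wave_integral g x ig _).
    have d3 := cvgM (cvg_cst (\1_(range (@lattice_pt R d)) x : R)) d2.
    exact: (d3 nx nx).
  have c3 := cvgB c1 c2.
  exact: (c3 nx).
- by exists r => // u /hr; rewrite -!fE.
Qed.

End poisson.

Section poisson_translated.
Context (R : realType) (d : nat).
Implicit Type g : borel_rV R d -> R.

(** The restriction on [s] is the one under which [nice_translation] applies; it covers the cube
    [0,1[^d that carries the spectral measure. *)
Lemma poisson g (s : 'rV[R]_d) : nice g -> (forall i, `|s ord0 i| <= 1) ->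
  frequency_sum g s = space_sum g s.
Proof.
move=> ng s1; pose gs (x : borel_rV R d) := g ((x : 'rV[R]_d) + s).
have ngs : nice gs by exact: nice_translation.
transitivity (frequency_sum gs 0); last first.
  rewrite (poisson0 ngs); apply: eq_Rintegral => x _.
  by rewrite /gs add0r addrC.
apply: eq_Rintegral => x _; rewrite /frequency_term; congr (_ * _).
have iF := integrable_mul_wave (x : 'rV[R]_d) (- (2 * pi * dotp x s)) (nice_integrable ng).
have [_ E] := Rintegral_lebesgue_translation s iF; apply: etrans (esym E) _.
apply: eq_Rintegral => t _; rewrite /gs; congr (_ * _); rewrite /wave dotpDr.
rewrite (_ : dotp (x : 'rV[R]_d) 0 = 0); last by rewrite /dotp big1// => i _; rewrite mxE mulr0.
by congr cos; ring.
Qed.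

End poisson_translated.

Lemma measurable_coords (R : realType) (d : nat) (A : R -> Prop) (B : set (measurableTypeR R)) :
  measurable B -> (forall y, A y <-> B y) ->
  measurable [set x : borel_rV R d | forall i, A (x ord0 i)].
Proof.
move=> mB AB; rewrite (_ : mkset _ = \bigcap_(i in [set: 'I_d])
    ((fun x : borel_rV R d => x ord0 i) @^-1` B)).
  apply: fin_bigcap_measurable => // i _.
  by rewrite -[X in measurable X]setTI; exact: (measurable_borel_coord i).
by apply/seteqP; split => x h i => [_|]; apply/AB; exact: h.
Qed.

Lemma measurable_unit_cube (R : realType) (d : nat) :
  measurable [set x : borel_rV R d | forall i, 0 <= x ord0 i < 1].
Proof.
apply: (measurable_coords (A := fun y => 0 <= y < 1) (measurable_itv `[0, 1[)) => y.
by rewrite /= in_itv.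
Qed.

(** * The diffraction measure *)

Section diffraction_formula.
Context (R : realType) (d : nat) (dT : measure_display) (T : measurableType dT).
Context (P : probability T R) (X : 'rV[int]_d -> {mfun T >-> bool}).
Context (mu : {finite_measure set (borel_rV R d) -> \bar R}).
Hypothesis spectral : is_spectral_measure P X mu.

Let c k := correlation P X k.
Let gamma := correlation_comb P X.

Lemma spectral_cos k : \int[mu]_s wave (lattice_pt k) 0 s = c k.
Proof.
have /(congr1 (fun z => complex.Re z))/= := spectral.2 k => E; apply: etrans E.
by apply: eq_Rintegral => s _; rewrite /wave addr0.
Qed.

Lemma spectral_sin k : \int[mu]_s wave (lattice_pt k) (pi / 2) s = 0.
Proof.
have /(congr1 (fun z => complex.Im z))/= := spectral.2 k => E; apply: etrans E.
by apply: eq_Rintegral => s _; rewrite /wave cosDpihalf.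
Qed.

(** Read off the spectral measure: the correlation is a cosine integral, unchanged when [k] becomes
    [- k]. *)
Lemma correlationN k : c (- k) = c k.
Proof.
rewrite -!spectral_cos; apply: eq_Rintegral => s _.
by rewrite -wave_opp oppr0 /lattice_pt map_mxN opprK.
Qed.

Lemma ge0_integral_correlation_comb (phi : borel_rV R d -> \bar R) :
  measurable_fun setT phi -> (forall x, 0 <= phi x)%E ->
  (\int[gamma]_x phi x = \esum_(k in [set: 'rV[int]_d]) ((c k)%:E * phi (lattice_pt k)))%E.
Proof.
move=> mphi phi0; rewrite [LHS]ge0_integral_esum_measure//.
apply: eq_esum => k _; rewrite ge0_integral_mscale//; congr (_ * _)%E.
by rewrite integral_dirac// diracT mul1e.
Qed.

(* A measurable extension of the correlations from the lattice to R^d. *)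
Let cfun (x : borel_rV R d) : R := `|\int[mu]_s wave x 0 s|.

Let measurable_cfun : measurable_fun setT cfun.
Proof.
apply: measurableT_comp => //.
apply: (@measurable_Rintegral_param _ _ (borel_rV R d) (borel_rV R d) R mu
  (fun p => wave (p.1 : 'rV[R]_d) 0 p.2)).
apply: measurable_cos; apply: measurable_funD => //; apply: measurable_funM => //.
exact: measurable_dotp2.
Qed.

Let cfunE k : cfun (lattice_pt k) = c k.
Proof. by rewrite /cfun spectral_cos ger0_norm// correlation_ge0. Qed.

Let cfun_le x : cfun x <= fine (mu setT).
Proof.
rewrite /cfun; have i1 : mu.-integrable setT (EFin \o (cst 1 : borel_rV R d -> R)).
  exact: finite_measure_integrable_cst.
have iw : mu.-integrable setT (EFin \o (wave x 0 : borel_rV R d -> R)).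
  by apply: (@bounded_integrable _ _ _ mu _ 1); [exact: measurable_wave|exact: wave_le1].
rewrite (le_trans (le_normr_Rintegral _ _))//.
rewrite (le_trans (le_Rintegral measurableT (integrable_norm iw) i1 _))//.
  by move=> s _; exact: wave_le1.
by rewrite Rintegral_cst// mul1r.
Qed.

Let ge0_integral_comb_cfun (phi : borel_rV R d -> \bar R) :
  measurable_fun setT phi -> (forall x, 0 <= phi x)%E ->
  (\int[gamma]_x phi x = \int[dirac_comb R d]_x ((cfun x)%:E * phi x))%E.
Proof.
move=> mphi phi0; rewrite ge0_integral_correlation_comb// ge0_integral_dirac_comb.
- by apply: eq_esum => k _; rewrite cfunE.
- by apply: emeasurable_funM => //; exact/measurable_EFinP.
- by move=> x; rewrite mule_ge0// lee_fin normr_ge0.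
Qed.

Lemma integral_comb_cfun (a : borel_rV R d -> R) : measurable_fun setT a ->
  (\int[gamma]_x (a x)%:E = \int[dirac_comb R d]_x (cfun x * a x)%:E)%E.
Proof.
move=> ma; have mF : measurable_fun setT (EFin \o a) by exact/measurable_EFinP.
rewrite [LHS]integralE [RHS]integralE.
rewrite ge0_integral_comb_cfun; [|exact: measurable_funepos|by move=> x; exact: funepos_ge0].
rewrite ge0_integral_comb_cfun; [|exact: measurable_funeneg|by move=> x; exact: funeneg_ge0].
have c0 x : 0 <= cfun x by exact: normr_ge0.
congr (_ - _)%E; apply: eq_integral => x _; rewrite ?funeposE ?funenegE/=.
  by rewrite -!EFin_max -EFinM maxr_pMr// mulr0.
by rewrite -!EFin_max -EFinM maxr_pMr// mulr0 mulrN.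
Qed.

Lemma weight_correlation_comb : (\int[gamma]_x (weight x)%:E < +oo)%E.
Proof.
have mw : measurable_fun setT (fun x : borel_rV R d => (weight x)%:E).
  by apply/measurable_EFinP; exact: measurable_weight.
have w0 (x : borel_rV R d) : (0 <= (weight x)%:E)%E by rewrite lee_fin ltW ?weight_gt0.
rewrite ge0_integral_comb_cfun//.
apply: (@le_lt_trans _ _ (\int[dirac_comb R d]_x ((fine (mu setT))%:E * (weight x)%:E))%E).
  apply: ge0_le_integral => //.
  - by move=> x _; rewrite mule_ge0// lee_fin normr_ge0.
  - by apply: emeasurable_funM => //; exact/measurable_EFinP.
  - by apply: emeasurable_funM.
  - by move=> x _; rewrite lee_pmul2r ?lte_fin ?weight_gt0// lee_fin.
rewrite ge0_integralZl ?lee_fin ?fine_ge0//.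
rewrite lte_mul_pinfty ?lee_fin ?fine_ge0//; exact: dirac_comb_weight.
Qed.

Lemma integrable_correlation_comb (a : borel_rV R d -> R) C : measurable_fun setT a ->
  (forall k, `|a (lattice_pt k)| <= C * weight (lattice_pt k : 'rV[R]_d)) ->
  gamma.-integrable setT (EFin \o a).
Proof.
move=> ma aC.
have /integrableP[mb foo] := integrableZl measurableT C (integrable_weight weight_correlation_comb).
apply/integrableP; split; first exact/measurable_EFinP.
apply: le_lt_trans foo.
rewrite !ge0_integral_correlation_comb//.
- apply: le_esum => k _; apply: lee_wpmul2l; first by rewrite lee_fin correlation_ge0.
  by rewrite /= lee_fin (le_trans (aC k))// ler_norm.
- exact: measurableT_comp.
- by apply: measurableT_comp => //; exact/measurable_EFinP.
Qed.

Lemma integrable_wave_integral_comb (g : borel_rV R d -> R) th : nice g ->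
  gamma.-integrable setT (EFin \o (fun x : borel_rV R d => wave_integral g x th)).
Proof.
move=> ng; have [C _ hC] := wave_integral_decay ng.
apply: (@integrable_correlation_comb _ C) => [|k]; last exact: hC.
by apply: measurable_wave_integral => //; exact: nice_measurable.
Qed.

(** The correlations are even, so [k] to [- k] exchanges the sums for the positive and negative
    parts of [a]. *)
Lemma odd_integral_correlation_comb (a : borel_rV R d -> R) : measurable_fun setT a ->
  (forall x : 'rV[R]_d, a (- x) = - a x) -> \int[gamma]_x a x = 0.
Proof.
move=> ma odda; rewrite /Rintegral integralE.
have mF : measurable_fun setT (EFin \o a) by exact/measurable_EFinP.
rewrite ge0_integral_correlation_comb; [|exact: measurable_funepos|by move=> x; exact: funepos_ge0].
rewrite ge0_integral_correlation_comb; [|exact: measurable_funeneg|by move=> x; exact: funeneg_ge0].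
have -> : (\esum_(k in [set: 'rV[int]_d]) ((c k)%:E * (EFin \o a)^\- (lattice_pt k)) =
    \esum_(k in [set: 'rV[int]_d]) ((c k)%:E * (EFin \o a)^\+ (lattice_pt k)))%E.
  rewrite [RHS](reindex_esum setT setT -%R).
    apply: eq_esum => k _; rewrite correlationN funeposE funenegE/=.
    by rewrite /lattice_pt map_mxN odda.
  split => // [k k' _ _ /oppr_inj//|k _]; by exists (- k); rewrite ?opprK.
(* If the common value is infinite, so is the difference, and [fine] sends it to 0. *)
by case: (esum _ _) => [r| |]//=; rewrite subrr.
Qed.

Lemma weight_periodization_spectral : (\int[periodization mu]_x (weight x)%:E < +oo)%E.
Proof.
apply: weight_periodization; have [h _] := spectral.
apply/eqP; rewrite -measure_le0 -h; apply: le_measure; rewrite ?inE.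
- by apply: measurableC; apply: (measurable_coords (A := fun y => `|y| <= 1) (measurable_itv `[-1, 1])) => y;
    rewrite /= in_itv/= ler_norml.
- by apply: measurableC; exact: measurable_unit_cube.
apply: subsetC => x x1 i; have /andP[h1 h2] := x1 i.
by rewrite ger0_norm// ltW.
Qed.

Lemma comb_wave_integral (g : borel_rV R d -> R) : rapid g ->
  \int[gamma]_x wave_integral g x 0 = \int[periodization mu]_x g x.
Proof.
move=> rg; have ng := rapid_nice rg.
have mg := nice_measurable ng.
have iP := rapid_integrable weight_periodization_spectral rg.
have ist := integrable_space_term ng.
have ift := integrable_frequency_term ng.
have [C C0 hC] := frequency_term_bound ng.
have mft := measurable_frequency_term ng.
have msum : measurable_fun setT (EFin \o (space_sum g : borel_rV R d -> R)).
  have := measurable_int _ (integrable_fubini_F (integrable_periodization iP)).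
  by apply: eq_measurable_fun => u _ /=; rewrite EFin_Rintegral.
transitivity (\int[mu]_s frequency_sum g s); last first.
  rewrite [RHS]/Rintegral (integral_periodization iP) /Rintegral; congr fine.
  transitivity (\int[mu]_s (space_sum g s)%:E)%E; last first.
    by apply: eq_integral => s _; rewrite EFin_Rintegral//; exact: ist.
  apply: ae_eq_integral => //.
    by apply/measurable_EFinP; exact: measurable_frequency_sum.
  have [h _] := spectral.
  exists (~` [set x : 'rV[R]_d | forall i, 0 <= x ord0 i < 1]); split => //.
    by apply: measurableC; exact: measurable_unit_cube.
  apply: subsetC => s s1 _; rewrite poisson// => i.
  by have /andP[h1 h2] := s1 i; rewrite ger0_norm// ltW.
have iF : (mu \x dirac_comb R d)%E.-integrable setT
    (EFin \o (fun p => frequency_term g p.1 p.2)).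
  have muT : (mu setT < +oo)%E by exact: fin_num_fun_lty.
  have iCw : (dirac_comb R d).-integrable setT (EFin \o (fun x => C * weight x)).
    exact: (integrableZl measurableT C (integrable_weight (@dirac_comb_weight R d))).
  exact: (integrable_prod_bound muT mft (fun p => hC p.1 p.2) iCw).
rewrite [RHS](Rintegral_fubini iF ift); last first.
  move=> x; apply: (@bounded_integrable _ _ _ mu _ (C * weight x)) => [|u]; last exact: hC.
  exact: (measurableT_comp mft (measurable_pair2 x)).
have mwi : measurable_fun setT (fun x : borel_rV R d => wave_integral g x 0).
  exact: measurable_wave_integral.
rewrite [LHS]/Rintegral (integral_comb_cfun mwi).
apply: eq_Rintegral_dirac_comb.
- exact: measurable_funM.
- apply: (@measurable_Rintegral_param _ _ _ _ R mu (fun q => frequency_term g q.2 q.1)).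
  have ms : measurable_fun setT (fun q : borel_rV R d * borel_rV R d => (q.2, q.1)).
    by apply: measurable_fun_pair; [exact: measurable_snd|exact: measurable_fst].
  exact: (measurableT_comp mft ms).
move=> k; rewrite cfunE.
pose a := wave_integral g (lattice_pt k) 0; pose b := wave_integral g (lattice_pt k) (pi / 2).
(* The sine integral against [mu] vanishes since the correlation is real; the cosine integral is
   [c k]. *)
transitivity (\int[mu]_s (a * wave (lattice_pt k) 0 s + b * wave (lattice_pt k) (pi / 2) s)).
  have iW al : mu.-integrable setT (EFin \o (wave (lattice_pt k) al : borel_rV R d -> R)).
    by apply: (@bounded_integrable _ _ _ mu _ 1); [exact: measurable_wave|exact: wave_le1].
  rewrite RintegralD//; last 2 first.
  - exact: (integrableZl measurableT _ (iW _)).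
  - exact: (integrableZl measurableT _ (iW _)).
  by rewrite !RintegralZl// spectral_cos spectral_sin mulr0 addr0 mulrC.
apply: eq_Rintegral => s _; rewrite /frequency_term indicE mem_set; last by exists k.
rewrite mul1r (wave_integral_decomp _ _ (nice_integrable ng)) -/a -/b.
by rewrite cosN sinN /wave addr0 cosDpihalf; ring.
Qed.

(** The sine transform of a real function is odd in the frequency, while the correlations are
    even. *)
Lemma comb_wave_integral_pihalf (g : borel_rV R d -> R) : nice g ->
  \int[gamma]_x wave_integral g x (pi / 2) = 0.
Proof.
move=> ng; apply: odd_integral_correlation_comb.
  by apply: measurable_wave_integral => //; exact: nice_measurable.
move=> x; rewrite -[pi / 2 in LHS]opprK wave_integral_opp.
rewrite wave_integral_decomp; last exact: nice_integrable.
by rewrite cosN sinN cos_pihalf mulr0 add0r sin_pihalf mulrN1.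
Qed.

Lemma fourier_Re_Im (f : 'rV[R]_d -> R[i]) (x : 'rV[R]_d) :
  let f1 y := complex.Re (f y) in let f2 y := complex.Im (f y) in
  rapid f1 -> rapid f2 ->
  complex.Re (fourier f x) = wave_integral f1 x 0 - wave_integral f2 x (pi / 2) /\
  complex.Im (fourier f x) = wave_integral f1 x (pi / 2) + wave_integral f2 x 0.
Proof.
move=> f1 f2 /rapid_nice n1 /rapid_nice n2; rewrite /fourier /cintegral/=.
have i1 th := integrable_mul_wave x th (nice_integrable n1).
have i2 th := integrable_mul_wave x th (nice_integrable n2).
split.
  rewrite -RintegralB//; apply: eq_Rintegral => t _.
  by rewrite /f1 /f2 /wave; case: (f t) => u v /=; rewrite addr0 cosDpihalf; ring.
rewrite -RintegralD//; apply: eq_Rintegral => t _.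
by rewrite /f1 /f2 /wave; case: (f t) => u v /=; rewrite addr0 cosDpihalf; ring.
Qed.

(** The real and imaginary parts of [fourier f] produce four real integrals. Those of phase [pi / 2]
    vanish by parity, and [comb_wave_integral] evaluates the other two. *)
Lemma diffraction_fourier_transform :
  is_fourier_transform (correlation_comb P X) (periodization mu).
Proof.
split; [exact: weight_tempered weight_correlation_comb|
  exact: weight_tempered weight_periodization_spectral|].
move=> f /schwartz_rapid[r1 r2]; rewrite /cintegral.
have [n1 n2] := (rapid_nice r1, rapid_nice r2).
have i1 th := integrable_wave_integral_comb th n1.
have i2 th := integrable_wave_integral_comb th n2.
congr (_ +i* _)%C.
  rewrite -(comb_wave_integral r1) -[RHS]subr0 -[X in _ = _ - X](comb_wave_integral_pihalf n2) -RintegralB//.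
  by apply: eq_Rintegral => x _; have [E _] := fourier_Re_Im x r1 r2; exact: E.
rewrite -(comb_wave_integral r2) -[RHS]add0r -[X in _ = X + _](comb_wave_integral_pihalf n1) -RintegralD//.
by apply: eq_Rintegral => x _; have [_ E] := fourier_Re_Im x r1 r2; exact: E.
Qed.

End diffraction_formula.

Theorem theorem2p1 (R : realType) (d : nat)
    (dT : measure_display) (T : measurableType dT) (P : probability T R)
    (X : 'rV[int]_d -> {mfun T >-> bool})
    (mu : {finite_measure set (borel_rV R d) -> \bar R}) :
  stationary P X -> ergodic P X -> is_spectral_measure P X mu ->
  {ae P, forall w, is_autocorrelation (point_set X w) (correlation_comb P X)} /\
  (is_fourier_transform (correlation_comb P X) (periodization mu) /\
   {ae P, forall w, is_diffraction (point_set X w) (periodization mu)}).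
Proof.
move=> st er sp; have ac := ae_autocorrelation st er.
have ft := diffraction_fourier_transform sp.
split=> //; split=> //.
by apply: filterS ac => w hw; exists (correlation_comb P X).
Qed.
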